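(* Let $\alpha\ge 0$ and $\beta>0$, and let $p(\cdot)\in\mathcal{P}^{\infty}_{\gamma_d}(\mathbb{R}^d)\cap LH_0(\mathbb{R}^d)$ with $1<p_-\le p_+<\infty$. Then the Gaussian Bessel potential $\mathcal{J}_\beta$ is bounded from $B^{\alpha}_{p(\cdot),\infty}(\gamma_d)$ into $B^{\alpha+\beta}_{p(\cdot),\infty}(\gamma_d)$; that is, there is a constant $C>0$ (independent of $f$) such that for every $f\in B^{\alpha}_{p(\cdot),\infty}(\gamma_d)$ one has $\mathcal{J}_\beta f\in B^{\alpha+\beta}_{p(\cdot),\infty}(\gamma_d)$ and $\|\mathcal{J}_\beta f\|_{B^{\alpha+\beta}_{p(\cdot),\infty}}\le C\,\|f\|_{B^{\alpha}_{p(\cdot),\infty}}$.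
   Context: Gaussian measure: $\gamma_d(dx)=\pi^{-d/2}e^{-|x|^2}dx$ on $\mathbb{R}^d$, $|\cdot|$ the Euclidean norm. Variable exponents: an exponent is a measurable function $p(\cdot):\mathbb{R}^d\to[1,\infty]$; $p_-=\operatorname{ess\,inf}p$, $p_+=\operatorname{ess\,sup}p$. - $p(\cdot)\in LH_0(\mathbb{R}^d)$ means there is $C_1>0$ with $|p(x)-p(y)|\le \dfrac{C_1}{\log(e+1/|x-y|)}$ for all $x,y\in\mathbb{R}^d$. - $p(\cdot)\in\mathcal{P}^{\infty}_{\gamma_d}(\mathbb{R}^d)$ means there are constants $C_{\gamma_d}>0$ and $p_\infty\ge1$ with $|p(x)-p_\infty|\le \dfrac{C_{\gamma_d}}{|x|^2}$ for all $x\in\mathbb{R}^d\setminus\{0\}$. Variable Lebesgue space: for $p_+<\infty$, $\|f\|_{p(\cdot),\gamma_d}=\inf\{\lambda>0:\int_{\mathbb{R}^d}|f(x)/\lambda|^{p(x)}\gamma_d(dx)\le1\}$, and $L^{p(\cdot)}(\gamma_d)$ is the set of measurable $f$ for which $\int_{\mathbb{R}^d}|f(x)/\lambda|^{p(x)}\gamma_d(dx)<\infty$ for some $\lambda>0$. Semigroups: the Ornstein–Uhlenbeck semigroup is $T_tf(x)=\int_{\mathbb{R}^d}f(\sqrt{1-e^{-2t}}\,u+e^{-t}x)\,\gamma_d(du)$, $t\ge0$, and the Poisson–Hermite semigroup is $P_tf(x)=\frac{1}{\sqrt{\pi}}\int_0^\infty\frac{e^{-u}}{\sqrt{u}}T_{t^2/4u}f(x)\,du$.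 (With $L=\frac12\Delta_x-\langle x,\nabla_x\rangle$, $T_t$ has generator $L$ and $P_t$ has generator $-(-L)^{1/2}$.) Gaussian Bessel potential: for $\beta>0$, $\mathcal{J}_\beta=(I+\sqrt{-L})^{-\beta}$, given by $$\mathcal{J}_\beta f(x)=\frac{1}{\Gamma(\beta)}\int_0^{\infty}t^{\beta}e^{-t}P_tf(x)\,\frac{dt}{t}.$$ Variable Gaussian Besov–Lipschitz space with $q=\infty$: for $\alpha\ge0$ let $k$ be the smallest integer greater than $\alpha$. $B^{\alpha}_{p(\cdot),\infty}(\gamma_d)$ is the set of $f\in L^{p(\cdot)}(\gamma_d)$ for which there is a constant $A$ with $\left\|\frac{\partial^kP_tf}{\partial t^k}\right\|_{p(\cdot),\gamma_d}\le A\,t^{-k+\alpha}$ for all $t>0$; its norm is $\|f\|_{B^{\alpha}_{p(\cdot),\infty}}=\|f\|_{p(\cdot),\gamma_d}+A_k(f)$, where $A_k(f)$ is the smallest such $A$. *)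

(* Defs.v *)
From HB Require Import structures.
From mathcomp Require Import all_boot all_order all_algebra.
From mathcomp Require Import all_classical all_reals all_analysis.
From mathcomp Require Import measurable_realfun ess_sup_inf.

Set Implicit Arguments.
Unset Strict Implicit.
Unset Printing Implicit Defensive.

Import Order.TTheory GRing.Theory Num.Theory.
Import numFieldNormedType.Exports.

Local Open Scope classical_set_scope.
Local Open Scope ring_scope.

(* Points of R^d are [d.-tuple R]: this type carries the product (hence Borel)
   sigma-algebra in the library, whereas ['rV[R]_d] carries none. *)

Section lebesgue_tuple.
Context {R : realType}.

Definition cons_pair n (z : measurableTypeR R * n.-tuple R) : n.+1.-tuple R :=
  [tuple of z.1 :: z.2].

Definition uncons n (x : n.+1.-tuple R) : measurableTypeR R * n.-tuple R :=
  (thead x, [tuple of behead x]).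

Lemma cons_pairK n : cancel (@cons_pair n) (@uncons n).
Proof. by move=> [a x]; congr pair; apply/val_inj. Qed.

Lemma measurable_cons_pair n :
  measurable_fun [set: measurableTypeR R * n.-tuple R] (@cons_pair n).
Proof. exact: measurable_cons. Qed.

Lemma measurable_uncons n : measurable_fun [set: n.+1.-tuple R] (@uncons n).
Proof.
apply/measurable_fun_pairP; split => /=; first exact: measurable_tnth.
exact: measurable_behead.
Qed.

Section cons_measure.
Context n (mu : {sigma_finite_measure set (n.-tuple R) -> \bar R}).

Let product : {measure set (measurableTypeR R * n.-tuple R) -> \bar R} :=
  (@lebesgue_measure R \x mu)%E.

Definition cons_measure : set (n.+1.-tuple R) -> \bar R :=
  pushforward product (@cons_pair n).

Let cons_measure0 : cons_measure set0 = 0%E.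
Proof. by rewrite /cons_measure /pushforward preimage_set0 measure0. Qed.

Let cons_measure_ge0 A : (0 <= cons_measure A)%E.
Proof. exact: (measure_ge0 product). Qed.

Let cons_measure_sigma_additive : semi_sigma_additive cons_measure.
Proof.
have mC (A : set (n.+1.-tuple R)) : measurable A ->
    measurable (@cons_pair n @^-1` A).
  by move=> mA; rewrite -[X in measurable X]setTI; exact: measurable_cons_pair.
move=> F mF tF mUF; rewrite /cons_measure /pushforward preimage_bigcup.
apply: measure_semi_sigma_additive.
- by move=> i; exact: mC.
- apply/trivIsetP => /= i j _ _ ij; rewrite -preimage_setI.
  by move/trivIsetP : tF => /(_ _ _ _ _ ij) ->//; rewrite preimage_set0.
- by rewrite -preimage_bigcup; exact: mC.
Qed.

HB.instance Definition _ := isMeasure.Build _ _ _ cons_measure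
  cons_measure0 cons_measure_ge0 cons_measure_sigma_additive.

Let cons_measure_sigma_finite : sigma_finite setT cons_measure.
Proof.
have /sigma_finiteP[F [TF ndF Foo]] := sigma_finiteT (@lebesgue_measure R).
have /sigma_finiteP[G [TG ndG Goo]] := sigma_finiteT mu.
exists (fun i => @uncons n @^-1` (F i `*` G i)).
  rewrite -preimage_bigcup (_ : \bigcup_i _ = setT) ?preimage_setT//.
  rewrite -setXTT TF TG predeqE => -[x y]; split.
    by move=> [i _ []/= ? ?]; split; exists i.
  move=> [/= [i _ Fix] [k _ Gky]]; exists (maxn i k) => //; split.
  - by move: x Fix; exact/subsetPset/ndF/leq_maxl.
  - by move: y Gky; exact/subsetPset/ndG/leq_maxr.
move=> i; have [mF Fi] := Foo i; have [mG Gi] := Goo i; split.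
  rewrite -[X in measurable X]setTI; apply: measurable_uncons => //.
  exact: measurableX.
rewrite /cons_measure /pushforward -comp_preimage.
rewrite (_ : _ \o _ = id); last by apply/funext => z /=; rewrite cons_pairK.
rewrite preimage_id /product/= product_measure1E//.
by rewrite lte_mul_pinfty// ge0_fin_numE.
Qed.

HB.instance Definition _ := Measure_isSigmaFinite.Build _ _ _ cons_measure
  cons_measure_sigma_finite.

End cons_measure.

Fixpoint lebesgue_tuple (n : nat) :
    {sigma_finite_measure set (n.-tuple R) -> \bar R} :=
  if n is m.+1 then cons_measure (lebesgue_tuple m) else \d_([tuple]).

End lebesgue_tuple.

Section euclidean.
Context {R : realType} {d : nat}.
Implicit Types x y : d.-tuple R.

Definition tuple_zero : d.-tuple R := [tuple 0 | i < d].

Definition tuple_sub x y : d.-tuple R := [tuple tnth x i - tnth y i | i < d].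

Definition tuple_lincomb (a : R) x (b : R) y : d.-tuple R :=
  [tuple a * tnth x i + b * tnth y i | i < d].

Definition enorm x : R := Num.sqrt (\sum_(i < d) tnth x i ^+ 2).

Lemma measurable_enorm : measurable_fun setT enorm.
Proof.
apply: (@measurableT_comp _ _ _ _ _ _ (@Num.sqrt R)).
  apply: continuous_measurable_fun; exact: sqrt_continuous.
by apply: measurable_sum => i; apply: measurable_funX; exact: measurable_tnth.
Qed.

End euclidean.

Section gaussian.
Context {R : realType} (d : nat).

Definition gauss_density (x : d.-tuple R) : R :=
  pi `^ (- (d%:R / 2)) * expR (- enorm x ^+ 2).

Lemma gauss_density_ge0 x : 0 <= gauss_density x.
Proof. by rewrite mulr_ge0 ?powR_ge0 ?expR_ge0. Qed.

Lemma measurable_gauss_density : measurable_fun setT gauss_density.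
Proof.
apply: measurable_funM => //; apply: measurableT_comp => //.
by apply: measurableT_comp => //; apply: measurable_funX; exact: measurable_enorm.
Qed.

Definition gauss_measure (A : set (d.-tuple R)) : \bar R :=
  (\int[lebesgue_tuple d]_(x in A) (gauss_density x)%:E)%E.

Let gauss_measure0 : gauss_measure set0 = 0%E.
Proof. by rewrite /gauss_measure integral_set0. Qed.

Let gauss_measure_ge0 A : (0 <= gauss_measure A)%E.
Proof. by apply: integral_ge0 => x _; rewrite lee_fin gauss_density_ge0. Qed.

Let gauss_measure_sigma_additive : semi_sigma_additive gauss_measure.
Proof.
move=> A mA tA mUA; rewrite /gauss_measure ge0_integral_bigcup//=.
- apply: is_cvg_ereal_nneg_natsum_cond => n _ _.
  exact: gauss_measure_ge0.
- apply/measurable_EFinP; apply: measurable_funTS.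
  exact: measurable_gauss_density.
- by move=> x _; rewrite lee_fin gauss_density_ge0.
Qed.

HB.instance Definition _ := isMeasure.Build _ _ _ gauss_measure
  gauss_measure0 gauss_measure_ge0 gauss_measure_sigma_additive.

End gaussian.

Arguments gauss_measure {R} d A.

Section variable_exponent.
Context {R : realType} {d : nat}.
Implicit Types (p : d.-tuple R -> \bar R) (f : d.-tuple R -> R).

Definition exponent p := measurable_fun setT p /\ forall x, (1 <= p x)%E.

Definition exponent_inf p : \bar R := ess_inf (lebesgue_tuple d) p.

Definition exponent_sup p : \bar R := ess_sup (lebesgue_tuple d) p.

(* The values of [p] are extended reals and [`|+oo - +oo| = +oo], so both
   conditions below can only hold at points where [p] is finite.
   For x = y the bound reads [C1], as [0^-1 = 0], instead of the limit value 0: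
   both are trivially true for a finite [p x]. *)
Definition LH0 p := exists2 C1 : R, 0 < C1 & forall x y,
  (`|p x - p y| <= (C1 / ln (expR 1 + 1 / enorm (tuple_sub x y)))%R%:E)%E.

Definition P_infty_gauss p :=
  exists C p_infty : R, [/\ 0 < C, 1 <= p_infty &
    forall x, x != tuple_zero ->
      (`|p x - p_infty%:E| <= (C / enorm x ^+ 2)%R%:E)%E].

(* [fine (p x)] is [p x] for almost every [x], since [L^p(.)] is only
   considered here when [ess_sup p < +oo]. *)
Definition modular p f : \bar R :=
  (\int[gauss_measure d]_x (`|f x| `^ fine (p x))%:E)%E.

Definition lux_norm p f : \bar R :=
  ereal_inf [set l%:E | l in
    [set l : R | 0 < l /\ (modular p (fun x => (f x / l)%R) <= 1)%E]].

Definition Lvar p f := measurable_fun setT f /\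
  exists2 l : R, 0 < l & (modular p (fun x => (f x / l)%R) < +oo)%E.

End variable_exponent.

Section semigroups.
Context {R : realType} {d : nat}.
Implicit Types (f : d.-tuple R -> R) (x : d.-tuple R).

Definition ornstein_uhlenbeck (t : R) f x : R :=
  \int[gauss_measure d]_u
    f (tuple_lincomb (Num.sqrt (1 - expR (- (2 * t)))) u (expR (- t)) x).

Definition poisson_hermite (t : R) f x : R :=
  (Num.sqrt pi)^-1 *
  \int[lebesgue_measure]_(u in `]0, +oo[)
    (expR (- u) / Num.sqrt u * ornstein_uhlenbeck (t ^+ 2 / (4 * u)) f x).

Definition Gamma (b : R) : R :=
  \int[lebesgue_measure]_(t in `]0, +oo[) (t `^ (b - 1) * expR (- t)).

(* The integral converges absolutely for almost every [x] when [f] is in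
   [L^p(.)]; on the remaining null set the value is that of [Rintegral]. *)
Definition bessel_potential (b : R) f x : R :=
  (Gamma b)^-1 *
  \int[lebesgue_measure]_(t in `]0, +oo[)
    (t `^ b * expR (- t) * poisson_hermite t f x / t).

End semigroups.

Section besov_lipschitz.
Context {R : realType} {d : nat}.
Implicit Types (a : R) (p : d.-tuple R -> \bar R) (f : d.-tuple R -> R).

(* The smallest integer (strictly) greater than [a], for [0 <= a]. *)
Definition besov_order a : nat := (Num.truncn a).+1.

Lemma besov_orderP a (m : int) : 0 <= a ->
  (a < m%:~R) = ((besov_order a)%:Z <= m).
Proof.
move=> a0; rewrite /besov_order; case: m => m.
  by rewrite -truncn_lt_nat.
by apply/negbTE; rewrite -leNgt (le_trans _ a0)// NegzE mulrNz oppr_le0.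
Qed.

Definition dt_poisson_hermite (k : nat) (t : R) f : d.-tuple R -> R :=
  fun x => derive1n k (fun s => poisson_hermite s f x) t.

Definition besov_bound a p f (A : R) := forall t, 0 < t ->
  (lux_norm p (dt_poisson_hermite (besov_order a) t f)
     <= (A * t `^ (- (besov_order a)%:R + a))%R%:E)%E.

Definition besov a p f := Lvar p f /\ exists A, besov_bound a p f A.

Definition besov_seminorm a p f : \bar R :=
  ereal_inf [set A%:E | A in besov_bound a p f].

Definition besov_norm a p f : \bar R :=
  (lux_norm p f + besov_seminorm a p f)%E.

End besov_lipschitz.

(* Main.v *)
(* Write [k] for the order attached to [alpha + beta] and [k0 <= k] for the one
   attached to [alpha].  By the semigroup property,
   [d^k/dt^k P_t f = d^(k-k0)/dt^(k-k0) P_(t/2) (d^k0/dt^k0 P_(t/2) f)], and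
   [t d/dt P_t] is bounded on [L^p(.)] uniformly in [t], so the assumption on [f]
   gives [||d^k/dt^k P_t f|| <= C A t^(alpha - k)].  The derivatives commute with
   [J_beta], hence
   [d^k/dt^k P_t (J_beta f) = 1/Gamma(beta) \int s^beta e^-s (d^k P_(s+t) f) ds/s],
   and Minkowski's inequality reduces the theorem to
   [\int_0^oo s^(beta-1) (s+t)^(alpha-k) ds <= C t^(alpha+beta-k)], valid because
   [0 < beta < k - alpha].

   Uniform boundedness on [L^p(.)] follows by subordination from that of the
   Ornstein-Uhlenbeck semigroup [T_t], proved directly: [T_t] is symmetric for the
   Gaussian measure, its kernel is that of the convolution with a Gaussian of
   width [delta = (1 - e^(-2t))^(1/2)], and a variable exponent costs a factor
   [(delta^-d e^(|x|^2))^|p(x) - p(y)|] at [y = e^-t x + delta u].  The decay of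
   [p - p_oo] bounds [|p(x) - p(y)| |x|^2], while log-Hoelder continuity bounds
   [|p(x) - p(y)| log(1/delta)] by a multiple of [1 + |u|], which is
   exponentially integrable. *)
Require Import Defs.
From HB Require Import structures.
From mathcomp Require Import all_boot all_order all_algebra.
From mathcomp Require Import all_classical all_reals all_analysis.
From mathcomp Require Import measurable_realfun ring lra.

Set Implicit Arguments.
Unset Strict Implicit.
Unset Printing Implicit Defensive.

Import Order.TTheory GRing.Theory Num.Theory.
Import numFieldNormedType.Exports.

Local Open Scope classical_set_scope.
Local Open Scope ring_scope.

(** * Change of variables on the line *)

(** Jensen's inequality fails when the exponent at the point of evaluation differs from the
    exponents at the averaged points. An average [S] is therefore compared with powers through the
    threshold [S / 2], which costs a factor 2 and leaves [(S / 2) ^ (q x - q y)] as the only trace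
    of the variable exponent. This factor is under control only for bounded [S]: hence [f / l] is
    cut at height 1, its large part has integral at most 1, and the Mehler kernel bounds [S]. The
    estimates concern admissible levels, [lux_le q f l], rather than the Luxemburg infimum, which
    reappears only at the end.

    Semigroup identities are proved for nonnegative extended-valued functions, where Tonelli and
    explicit substitutions suffice, and are transferred to L1, which contains L^p(.).

    Only one time derivative is ever taken under an integral sign: at the price of half of the time
    it becomes an operator [dSub (t / 2)], and higher derivatives are compositions of such
    operators, which commute with every other operator in play. *)

Section weighted_pushforward.
Context d1 d2 (T1 : measurableType d1) (T2 : measurableType d2) (R : realType).
Variables (mu : {measure set T1 -> \bar R}) (phi : T1 -> T2) (w : T1 -> R).
Hypothesis mphi : measurable_fun setT phi.
Hypothesis mw : measurable_fun setT w.
Hypothesis w0 : forall x, 0 <= w x.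

Import HBNNSimple.

Local Open Scope ereal_scope.

(** Both sides are monotone limits along the simple approximations of [G], for which they agree
    level set by level set. With [phi := id] it is integration against a density, which covers the
    Gaussian measure and the restriction of Lebesgue measure to a set. *)
Lemma ge0_integral_weighted_pushforward (nu : {measure set T2 -> \bar R}) :
  (forall A, measurable A -> nu A = \int[mu]_(x in phi @^-1` A) (w x)%:E) ->
  forall G : T2 -> \bar R, measurable_fun setT G -> (forall y, 0 <= G y) ->
  \int[nu]_y G y = \int[mu]_x (G (phi x) * (w x)%:E).
Proof.
move=> nuE G mG G0.
pose f_ := nnsfun_approx measurableT mG.
have fG y : (f_ n y)%:E @[n --> \oo] --> G y.
  by apply: cvg_nnsfun_approx.
have fnd y m n : (m <= n)%N -> (f_ m y <= f_ n y)%R.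
  by move=> mn; exact/lefP/nd_nnsfun_approx.
transitivity (limn (fun n => \int[nu]_y (f_ n y)%:E)).
  rewrite -monotone_convergence//.
  - by apply: eq_integral => y _; apply/esym/cvg_lim => //; exact: fG.
  - by move=> n; exact/measurable_EFinP/measurable_funP.
  - by move=> n y _; rewrite lee_fin.
  - by move=> y _ m n mn; rewrite lee_fin; exact: fnd.
rewrite [X in limn X](_ : _ =
    (fun n => \int[mu]_x ((f_ n (phi x))%:E * (w x)%:E))).
  rewrite -monotone_convergence//.
  - apply: eq_integral => x _; apply/cvg_lim => //.
    by apply: cvgeZr => //; exact: fG.
  - move=> n; apply: emeasurable_funM; apply/measurable_EFinP => //.
    by apply: measurableT_comp => //; exact: measurable_funP.
  - by move=> n x _; rewrite mule_ge0 ?lee_fin.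
  - move=> x _ m n mn; rewrite lee_wpmul2r ?lee_fin//; exact: fnd.
apply/funext => n.
under eq_integral do rewrite fimfunE -fsumEFin//.
rewrite ge0_integral_fsum//; last 2 first.
- by move=> y; apply/measurable_EFinP; exact: measurable_funM.
- by move=> y x _; rewrite nnfun_muleindic_ge0.
transitivity (\int[mu]_x (\sum_(k \in range (f_ n))
    (k * \1_(f_ n @^-1` [set k]) (phi x))%:E * (w x)%:E)); last first.
  apply: eq_integral => x _.
  rewrite [in RHS]fimfunE -fsumEFin// ge0_mule_fsuml// => i.
  by rewrite nnfun_muleindic_ge0.
rewrite ge0_integral_fsum//; last 2 first.
- move=> y; apply/emeasurable_funM; apply/measurable_EFinP => //.
  by apply: measurable_funM => //; apply: measurableT_comp.
- by move=> y x _; rewrite mule_ge0 ?lee_fin ?w0// -lee_fin nnfun_muleindic_ge0.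
apply: eq_fsbigr => r rf.
have mA : measurable (f_ n @^-1` [set r]) by [].
have [->|rn0] := eqVneq r 0%R.
  by rewrite !integral0_eq// => x _; rewrite mul0r ?mul0e.
under eq_integral do rewrite EFinM.
under [RHS]eq_integral do rewrite EFinM -muleA.
have r0 : (0 <= r)%R by move: rf; rewrite inE => -[x _ <-].
rewrite ge0_integralZl_EFin//; last exact/measurable_EFinP.
rewrite ge0_integralZl_EFin//; last 2 first.
  by move=> x _; rewrite mule_ge0 ?lee_fin.
  apply/emeasurable_funM; apply/measurable_EFinP => //.
  by apply: (measurableT_comp (measurable_indic mA) mphi).
rewrite integral_indic// setIT nuE//; congr (_ * _).
rewrite integral_mkcond; apply: eq_integral => x _.
rewrite /patch indicE; case: ifPn => xA.
  by rewrite mem_set ?mul1e//; move: xA; rewrite inE.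
by rewrite memNset ?mul0e//; move: xA; rewrite notin_setE.
Qed.

End weighted_pushforward.

Section integral_substitution.
Context {R : realType}.
Notation mu := (@lebesgue_measure R).
Variables (I : set (measurableTypeR R)) (phi w : R -> R).
Hypotheses (mI : measurable I)
  (mphi : measurable_fun [set: measurableTypeR R] (phi : _ -> measurableTypeR R))
  (mw : measurable_fun [set: measurableTypeR R] w) (w0 : forall x, 0 <= w x).

Let nu (A : set (measurableTypeR R)) : \bar R :=
  (\int[mu]_(x in (phi : measurableTypeR R -> measurableTypeR R) @^-1` A) (w x)%:E)%E.

Let nu0 : nu set0 = 0%E.
Proof. by rewrite /nu preimage_set0 integral_set0. Qed.

Let nu_ge0 A : (0 <= nu A)%E.
Proof. by apply: integral_ge0 => x _; rewrite lee_fin. Qed.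

Let nu_sigma : semi_sigma_additive nu.
Proof.
have mC A : measurable A -> measurable ((phi : measurableTypeR R -> measurableTypeR R) @^-1` A).
  by move=> mA; rewrite -[X in measurable X]setTI; exact: mphi.
move=> F mF tF mUF; rewrite /nu preimage_bigcup ge0_integral_bigcup//.
- apply: is_cvg_ereal_nneg_natsum_cond => n _ _; exact: nu_ge0.
- by move=> n; exact: mC.
- by apply/measurable_EFinP; exact: measurable_funTS.
- by move=> x _; rewrite lee_fin.
- apply/trivIsetP => /= i j _ _ ij; rewrite -preimage_setI.
  by move/trivIsetP : tF => /(_ _ _ _ _ ij) ->//; rewrite preimage_set0.
Qed.

Let nuM : {measure set (measurableTypeR R) -> \bar R} :=
  HB.pack nu (isMeasure.Build _ _ _ nu nu0 nu_ge0 nu_sigma).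

Hypothesis nuI : forall a b, a < b ->
  (\int[mu]_(x in [set x | (phi x \in `]a, b])%R]) (w x)%:E)%E
    = mu (`]a, b]%classic `&` I).

(** The image of [w dx] under [phi] and Lebesgue measure restricted to [I] agree on the half-open
    intervals, a generating family stable under intersection, and the intervals []-n, n]] of finite
    measure exhaust the line. Hence [nuI], which a primitive of [w] provides, is enough. *)
Lemma ge0_integral_substitution (G : R -> \bar R) :
  measurable_fun [set: measurableTypeR R] G -> (forall y, 0 <= G y)%E ->
  (\int[mu]_(y in I) G y = \int[mu]_x (G (phi x) * (w x)%:E))%E.
Proof.
move=> mG G0.
rewrite -(@ge0_integral_weighted_pushforward _ _ (measurableTypeR R)
  (measurableTypeR R) R mu phi w mphi mw w0 nuM)//.
have m1 : measurable_fun [set: measurableTypeR R] (\1_I : _ -> R).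
  exact: measurable_indic.
have -> : (\int[mu]_(y in I) G y = \int[mrestr mu mI]_y G y)%E.
  rewrite (@ge0_integral_weighted_pushforward _ _ (measurableTypeR R)
    (measurableTypeR R) R mu id \1_I (@measurable_id _ _ _) m1 _ (mrestr mu mI))//.
    by have := @integral_mkcond _ (measurableTypeR R) R mu I G; rewrite epatch_indic.
  by move=> A mA; rewrite integral_indic// setIC.
apply: eq_measure_integral => A mA _.
refine (@measure_unique _ R (measurableTypeR R) (@ocitv R)
  (fun n : nat => `](- n%:R : R), n%:R]%classic) _ _ _ _ (mrestr mu mI) nuM _ _ A mA) => //.
- move=> _ _ [[a b] _ <-] [[c e] _ <-]; exists (Num.max a c, Num.min b e) => //=.
  apply/seteqP; split => x /=; rewrite !in_itv/= gt_max le_min.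
    by move=> /andP[/andP[-> ->] /andP[-> ->]].
  by move=> [/andP[-> ->] /andP[-> ->]].
- by move=> n; exists (- n%:R, n%:R).
- exact: bigcup_itvT.
- move=> _ [[a b] _ <-] /=; rewrite /mrestr.
  have [ba|ab] := leP b a.
    by rewrite set_itv_ge ?bnd_simp -?leNgt// set0I measure0 nu0.
  by rewrite -nuI.
- move=> n; rewrite /= /mrestr.
  apply: (@le_lt_trans _ _ (mu `](- n%:R), n%:R]%classic)).
    by apply: le_measure; rewrite ?inE//; exact: measurableI.
  by rewrite lebesgue_measure_itv/=; case: ifP => _; rewrite ltry.
Qed.

End integral_substitution.

Section monotone_change_of_variables.
Context {R : realType}.
Notation mu := (@lebesgue_measure R).
Variables (phi psi w : R -> R).
Hypothesis psiK : cancel psi phi.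
Hypothesis phi_incr : {homo phi : x y / x < y}.
Hypothesis cw : continuous w.
Hypothesis w0 : forall x, 0 <= w x.
Hypothesis dphi : forall x : R, is_derive x 1 phi (w x).

Let cphi : continuous phi.
Proof.
move=> x; apply: differentiable_continuous; apply/derivable1_diffP.
exact: ex_derive.
Qed.

Let mw : measurable_fun [set: measurableTypeR R] w.
Proof. exact: continuous_measurable_fun. Qed.

Let phi_mono x y : (phi x <= phi y) = (x <= y).
Proof. by apply: le_mono => ? ?; exact: phi_incr. Qed.

Let phi_smono x y : (phi x < phi y) = (x < y).
Proof. by apply: leW_mono => ? ?; exact: phi_mono. Qed.

(** By the fundamental theorem of calculus the interval []psi a, psi b]] has [w]-mass
    [phi (psi b) - phi (psi a) = b - a]. *)
Lemma ge0_integral_change_of_variables (G : R -> \bar R) :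
  measurable_fun [set: measurableTypeR R] G -> (forall y, 0 <= G y)%E ->
  (\int[mu]_y G y = \int[mu]_x (G (phi x) * (w x)%:E))%E.
Proof.
apply: ge0_integral_substitution => //.
  exact: continuous_measurable_fun.
move=> a b ab; rewrite setIT.
have -> : [set x | (phi x \in `]a, b])%R] = `]psi a, psi b]%classic.
  apply/seteqP; split => x /=;
  by rewrite !in_itv/= -(phi_smono (psi a)) -(phi_mono _ (psi b)) !psiK.
rewrite lebesgue_measure_itv/= lte_fin ab integral_itv_obnd_cbnd; last first.
  by apply/measurable_EFinP; exact: measurable_funTS.
rewrite (@continuous_FTC2 _ w phi).
- by rewrite !psiK.
- by rewrite -phi_smono !psiK.
- by apply: continuous_subspaceT.
- split; last 2 first.
  + exact/cvg_at_right_filter/cphi.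
  + exact/cvg_at_left_filter/cphi.
  by move=> x _; exact: ex_derive.
- by move=> x _; rewrite derive1E; apply: derive_val.
Qed.

End monotone_change_of_variables.

Section special_substitutions.
Context {R : realType}.
Notation mu := (@lebesgue_measure R).
Implicit Type G : R -> \bar R.
Local Open Scope ereal_scope.

Let FTC_expR (a b : R) : (a < b)%R ->
  \int[mu]_(x in `]a, b]) (expR x)%:E = (expR b - expR a)%:E.
Proof.
move=> ab; rewrite integral_itv_obnd_cbnd; last first.
  by apply/measurable_EFinP; exact: measurable_funTS.
rewrite (@continuous_FTC2 _ expR expR) ?EFinB//.
- by apply: continuous_subspaceT; exact: continuous_expR.
- split => [x _||]; first exact: derivable_expR.
  + exact/cvg_at_right_filter/continuous_expR.
  + exact/cvg_at_left_filter/continuous_expR.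
- by move=> x _; rewrite derive1E; apply: derive_val.
Qed.

Let FTC_expRNy (b : R) :
  \int[mu]_(x in `]-oo, b]) (expR x)%:E = (expR b)%:E.
Proof.
have H : \int[mu]_(x in `](b - n.+1%:R)%R, b]%classic) (expR x)%:E @[n --> \oo]
    --> \int[mu]_(x in \bigcup_n `](b - n.+1%:R)%R, b]%classic) (expR x)%:E.
  apply: ge0_nondecreasing_set_cvg_integral => //.
  - move=> m n mn; apply/subsetPset; apply: subset_itvr.
    by rewrite bnd_simp lerB// ler_nat ltnS.
  - by move=> n; apply/measurable_EFinP; exact: measurable_funTS.
have E : \bigcup_n `](b - n.+1%:R)%R, b]%classic = `]-oo, b]%classic :> set R.
  apply/seteqP; split => x /=; rewrite ?in_itv/=.
    by move=> [n _] /=; rewrite in_itv/= => /andP[].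
  move=> xb; exists (Num.trunc (b - x)) => //=; rewrite in_itv/= xb andbT.
  by rewrite ltrBlDr -ltrBlDl truncnS_gt.
rewrite E in H; apply/esym/(cvg_unique _ _ H) => //.
apply: (@cvg_trans _ ((fun n : nat => (expR b - expR (b - n.+1%:R))%:E) @ \oo)).
  apply: near_eq_cvg; apply: nearW => n; apply/esym/FTC_expR.
  by rewrite ltrBlDr ltrDl.
apply: cvg_EFin; first by apply: nearW.
rewrite -[X in _ --> X]subr0; apply: cvgB; first exact: cvg_cst.
rewrite (_ : (fun n => _) = (fun n => (expR b * expR (- n.+1%:R))%R)); last first.
  by apply/funext => n; rewrite expRD.
rewrite -[X in _ --> X](mulr0 (expR b)); apply: cvgM; first exact: cvg_cst.
apply: (@cvg_comp _ _ _ (fun n => n.+1%:R) (fun x => expR (- x))%R _ (+oo%R)).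
  rewrite (cvg_shiftS (fun n => n%:R : R)); exact: cvgr_idn.
exact: cvgr_expR.
Qed.

(** The exponential is not onto the line, so the preimage of []a, b]] is empty, a half-line or an
    interval according to the position of 0; the half-line has [expR]-mass [expR (ln b) = b]. *)
Lemma ge0_integral_expR_substitution G :
  measurable_fun [set: measurableTypeR R] G -> (forall y, 0 <= G y) ->
  \int[mu]_(y in `]0%R, +oo[) G y = \int[mu]_x (G (expR x) * (expR x)%:E).
Proof.
apply: ge0_integral_substitution => //.
move=> a b ab.
have [b0|b0] := leP b 0%R.
  rewrite (_ : [set x : R | (expR x \in `]a, b])%R] = set0) ?integral_set0; last first.
    apply/seteqP; split => // x /=; rewrite in_itv/= => /andP[_].
    by rewrite leNgt (le_lt_trans b0 (expR_gt0 _)).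
  rewrite (_ : _ `&` _ = set0) ?measure0//.
  apply/seteqP; split => // x /=; rewrite !in_itv/= andbT => -[/andP[_ xb]].
  by rewrite ltNge (le_trans xb).
have [a0|a0] := leP a 0%R.
  rewrite (_ : [set x : R | (expR x \in `]a, b])%R] = `]-oo, ln b]%classic); last first.
    apply/seteqP; split => // x /=; rewrite !in_itv/=.
      by move=> /andP[_]; rewrite -[(x <= ln b)%R]ler_expR lnK.
    by rewrite (le_lt_trans a0 (expR_gt0 _))/= -[(x <= ln b)%R]ler_expR lnK.
  rewrite FTC_expRNy lnK//.
  rewrite (_ : _ `&` _ = `]0%R, b]%classic) ?lebesgue_measure_itv/= ?lte_fin ?b0 ?sube0//.
  apply/seteqP; split => // x /=; rewrite !in_itv/= andbT.
    by move=> [/andP[_ ->] ->].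
  by move=> /andP[x0 xb]; rewrite xb (le_lt_trans a0 x0).
have -> : [set x : R | (expR x \in `]a, b])%R] = `]ln a, ln b]%classic.
  apply/seteqP; split => x /=;
  by rewrite !in_itv/= -(@ltr_expR _ (ln a)) -(@ler_expR _ _ (ln b)) !lnK.
rewrite FTC_expR ?ltr_ln// !lnK//.
rewrite (_ : _ `&` _ = `]a, b]%classic) ?lebesgue_measure_itv/= ?lte_fin ?ab//.
apply/seteqP; split => // x /=; rewrite !in_itv/= andbT.
by move=> /andP[x0 xb]; rewrite x0 xb (lt_trans a0 x0).
Qed.

Lemma ge0_integral_affine (a b : R) G : (0 < a)%R ->
  measurable_fun [set: measurableTypeR R] G -> (forall y, 0 <= G y) ->
  \int[mu]_y G y = \int[mu]_x (G (a * x + b)%R * a%:E).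
Proof.
move=> a0; have an0 := lt0r_neq0 a0.
apply: (@ge0_integral_change_of_variables _ (fun x => a * x + b)%R
    (fun y => (y - b) / a)%R (cst a)) => //=.
- by move=> x; rewrite mulrC divfK// subrK.
- by move=> x y xy; rewrite ltrD2r ltr_pM2l.
- by move=> x; exact: cvg_cst.
- by move=> x; exact: ltW.
- by move=> x; apply: is_derive_eq; rewrite addr0 scaler1.
Qed.

Lemma ge0_integral_opp G :
  measurable_fun [set: measurableTypeR R] G -> (forall y, 0 <= G y) ->
  \int[mu]_y G y = \int[mu]_x G (- x)%R.
Proof.
move=> mG G0.
rewrite -[RHS](@ge0_integral_pushforward _ _ (measurableTypeR R)
  (measurableTypeR R) R -%R _ mu setT)//=.
by apply: eq_measure_integral => A mA _; apply/esym/lebesgue_measureN.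
Qed.

(** The substitution is [y = 2 sinh x]; its inverse is explicit because [e^x] is the positive root
    of [X^2 - z X - 1]. *)
Lemma ge0_integral_sinh G :
  measurable_fun [set: measurableTypeR R] G -> (forall y, 0 <= G y) ->
  \int[mu]_y G y = \int[mu]_x (G (expR x - expR (- x))%R * (expR x + expR (- x))%:E).
Proof.
pose s (z : R) : R := Num.sqrt (z ^+ 2 + 4).
have s2 z : (s z ^+ 2 = z ^+ 2 + 4)%R.
  by rewrite sqr_sqrtr// addr_ge0// sqr_ge0.
have sz z : (`|z| < s z)%R.
  rewrite -sqrtr_sqr ltr_sqrt ?ltrDl// ltr_wpDl ?sqr_ge0//.
have zs z : (0 < z + s z)%R.
  by have := sz z; rewrite ltr_norml => /andP[+ _]; rewrite -subr_gt0 opprK addrC.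
apply: (@ge0_integral_change_of_variables _ (fun x => expR x - expR (- x))%R
    (fun z => ln ((z + s z) / 2)) (fun x => expR x + expR (- x)))%R => //=.
- move=> z; rewrite expRN lnK; last by rewrite posrE divr_gt0.
  have : (s z ^+ 2 = z ^+ 2 + 4)%R by [].
  have := zs z; move: (s z) => u u0 uz.
  have n0 : (z + u != 0)%R by rewrite gt_eqF.
  have -> : (((z + u) / 2)^-1 = (u - z) / 2)%R.
    have u2 : ((z + u) * (u - z) = 4)%R.
      by transitivity (u ^+ 2 - z ^+ 2)%R; [ring|rewrite uz; ring].
    by apply: (mulfI n0); rewrite mulrA u2; field; rewrite n0.
  by field.
- by move=> x y xy; rewrite ltrB// ltr_expR// ltrN2.
- move=> x; apply: cvgD; first exact: continuous_expR.
  apply: (@continuous_comp _ _ _ -%R expR); first exact: opp_continuous.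
  exact: continuous_expR.
- by move=> x; apply: is_derive_eq; rewrite mulrN1 opprK.
Qed.

End special_substitutions.

(** * The Ornstein-Uhlenbeck semigroup and the Mehler kernel *)

Section euclidean_tuples.
Context {R : realType}.

Lemma enormE d (x : d.-tuple R) : enorm x ^+ 2 = \sum_(i < d) tnth x i ^+ 2.
Proof. by rewrite sqr_sqrtr// sumr_ge0// => i _; exact: sqr_ge0. Qed.

Lemma enorm_ge0 d (x : d.-tuple R) : 0 <= enorm x.
Proof. exact: sqrtr_ge0. Qed.

Lemma tnth_lincomb d (a b : R) (x y : d.-tuple R) i :
  tnth (tuple_lincomb a x b y) i = a * tnth x i + b * tnth y i.
Proof. by rewrite tnth_mktuple. Qed.

Lemma enorm_cons n (z : measurableTypeR R * n.-tuple R) :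
  enorm (cons_pair z) ^+ 2 = z.1 ^+ 2 + enorm z.2 ^+ 2.
Proof.
rewrite !enormE big_ord_recl; congr (_ + _).
by apply: eq_bigr => i _; rewrite /cons_pair tnthS.
Qed.

Lemma lincomb_cons n (a b : R) (z : measurableTypeR R * n.-tuple R)
    (y : n.+1.-tuple R) :
  tuple_lincomb a (cons_pair z) b y =
  cons_pair (a * z.1 + b * thead y, tuple_lincomb a z.2 b [tuple of behead y]).
Proof.
apply: eq_from_tnth => i; rewrite tnth_lincomb.
case: (unliftP ord0 i) => [j|] ->.
  rewrite /cons_pair !tnthS tnth_lincomb; congr (_ + _ * _).
  by rewrite [in LHS](tuple_eta y) tnthS.
by rewrite /cons_pair !tnth0.
Qed.

Lemma measurable_lincomb d d' (T : measurableType d') (a b : T -> R)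
    (x y : T -> d.-tuple R) :
  measurable_fun setT a -> measurable_fun setT b ->
  measurable_fun setT x -> measurable_fun setT y ->
  measurable_fun setT (fun t => tuple_lincomb (a t) (x t) (b t) (y t)).
Proof.
move=> ma mb mx my; apply/measurable_fun_tnthP => i.
rewrite (_ : _ \o _ = fun t => a t * tnth (x t) i + b t * tnth (y t) i); last first.
  by apply/funext => t /=; rewrite tnth_lincomb.
by apply: measurable_funD; apply: measurable_funM => //;
  apply: (measurableT_comp (measurable_tnth i)).
Qed.

End euclidean_tuples.

Section lebesgue_tuple_integral.
Context {R : realType}.
Notation mu := (@lebesgue_measure R).
Local Open Scope ereal_scope.

Lemma ge0_integral_lebesgue_tupleS n (F : n.+1.-tuple R -> \bar R) :
  measurable_fun setT F -> (forall x, 0 <= F x) ->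
  \int[lebesgue_tuple n.+1]_x F x =
  \int[mu]_a \int[lebesgue_tuple n]_x F (cons_pair (a, x)).
Proof.
move=> mF F0.
have mc := @measurable_cons_pair R n.
rewrite -(@fubini_tonelli1 _ _ _ _ _ mu (lebesgue_tuple n) (F \o @cons_pair R n))//=.
  by rewrite -[RHS](@ge0_integral_pushforward _ _ _ _ _ (@cons_pair R n) _ _ setT).
exact: measurableT_comp.
Qed.

(** One coordinate at a time, by Tonelli. The translation is written [c * b] so that [ou_point] is
    an instance. *)
Lemma ge0_integral_lebesgue_tuple_affine d (a c : R) (b : d.-tuple R)
    (F : d.-tuple R -> \bar R) : (0 < a)%R ->
  measurable_fun setT F -> (forall x, 0 <= F x) ->
  \int[lebesgue_tuple d]_x F x =
  \int[lebesgue_tuple d]_x (F (tuple_lincomb a x c b) * (a ^+ d)%:E).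
Proof.
move=> a0; elim: d b F => [|n IH] b F mF F0.
  rewrite /= !integral_dirac//; last first.
    apply: emeasurable_funM => //; apply: (measurableT_comp mF).
    exact: measurable_lincomb.
  rewrite !diracT !mul1e mule1; congr F.
  by apply: eq_from_tnth => -[].
have mF' s : measurable_fun setT (fun x : n.-tuple R => F (cons_pair (s, x))).
  apply: (measurableT_comp mF); apply: (measurableT_comp (@measurable_cons_pair R n)).
  exact: pair1_measurable.
rewrite ge0_integral_lebesgue_tupleS//.
rewrite (ge0_integral_affine (c * thead b)%R a0); last 2 first.
- apply: (@measurable_fun_fubini_tonelli_F _ _ _ _ _ (lebesgue_tuple n)
    (F \o @cons_pair R n)) => [|x]; last exact: F0.
  exact: (measurableT_comp mF (@measurable_cons_pair R n)).
- by move=> y; apply: integral_ge0.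
rewrite ge0_integral_lebesgue_tupleS; last 2 first.
- apply: emeasurable_funM => //; apply: (measurableT_comp mF).
  exact: measurable_lincomb.
- by move=> x; rewrite mule_ge0// lee_fin exprn_ge0// ltW.
apply: eq_integral => s _; rewrite (IH [tuple of behead b])//.
rewrite -ge0_integralZr//; last 3 first.
- apply: emeasurable_funM => //; apply: (measurableT_comp (mF' _)).
  exact: measurable_lincomb.
- by move=> x _; rewrite mule_ge0// lee_fin exprn_ge0// ltW.
- by rewrite lee_fin ltW.
apply: eq_integral => x _; rewrite lincomb_cons/= -muleA -EFinM.
by rewrite [in RHS]exprSr.
Qed.

End lebesgue_tuple_integral.

Section gauss_probability.
Context {R : realType}.
Notation mu := (@lebesgue_measure R).
Local Open Scope ereal_scope.

Lemma ge0_integral_gauss d (F : d.-tuple R -> \bar R) :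
  measurable_fun setT F -> (forall x, 0 <= F x) ->
  \int[gauss_measure d]_x F x = \int[lebesgue_tuple d]_x (F x * (gauss_density x)%:E).
Proof.
move=> mF F0.
rewrite (@ge0_integral_weighted_pushforward _ _ _ _ _ (lebesgue_tuple d) id
  (@gauss_density R d))//; first exact: measurable_gauss_density.
exact: gauss_density_ge0.
Qed.

Lemma measurable_enormX2 d (c : R) :
  measurable_fun setT (fun x : d.-tuple R => expR (- (c * enorm x ^+ 2))).
Proof.
apply: measurableT_comp => //; apply: measurableT_comp => //.
apply: measurable_funM => //; apply: measurable_funX; exact: measurable_enorm.
Qed.

Lemma integral_expR_enorm d :
  \int[lebesgue_tuple d]_x (expR (- enorm x ^+ 2))%:E = (pi `^ (d%:R / 2))%:E :> \bar R.
Proof.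
have mE n : measurable_fun setT (fun x : n.-tuple R => (expR (- enorm x ^+ 2))%:E).
  apply/measurable_EFinP.
  by have := @measurable_enormX2 n 1; under eq_fun do rewrite mul1r.
elim: d => [|n IH].
  rewrite /= integral_dirac//; last exact: mE.
  rewrite diracT mul1e enormE big_ord0 oppr0 expR0.
  by rewrite mul0r powRr0.
rewrite ge0_integral_lebesgue_tupleS//.
under eq_integral => a _.
  under eq_integral => x _ do rewrite enorm_cons/= opprD expRD EFinM.
  rewrite ge0_integralZl_EFin ?expR_ge0//; last exact: mE.
  rewrite IH; over.
rewrite ge0_integralZr//; last 2 first.
- apply/measurable_EFinP; exact: measurable_gauss_fun.
- by rewrite lee_fin powR_ge0.
rewrite [X in X * _](_ : _ = (Num.sqrt pi)%:E); last exact: integralT_gauss.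
rewrite -EFinM -powR12_sqrt ?pi_ge0//.
rewrite -powRD; last by rewrite (gt_eqF (pi_gt0 R)) implybT.
by congr (_ `^ _)%:E; rewrite -natr1; field.
Qed.

Lemma gauss_measure_setT d : gauss_measure d [set: d.-tuple R] = 1.
Proof.
rewrite /gauss_measure /gauss_density.
under eq_integral do rewrite EFinM.
rewrite ge0_integralZl_EFin ?powR_ge0//; last first.
  apply/measurable_EFinP.
  by have := @measurable_enormX2 d 1; under eq_fun do rewrite mul1r.
rewrite integral_expR_enorm -EFinM -powRD; last first.
  by rewrite (gt_eqF (pi_gt0 R)) implybT.
by rewrite addNr powRr0.
Qed.

HB.instance Definition _ d := Measure_isProbability.Build _ _ _
  (@gauss_measure R d) (gauss_measure_setT d).

End gauss_probability.

Section mehler.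
Context {R : realType} {d : nat}.
Notation X := (d.-tuple R).
Notation gamma := (@gauss_measure R d).
Implicit Types (t : R) (u x y : X).

Definition ou_rad t : R := Num.sqrt (1 - expR (- (2 * t))).

Definition ou_point t u x : X := tuple_lincomb (ou_rad t) u (expR (- t)) x.

Lemma ou_rad_ge0 t : 0 <= ou_rad t. Proof. exact: sqrtr_ge0. Qed.

Lemma ou_rad2 t : 0 <= t -> ou_rad t ^+ 2 = 1 - expR (- t) ^+ 2.
Proof.
move=> t0; rewrite sqr_sqrtr ?subr_ge0 ?expR_le1 ?oppr_le0 ?mulr_ge0//.
by rewrite -expRM_natl mulrN.
Qed.

Lemma ou_rad_gt0 t : 0 < t -> 0 < ou_rad t.
Proof.
by move=> t0; rewrite sqrtr_gt0 subr_gt0 expR_lt1 oppr_lt0 mulr_gt0.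
Qed.

Lemma ou_rad_le1 t : ou_rad t <= 1.
Proof.
rewrite -[leRHS]sqrtr1 ler_wsqrtr// gerBl; exact: expR_ge0.
Qed.

(** The density in [y] of the law of [ou_point t u x] for Gaussian [u], taken with respect to
    Lebesgue measure and not to the Gaussian measure. *)
Definition mehler t x y : R :=
  ou_rad t ^- d * (pi `^ (- (d%:R / 2))) *
  expR (- ((ou_rad t ^- 2) * enorm (tuple_lincomb 1 y (- expR (- t)) x) ^+ 2)).

Lemma mehler_ge0 t x y : 0 <= mehler t x y.
Proof.
by rewrite !mulr_ge0// ?expR_ge0 ?powR_ge0// invr_ge0 exprn_ge0// ou_rad_ge0.
Qed.

Lemma measurable_mehler t : measurable_fun setT (fun z : X * X => mehler t z.1 z.2).
Proof.
apply: measurable_funM => //; apply: measurableT_comp => //.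
apply: measurableT_comp => //; apply: measurable_funM => //.
apply: measurable_funX; apply: measurableT_comp; first exact: measurable_enorm.
exact: measurable_lincomb.
Qed.

(* [|x|^2 + |y - r x|^2 / (1 - r^2)] is symmetric in [x] and [y] *)
Lemma gauss_density_mehlerC t x y : 0 < t ->
  gauss_density x * mehler t x y = gauss_density y * mehler t y x.
Proof.
move=> t0; rewrite /gauss_density /mehler.
have s0 := lt0r_neq0 (ou_rad_gt0 t0).
have := ou_rad2 (ltW t0); set s := ou_rad t; set r := expR (- t) => s2.
have E : expR (- enorm x ^+ 2) *
    expR (- (s ^- 2 * enorm (tuple_lincomb 1 y (- r) x) ^+ 2)) =
  expR (- enorm y ^+ 2) *
    expR (- (s ^- 2 * enorm (tuple_lincomb 1 x (- r) y) ^+ 2)).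
  rewrite -!expRD; congr expR.
  rewrite -!opprD; congr (- _); rewrite !enormE !mulr_sumr -!big_split/=.
  apply: eq_bigr => i _; rewrite !tnth_lincomb.
  have -> : s ^- 2 = (1 - r ^+ 2)^-1 by rewrite s2.
  have n0 : 1 - r ^+ 2 != 0 by rewrite -s2 expf_neq0.
  by field.
set a := pi `^ _; set b := s ^- d; move: E.
set e1 := expR _; set e2 := expR _; set e3 := expR _; set e4 := expR _ => E.
transitivity (a * b * a * (e1 * e2)); first by ring.
by rewrite E; ring.
Qed.

(** By symmetry [mehler t x y] equals [pi^(d/2) e^(|x|^2) gauss_density y * mehler t y x], and the
    exponential inside [mehler t y x] is at most 1. *)
Lemma mehler_le t x y : 0 < t ->
  mehler t x y <= ou_rad t ^- d * expR (enorm x ^+ 2) * gauss_density y.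
Proof.
move=> t0.
have cE : 0 < pi `^ (- (d%:R / 2)) :> R by rewrite powR_gt0// pi_gt0.
have := gauss_density_mehlerC x y t0.
rewrite {1}/gauss_density => E.
have -> : mehler t x y = (pi `^ (- (d%:R / 2)))^-1 * expR (enorm x ^+ 2) *
    (gauss_density y * mehler t y x).
  rewrite -E expRN; field; rewrite expR_eq0 gt_eqF//.
rewrite /mehler [leRHS](_ : _ = (pi `^ (- (d%:R / 2)))^-1 * expR (enorm x ^+ 2) *
    (gauss_density y * (ou_rad t ^- d * pi `^ (- (d%:R / 2)) * 1))).
  rewrite ler_wpM2l ?mulr_ge0 ?invr_ge0 ?(ltW cE) ?expR_ge0//.
  rewrite ler_wpM2l ?gauss_density_ge0// ler_wpM2l//.
    by rewrite mulr_ge0 ?(ltW cE)// invr_ge0 exprn_ge0// ou_rad_ge0.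
  rewrite expR_le1 oppr_le0 mulr_ge0// ?sqr_ge0// invr_ge0 sqr_ge0//.
by rewrite mulr1; move: (ou_rad t ^- d) => b; field; rewrite gt_eqF.
Qed.

Local Open Scope ereal_scope.

Lemma ge0_integral_ou_point t x (F : X -> \bar R) : (0 < t)%R ->
  measurable_fun setT F -> (forall y, 0 <= F y) ->
  \int[gamma]_u F (ou_point t u x) =
  \int[lebesgue_tuple d]_y (F y * (mehler t x y)%:E).
Proof.
move=> t0 mF F0; have s0 := ou_rad_gt0 t0.
rewrite (@ge0_integral_gauss _ d (fun u => F (ou_point t u x))); last 2 first.
- by apply: (measurableT_comp mF); exact: measurable_lincomb.
- by move=> u; exact: F0.
rewrite [RHS](@ge0_integral_lebesgue_tuple_affine R d (ou_rad t) (expR (- t)) x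
  (fun y => F y * (mehler t x y)%:E) s0); last 2 first.
- apply: emeasurable_funM => //; apply/measurable_EFinP.
  exact: (measurableT_comp (measurable_mehler t) (pair1_measurable x)).
- by move=> y; rewrite mule_ge0// lee_fin mehler_ge0.
apply: eq_integral => u _; rewrite -muleA; congr (_ * _).
rewrite -EFinM; congr EFin; rewrite /gauss_density /mehler.
have -> : tuple_lincomb 1 (tuple_lincomb (ou_rad t) u (expR (- t)) x) (- expR (- t)) x =
    tuple_lincomb (ou_rad t) u 0 x.
  by apply: eq_from_tnth => i; rewrite !tnth_lincomb; ring.
have -> : (enorm (tuple_lincomb (ou_rad t) u 0 x) ^+ 2 = ou_rad t ^+ 2 * enorm u ^+ 2)%R.
  rewrite !enormE mulr_sumr; apply: eq_bigr => i _.
  by rewrite tnth_lincomb mul0r addr0 exprMn.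
rewrite mulrA mulVf ?mul1r; last by rewrite expf_neq0// gt_eqF.
by field; rewrite expf_neq0// gt_eqF.
Qed.

(** For independent Gaussian [x] and [u] the pair [(x, ou_point t u x)] is exchangeable, because the
    kernel weighted by the Gaussian density is symmetric. Functions of both points are allowed since
    the weights met later depend on [|q x - q y|]. *)
Lemma ge0_integral_ou_pointC t (Phi : X * X -> \bar R) : (0 < t)%R ->
  measurable_fun setT Phi -> (forall z, 0 <= Phi z) ->
  \int[gamma]_x \int[gamma]_u Phi (x, ou_point t u x) =
  \int[gamma]_y \int[gamma]_u Phi (ou_point t u y, y).
Proof.
move=> t0 mP P0.
have mPl x : measurable_fun setT (fun y => Phi (x, y)).
  exact: (measurableT_comp mP (pair1_measurable x)).
have mPr y : measurable_fun setT (fun x => Phi (x, y)).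
  exact: (measurableT_comp mP (pair2_measurable y)).
have mM := measurable_mehler t.
have mD : measurable_fun setT (@gauss_density R d) by exact: measurable_gauss_density.
under eq_integral => x _ do rewrite (ge0_integral_ou_point x t0 (mPl x))//.
under [RHS]eq_integral => y _ do rewrite (ge0_integral_ou_point y t0 (mPr y))//.
have mK : measurable_fun setT (fun z : X * X => Phi z * (mehler t z.1 z.2)%:E).
  by apply: emeasurable_funM => //; exact/measurable_EFinP.
have mK' : measurable_fun setT (fun z : X * X => Phi z * (mehler t z.2 z.1)%:E).
  apply: emeasurable_funM => //; apply/measurable_EFinP.
  exact: (measurableT_comp mM (@measurable_swap _ _ _ _)).
have K0 z : 0 <= Phi z * (mehler t z.1 z.2)%:E.
  by rewrite mule_ge0// lee_fin mehler_ge0.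
have K'0 z : 0 <= Phi z * (mehler t z.2 z.1)%:E.
  by rewrite mule_ge0// lee_fin mehler_ge0.
rewrite ge0_integral_gauss; last 2 first.
- exact: (@measurable_fun_fubini_tonelli_F _ _ X X R (lebesgue_tuple d) _ mK).
- by move=> x; apply: integral_ge0.
rewrite ge0_integral_gauss; last 2 first.
- exact: (@measurable_fun_fubini_tonelli_G _ _ X X R (lebesgue_tuple d) _ mK').
- by move=> x; apply: integral_ge0.
transitivity (\int[lebesgue_tuple d]_x \int[lebesgue_tuple d]_y
    (Phi (x, y) * (gauss_density x * mehler t x y)%:E)).
  apply: eq_integral => x _; rewrite -ge0_integralZr//.
  - by apply: eq_integral => y _; rewrite -muleA -EFinM [X in X%:E]mulrC.
  - exact: (measurableT_comp mK (pair1_measurable x)).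
  - by rewrite lee_fin gauss_density_ge0.
transitivity (\int[lebesgue_tuple d]_y \int[lebesgue_tuple d]_x
    (Phi (x, y) * (gauss_density x * mehler t x y)%:E)).
  apply: (@fubini_tonelli _ _ _ _ _ _ _
    (fun z => Phi z * (gauss_density z.1 * mehler t z.1 z.2)%:E)).
  - apply: emeasurable_funM => //; apply/measurable_EFinP.
    apply: measurable_funM => //.
    exact: (measurableT_comp mD measurable_fst).
  - by move=> z; rewrite mule_ge0// lee_fin mulr_ge0 ?gauss_density_ge0 ?mehler_ge0.
apply: eq_integral => y _; rewrite -ge0_integralZr//.
- apply: eq_integral => x _; rewrite -muleA -EFinM.
  by rewrite gauss_density_mehlerC// [X in X%:E]mulrC.
- exact: (measurableT_comp mK' (pair2_measurable y)).
- by rewrite lee_fin gauss_density_ge0.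
Qed.

(** The semigroup on nonnegative extended-valued functions, where it makes sense without
    integrability. *)
Definition EOU t (F : X -> \bar R) x : \bar R := \int[gamma]_u F (ou_point t u x).

Lemma measurable_ou_point d' (T : measurableType d') (t : T -> R) (u x : T -> X) :
  measurable_fun setT t -> measurable_fun setT u -> measurable_fun setT x ->
  measurable_fun setT (fun z => ou_point (t z) (u z) (x z)).
Proof.
move=> mt mu mx; apply: measurable_lincomb => //.
  apply: (@measurableT_comp _ _ _ _ _ _ (@Num.sqrt R)).
    by apply: continuous_measurable_fun; exact: sqrt_continuous.
  apply: measurable_funB => //; apply: measurableT_comp => //.
  by apply: measurable_funN; apply: measurable_funM.
by apply: measurableT_comp => //; exact: measurable_funN.
Qed.

Lemma measurable_EOU d' (T : measurableType d') (t : T -> R) (F : T * X -> \bar R)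
    (x : T -> X) : measurable_fun setT t -> measurable_fun setT x ->
  measurable_fun setT F -> (forall z, 0 <= F z) ->
  measurable_fun setT (fun z => EOU (t z) (fun y => F (z, y)) (x z)).
Proof.
move=> mt mx mF F0.
apply: (@measurable_fun_fubini_tonelli_F _ _ _ _ _ gamma
  (fun z : T * X => F (z.1, ou_point (t z.1) z.2 (x z.1)))) => //.
apply: (measurableT_comp mF); apply/measurable_fun_pairP; split.
  exact: measurable_fst.
apply: measurable_ou_point => //.
  exact: (measurableT_comp mt).
exact: (measurableT_comp mx).
Qed.

Lemma EOU_ge0 t F x : (forall y, 0 <= F y) -> 0 <= EOU t F x.
Proof. by move=> F0; apply: integral_ge0. Qed.

Lemma integral_EOU t F : (0 < t)%R -> measurable_fun setT F ->
  (forall y, 0 <= F y) -> \int[gamma]_x EOU t F x = \int[gamma]_x F x.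
Proof.
move=> t0 mF F0.
rewrite (@ge0_integral_ou_pointC t (F \o snd))//=; last first.
  exact: (measurableT_comp mF).
apply: eq_integral => y _; rewrite integral_cst//=.
by rewrite -[X in _ * X]/(gauss_measure d setT) gauss_measure_setT mule1.
Qed.

(** The total noise [e^(-t) ou_rad s u + ou_rad t v] equals [ou_rad (s + t) w] with
    [w = rho u + (1 - rho^2)^(1/2) v]. Writing [rho = e^(-tau)] gives [w = ou_point tau v u], so the
    rotation invariance of the Gaussian measure is the invariance [integral_EOU] at time [tau]. *)
Lemma EOU_semigroup s t F x : (0 < s)%R -> (0 < t)%R -> measurable_fun setT F ->
  (forall y, 0 <= F y) -> EOU s (EOU t F) x = EOU (s + t) F x.
Proof.
move=> s0 t0 mF F0; rewrite /EOU.
have st0 := addr_gt0 s0 t0.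
have S0 := ou_rad_gt0 st0.
have sE := ou_rad2 (ltW s0); have tE := ou_rad2 (ltW t0).
have stE := ou_rad2 (ltW st0).
pose rho := (expR (- t) * ou_rad s / ou_rad (s + t))%R.
have rho0 : (0 < rho)%R by rewrite divr_gt0// mulr_gt0 ?expR_gt0// ou_rad_gt0.
have rhoE : (1 - rho ^+ 2 = (ou_rad t / ou_rad (s + t)) ^+ 2)%R.
  rewrite /rho !exprMn exprVn; apply: (mulIf (lt0r_neq0 (exprn_gt0 2 S0))).
  rewrite mulrBl !mulfVK ?expf_neq0 ?gt_eqF// stE tE sE opprD expRD; ring.
have rho1 : (rho < 1)%R.
  rewrite -(@ltr_pXn2r _ 2) ?nnegrE ?ltW// expr1n -subr_gt0 rhoE exprn_gt0//.
  by rewrite divr_gt0// ou_rad_gt0.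
pose tau := (- ln rho)%R.
have tau0 : (0 < tau)%R by rewrite oppr_gt0 ln_lt0// rho0.
have etau : expR (- tau) = rho by rewrite opprK lnK.
have rtau : ou_rad tau = (ou_rad t / ou_rad (s + t))%R.
  apply/eqP; rewrite -(@eqrXn2 _ 2)// ?ou_rad_ge0 ?divr_ge0 ?ou_rad_ge0//.
  by rewrite ou_rad2 ?ltW// etau rhoE.
pose H w := F (ou_point (s + t) w x).
have mH : measurable_fun setT H.
  by apply: (measurableT_comp mF); exact: measurable_ou_point.
transitivity (\int[gamma]_x EOU tau H x); last first.
  by rewrite integral_EOU// => y; exact: F0.
apply: eq_integral => u _; apply: eq_integral => v _; congr F.
apply: eq_from_tnth => i; rewrite !tnth_lincomb rtau etau /rho opprD expRD.
by field; rewrite gt_eqF.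
Qed.

(** A bound at every point by the integral alone: for integrable functions the semigroup is finite
    everywhere, not just almost everywhere, and its values are bounded in terms of [x] and [t]. *)
Lemma EOU_le t F x : (0 < t)%R -> measurable_fun setT F -> (forall y, 0 <= F y) ->
  EOU t F x <= (ou_rad t ^- d * expR (enorm x ^+ 2))%:E * \int[gamma]_y F y.
Proof.
move=> t0 mF F0.
have c0 : (0 <= ou_rad t ^- d * expR (enorm x ^+ 2))%R.
  by rewrite mulr_ge0 ?expR_ge0// invr_ge0 exprn_ge0// ou_rad_ge0.
have mG : measurable_fun setT (fun y : X => F y * (gauss_density y)%:E).
  by apply: emeasurable_funM => //; apply/measurable_EFinP; exact: measurable_gauss_density.
have G0 y : 0 <= F y * (gauss_density y)%:E.
  by rewrite mule_ge0// lee_fin gauss_density_ge0.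
rewrite /EOU ge0_integral_ou_point// ge0_integral_gauss// -ge0_integralZl_EFin//.
apply: ge0_le_integral => //.
- by move=> y _; rewrite mule_ge0// lee_fin mehler_ge0.
- apply: emeasurable_funM => //; apply/measurable_EFinP.
  exact: (measurableT_comp (measurable_mehler t) (pair1_measurable x)).
- exact: measurable_funeM.
- move=> y _; rewrite muleCA; apply: lee_wpmul2l => //.
  by rewrite -EFinM lee_fin mehler_le.
Qed.

End mehler.

(** * Subordination *)

Section subordinator.
Context {R : realType}.
Notation mu := (@lebesgue_measure R).
Implicit Types (s t a b c z : R).

(* The substitution [u = (t e^z)^2] in the definition of [poisson_hermite] turns
   [t^2 / (4 u)] into [e^{-2z} / 4]: all of the dependence on [t] moves to the
   kernel, where it can be differentiated. *)
Definition sub_time z : R := expR (- (2 * z)) / 4.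

Definition poisson_kernel t z : R :=
  2 / Num.sqrt pi * t * expR z * expR (- (t * expR z) ^+ 2).

Lemma sub_time_gt0 z : 0 < sub_time z.
Proof. by rewrite divr_gt0// expR_gt0. Qed.

Lemma measurable_sub_time : measurable_fun [set: R] sub_time.
Proof.
apply: measurable_funM => //; apply: measurableT_comp => //.
by apply: measurable_funN; apply: measurable_funM.
Qed.

Lemma sqrt_pi_gt0 : 0 < Num.sqrt pi :> R.
Proof. by rewrite sqrtr_gt0 pi_gt0. Qed.

Lemma poisson_kernel_ge0 t z : 0 <= t -> 0 <= poisson_kernel t z.
Proof.
by move=> t0; rewrite !mulr_ge0// ?expR_ge0// invr_ge0 sqrtr_ge0.
Qed.

Lemma measurable_poisson_kernel2 :
  measurable_fun setT (fun z : R * R => poisson_kernel z.1 z.2).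
Proof.
have me : measurable_fun setT (fun z : R * R => expR z.2).
  exact: (measurableT_comp (@measurable_expR R)).
apply: measurable_funM.
  by apply: measurable_funM => //; apply: measurable_funM.
apply: measurableT_comp => //; apply: measurable_funN.
by apply: measurable_funX; apply: measurable_funM.
Qed.

Lemma measurable_poisson_kernel t : measurable_fun setT (poisson_kernel t).
Proof.
exact: (measurableT_comp measurable_poisson_kernel2 (pair1_measurable t)).
Qed.

Local Open Scope ereal_scope.

Lemma integral_gauss_scaled c : (0 < c)%R ->
  \int[mu]_y (expR (- (c * y) ^+ 2))%:E = (Num.sqrt pi / c)%:E.
Proof.
move=> c0.
have mG : measurable_fun [set: measurableTypeR R] (fun y : R => (expR (- y ^+ 2))%:E).
  apply/measurable_EFinP; exact: measurable_gauss_fun.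
have E : \int[mu]_x (expR (- x ^+ 2))%:E = (Num.sqrt pi)%:E by exact: integralT_gauss.
rewrite (ge0_integral_affine 0 c0 mG) in E; last by move=> y; rewrite lee_fin expR_ge0.
have {}E : \int[mu]_y (expR (- (c * y) ^+ 2))%:E * c%:E = (Num.sqrt pi)%:E.
  rewrite -E -ge0_integralZr; last 4 first.
  - by [].
  - by apply: (measurableT_comp mG); exact: measurable_funM.
  - by move=> y _; rewrite lee_fin expR_ge0.
  - by rewrite lee_fin ltW.
  by apply: eq_integral => y _; rewrite addr0.
rewrite EFinM -E -muleA -EFinM divff ?mule1// gt_eqF//.
Qed.

(** The reflection [z -> - z] exchanges the two integrals, and their sum is a Gaussian integral
    after the substitution [y = 2 sinh z]. A finite [x + x] forces [x] to be finite, so each one is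
    half of the sum. *)
Let K0 c : (0 < c)%R ->
  \int[mu]_z (expR z * expR (- (c * (expR z - expR (- z))) ^+ 2))%:E =
  (Num.sqrt pi / (2 * c))%:E /\
  \int[mu]_z (expR (- z) * expR (- (c * (expR z - expR (- z))) ^+ 2))%:E =
  (Num.sqrt pi / (2 * c))%:E.
Proof.
move=> c0.
pose e z := expR (- (c * (expR z - expR (- z))) ^+ 2) : R.
have me : measurable_fun [set: measurableTypeR R] e.
  apply: measurableT_comp => //; apply: measurable_funN; apply: measurable_funX.
  apply: measurable_funM => //; apply: measurable_funB => //.
  by apply: measurableT_comp => //; exact: measurable_funN.
have men : measurable_fun [set: measurableTypeR R] (fun z => expR (- z) : R).
  by apply: measurableT_comp => //; exact: measurable_funN.
have m1 : measurable_fun [set: measurableTypeR R] (fun z => (expR z * e z)%:E).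
  by apply/measurable_EFinP; apply: measurable_funM.
have m2 : measurable_fun [set: measurableTypeR R] (fun z => (expR (- z) * e z)%:E).
  by apply/measurable_EFinP; apply: measurable_funM.
have e0 z : (0 <= e z)%R by exact: expR_ge0.
have E12 : \int[mu]_z (expR z * e z)%:E = \int[mu]_z (expR (- z) * e z)%:E.
  rewrite (ge0_integral_opp m1); last by move=> y; rewrite lee_fin mulr_ge0 ?expR_ge0.
  apply: eq_integral => z _; congr (_ * _)%:E; congr expR.
  by rewrite opprK -[in RHS]opprB mulrN sqrrN.
have S : \int[mu]_z (expR z * e z)%:E + \int[mu]_z (expR (- z) * e z)%:E =
    (Num.sqrt pi / c)%:E.
  rewrite -ge0_integralD//; last 2 first.
  - by move=> y _; rewrite lee_fin mulr_ge0 ?expR_ge0.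
  - by move=> y _; rewrite lee_fin mulr_ge0 ?expR_ge0.
  rewrite -integral_gauss_scaled// [RHS]ge0_integral_sinh; last 2 first.
  - apply/measurable_EFinP; apply: measurableT_comp => //.
    by apply: measurable_funN; apply: measurable_funX; apply: measurable_funM.
  - by move=> y; rewrite lee_fin expR_ge0.
  apply: eq_integral => z _; rewrite -EFinM -EFinD; congr EFin.
  by rewrite /e; ring.
have half (x : \bar R) : x + x = (Num.sqrt pi / c)%:E -> x = (Num.sqrt pi / (2 * c))%:E.
  case: x => [r| |]//= [] rr; congr EFin.
  have -> : (Num.sqrt pi / (2 * c) = (Num.sqrt pi / c) / 2)%R by field; rewrite gt_eqF.
  by rewrite -rr; field.
by split; apply: half; [rewrite {2}E12|rewrite -{1}E12].
Qed.

Lemma ge0_integral_shift c (G : R -> \bar R) :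
  measurable_fun [set: measurableTypeR R] G -> (forall y, 0 <= G y) ->
  \int[mu]_z G z = \int[mu]_z G (z + c)%R.
Proof.
move=> mG G0; rewrite (ge0_integral_affine c (@ltr01 R) mG G0).
by apply: eq_integral => z _; rewrite mul1r mule1.
Qed.

Lemma integral_poisson_kernel t : (0 < t)%R -> \int[mu]_z (poisson_kernel t z)%:E = 1.
Proof.
move=> t0.
transitivity (\int[mu]_z (poisson_kernel 1 z)%:E).
  rewrite [RHS](@ge0_integral_shift (ln t)).
  - apply: eq_integral => z _; rewrite /poisson_kernel expRD lnK//.
    by congr EFin; rewrite !mul1r mulr1 [(expR z * t)%R]mulrC !mulrA.
  - by apply/measurable_EFinP; exact: measurable_poisson_kernel.
  - by move=> y; rewrite lee_fin poisson_kernel_ge0.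
have mg : measurable_fun [set: measurableTypeR R] (fun w : R => (gauss_fun w)%:E).
  by apply/measurable_EFinP; exact: measurable_gauss_fun.
transitivity ((2 / Num.sqrt pi)%:E * \int[mu]_(w in `]0%R, +oo[) (gauss_fun w)%:E).
  rewrite (ge0_integral_expR_substitution mg); last first.
    by move=> y; rewrite lee_fin gauss_fun_ge0.
  rewrite -ge0_integralZl_EFin//.
  - by apply: eq_integral => z _; rewrite -!EFinM; congr EFin;
      rewrite /poisson_kernel /gauss_fun !mul1r; ring.
  - by move=> z _; rewrite mule_ge0// lee_fin ?gauss_fun_ge0 ?expR_ge0.
  - apply: emeasurable_funM; last exact/measurable_EFinP.
    by apply: (measurableT_comp mg).
rewrite integral_itv_obnd_cbnd; last exact: measurable_funTS.
rewrite [X in _ * X](_ : _ = (Num.sqrt pi / 2)%:E); last exact: integral0y_gauss.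
by rewrite -EFinM; congr EFin; field; rewrite gt_eqF// sqrt_pi_gt0.
Qed.

Let K s t z : (0 < s)%R -> (0 < t)%R ->
  \int[mu]_b ((expR b + expR (- b)) *
     expR (- (expR z * (t * expR b - s * expR (- b))) ^+ 2))%:E =
  (Num.sqrt pi * (s + t) / (2 * s * t) / expR z)%:E.
Proof.
move=> s0 t0.
(* The shift [b -> b + ln q] balances the two coefficients, [t q = s / q], and so reduces the
   integral to [K0]. *)
pose q := Num.sqrt (s / t).
have q0 : (0 < q)%R by rewrite sqrtr_gt0 divr_gt0.
have q2 : (q ^+ 2 = s / t)%R by rewrite sqr_sqrtr// divr_ge0 ?ltW.
have sE : (s = t * q ^+ 2)%R by rewrite q2 mulrCA divff ?mulr1 ?gt_eqF.
pose c := (expR z * t * q)%R.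
have c0 : (0 < c)%R by rewrite !mulr_gt0// expR_gt0.
have [E1 E2] := K0 c0.
pose e b := expR (- (c * (expR b - expR (- b))) ^+ 2) : R.
have me : measurable_fun [set: measurableTypeR R] e.
  apply: measurableT_comp => //; apply: measurable_funN; apply: measurable_funX.
  apply: measurable_funM => //; apply: measurable_funB => //.
  by apply: measurableT_comp => //; exact: measurable_funN.
have men : measurable_fun [set: measurableTypeR R] (fun z => expR (- z) : R).
  by apply: measurableT_comp => //; exact: measurable_funN.
rewrite (@ge0_integral_shift (ln q)); last 2 first.
- apply/measurable_EFinP; apply: measurable_funM; first exact: measurable_funD.
  apply: measurableT_comp => //; apply: measurable_funN; apply: measurable_funX.
  by apply: measurable_funM => //; apply: measurable_funB => //; apply: measurable_funM.
- by move=> b; rewrite lee_fin mulr_ge0 ?addr_ge0 ?expR_ge0.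
transitivity (\int[mu]_b (q%:E * (expR b * e b)%:E + q^-1%:E * (expR (- b) * e b)%:E)).
  apply: eq_integral => b _; rewrite -!EFinM -EFinD; congr EFin.
  have eN : (expR (- (b + ln q)) = expR (- b) / q)%R.
    by rewrite opprD expRD expRN [X in (_ * X)%R]expRN lnK.
  rewrite eN expRD lnK// /e.
  have -> : (expR z * (t * (expR b * q) - s * (expR (- b) / q)) =
    c * (expR b - expR (- b)))%R by rewrite sE /c; field; rewrite gt_eqF.
  by ring.
rewrite ge0_integralD//; last 4 first.
- by move=> b _; rewrite -EFinM lee_fin !mulr_ge0 ?expR_ge0// ltW.
- by apply/measurable_funeM/measurable_EFinP; exact: measurable_funM.
- by move=> b _; rewrite -EFinM lee_fin !mulr_ge0 ?expR_ge0// invr_ge0 ltW.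
- by apply/measurable_funeM/measurable_EFinP; exact: measurable_funM.
rewrite !ge0_integralZl_EFin//; last 6 first.
- by move=> b _; rewrite lee_fin mulr_ge0 ?expR_ge0.
- by apply/measurable_EFinP; exact: measurable_funM.
- by rewrite invr_ge0 ltW.
- by move=> b _; rewrite lee_fin mulr_ge0 ?expR_ge0.
- by apply/measurable_EFinP; exact: measurable_funM.
- by rewrite ltW.
rewrite E1 E2 -!EFinM -EFinD; congr EFin.
by rewrite sE /c; field; rewrite !gt_eqF// expR_gt0.
Qed.

(** Under [poisson_kernel t] the law of [sub_time] is the one-sided stable law of index 1/2, and
    these laws form a convolution semigroup. After the shift [b -> b + a] the variable [b] encodes
    the ratio of the two times; with this ratio fixed, a translation of [a] parametrizes their sum,
    and [K] integrates the ratio out. *)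
Lemma ge0_poisson_kernel_convolution s t (G : R -> \bar R) :
  (0 < s)%R -> (0 < t)%R -> measurable_fun [set: R] G -> (forall y, 0 <= G y) ->
  \int[mu]_a \int[mu]_b
    ((poisson_kernel s a * poisson_kernel t b)%:E * G (sub_time a + sub_time b)%R) =
  \int[mu]_z ((poisson_kernel (s + t) z)%:E * G (sub_time z)).
Proof.
move=> s0 t0 mG G0.
have mk2 (x : R) (T1 : R * R -> R) : measurable_fun setT T1 ->
    measurable_fun setT (fun w => poisson_kernel x (T1 w)).
  by move=> m1; apply: (measurableT_comp (measurable_poisson_kernel x)).
have mt2 (T1 : R * R -> R) : measurable_fun setT T1 ->
    measurable_fun setT (fun w => sub_time (T1 w)).
  by move=> m1; apply: (measurableT_comp measurable_sub_time).
have mm (T1 T2 : R * R -> R) : measurable_fun setT T1 -> measurable_fun setT T2 ->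
    measurable_fun setT (fun w => (poisson_kernel s (T1 w) * poisson_kernel t (T2 w))%:E *
       G (sub_time (T1 w) + sub_time (T2 w))%R).
  move=> m1 m2; apply: emeasurable_funM.
    by apply/measurable_EFinP; apply: measurable_funM; apply: mk2.
  by apply: (measurableT_comp mG); apply: measurable_funD; apply: mt2.
have pp a b c : 0 <= (poisson_kernel s a * poisson_kernel t b)%:E * G c.
  by rewrite mule_ge0// lee_fin mulr_ge0 ?poisson_kernel_ge0 ?ltW.
(* The translation for which [sub_time (z + h b) + sub_time (b + (z + h b)) = sub_time z]. *)
pose h (b : R) : R := (ln (1 + expR (- (2 * b))) / 2)%R.
have mh : measurable_fun [set: R] h.
  apply: measurable_funM => //; apply: measurableT_comp; first exact: measurable_ln.
  apply: measurable_funD => //; apply: measurableT_comp => //.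
  by apply: measurable_funN; exact: measurable_funM.
have h2 b : expR (2 * h b) = (1 + expR (- (2 * b)))%R.
  rewrite /h mulrCA divff ?mulr1 ?pnatr_eq0// lnK//.
  by rewrite posrE ltr_wpDr ?expR_ge0.
under eq_integral => a _.
  rewrite (@ge0_integral_shift a)//; last first.
    exact: (measurableT_comp (mm _ _ measurable_fst measurable_snd) (pair1_measurable a)).
  over.
rewrite (@fubini_tonelli _ _ _ _ _ mu mu (fun w => (poisson_kernel s w.1 *
  poisson_kernel t (w.2 + w.1))%:E * G (sub_time w.1 + sub_time (w.2 + w.1))%R))//;
  last first.
  by apply: mm => //; apply: measurable_funD.
under eq_integral => b _.
  rewrite (@ge0_integral_shift (h b))//; last first.
    have mm' := mm fst (fun w => w.2 + w.1)%R measurable_fst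
      (measurable_funD measurable_snd measurable_fst).
    exact: (measurableT_comp mm' (pair2_measurable b)).
  under eq_integral => z _.
    have -> : (sub_time (z + h b) + sub_time (b + (z + h b)) = sub_time z)%R.
      rewrite /sub_time -mulrDl; congr (_ / _)%R.
      transitivity (expR (- (2 * z)) * (expR (2 * h b))^-1 * (1 + expR (- (2 * b))))%R.
        rewrite -expRN [RHS]mulrDr mulr1 -!expRD; congr (expR _ + expR _)%R; ring.
      by rewrite h2 mulfVK// gt_eqF// ltr_wpDr ?expR_ge0.
    over.
  over.
rewrite (@fubini_tonelli _ _ _ _ _ mu mu (fun w => (poisson_kernel s (w.2 + h w.1) *
  poisson_kernel t (w.1 + (w.2 + h w.1)))%:E * G (sub_time w.2)))//; last first.
  have mw : measurable_fun setT (fun w : R * R => w.2 + h w.1)%R.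
    by apply: measurable_funD => //; exact: (measurableT_comp mh).
  apply: emeasurable_funM.
    apply/measurable_EFinP; apply: measurable_funM; apply: mk2 => //.
    exact: measurable_funD.
  by apply: (measurableT_comp mG); apply: mt2.
apply: eq_integral => z _ /=.
rewrite ge0_integralZr//; last 2 first.
- apply/measurable_EFinP; apply: measurable_funM.
    apply: (measurableT_comp (measurable_poisson_kernel _)).
    exact: measurable_funD.
  apply: (measurableT_comp (measurable_poisson_kernel _)).
  by apply: measurable_funD => //; exact: measurable_funD.
- by move=> b _; rewrite lee_fin mulr_ge0 ?poisson_kernel_ge0 ?ltW.
congr (_ * _).
have pE : (pi^-1 = (Num.sqrt pi)^-1 * (Num.sqrt pi)^-1 :> R)%R.
  by rewrite -invfM -expr2 sqr_sqrtr// pi_ge0.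
pose A := (4 * s * t / pi * expR z ^+ 2 * expR (- ((s + t) * expR z) ^+ 2))%R.
transitivity (\int[mu]_b (A%:E * ((expR b + expR (- b)) *
     expR (- (expR z * (t * expR b - s * expR (- b))) ^+ 2))%:E)).
  apply: eq_integral => b _; rewrite -EFinM; congr EFin.
  rewrite /poisson_kernel /A.
  have E2 : (expR b * expR (- b) = 1)%R by rewrite -expRD subrr expR0.
  have eh : (expR (h b) ^+ 2 = 1 + expR (- b) ^+ 2)%R.
    by rewrite -!expRM_natl h2 mulrN.
  (* Completion of the square, by [e^b e^(-b) = 1]: the two Gaussian exponents split into the
     exponent of the kernel at time [s + t] and the one integrated by [K]. *)
  have E3 : ((expR z * (t * expR b - s * expR (- b))) ^+ 2 + ((s + t) * expR z) ^+ 2 =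
     (s * expR (z + h b)) ^+ 2 + (t * expR (b + (z + h b))) ^+ 2)%R.
    rewrite !expRD !exprMn eh.
    transitivity (expR z ^+ 2 * (s ^+ 2 + t ^+ 2 + (s * expR (- b)) ^+ 2
       + (t * expR b) ^+ 2 + 2 * s * t * (1 - expR b * expR (- b))))%R; first by ring.
    rewrite E2; move: E2; set u := expR b; set v := expR (- b) => uv.
    rewrite subrr mulr0 addr0.
    transitivity (expR z ^+ 2 * (s ^+ 2 + t ^+ 2 * (u * v) ^+ 2 + (s * v) ^+ 2
       + (t * u) ^+ 2))%R; last by ring.
    by rewrite uv; ring.
  have E4 : (expR (- (s * expR (z + h b)) ^+ 2) *
     expR (- (t * expR (b + (z + h b))) ^+ 2) =
     expR (- ((s + t) * expR z) ^+ 2) *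
     expR (- (expR z * (t * expR b - s * expR (- b))) ^+ 2))%R.
    rewrite -[LHS]expRD -[RHS]expRD -!opprD -E3; congr (expR (- _))%R.
    exact: addrC.
  have E5 : (expR (z + h b) * expR (b + (z + h b)) =
     expR z ^+ 2 * (expR b + expR (- b)))%R.
    rewrite !expRD.
    transitivity (expR z ^+ 2 * expR b * expR (h b) ^+ 2)%R; first by ring.
    rewrite eh mulrDr mulr1 mulrDr expr2 [X in (_ + X)%R](_ : _ =
      (expR z ^+ 2 * ((expR b * expR (- b)) * expR (- b))))%R; last by ring.
    by rewrite E2 mul1r expr2.
  have -> : (4 * s * t / pi * expR z ^+ 2 * expR (- ((s + t) * expR z) ^+ 2) *
     ((expR b + expR (- b)) * expR (- (expR z * (t * expR b - s * expR (- b))) ^+ 2)) =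
     4 * s * t / pi * (expR z ^+ 2 * (expR b + expR (- b))) *
     (expR (- ((s + t) * expR z) ^+ 2) *
     expR (- (expR z * (t * expR b - s * expR (- b))) ^+ 2)))%R by ring.
  rewrite -E5 -E4 pE.
  by field; rewrite gt_eqF// sqrt_pi_gt0.
rewrite ge0_integralZl_EFin//; last 2 first.
- apply/measurable_EFinP; apply: measurable_funM.
    apply: measurable_funD => //.
    by apply: measurableT_comp => //; exact: measurable_funN.
  apply: measurableT_comp => //; apply: measurable_funN; apply: measurable_funX.
  apply: measurable_funM => //; apply: measurable_funB => //; apply: measurable_funM => //.
  by apply: measurableT_comp => //; exact: measurable_funN.
- by rewrite !mulr_ge0 ?expR_ge0 ?sqr_ge0 ?invr_ge0 ?pi_ge0 ?ltW.
rewrite K// -EFinM; congr EFin; rewrite /A /poisson_kernel.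
rewrite pE.
by field; rewrite !gt_eqF// ?expR_gt0// ?sqrt_pi_gt0.
Qed.

End subordinator.

Section subordination.
Context {R : realType} {d : nat}.
Notation mu := (@lebesgue_measure R).
Notation X := (d.-tuple R).
Notation gamma := (@gauss_measure R d).
Implicit Types (k : R -> R) (s t z : R) (F : X -> \bar R) (x : X).

Local Open Scope ereal_scope.

Definition ESub k F x : \bar R := \int[mu]_z ((k z)%:E * EOU (sub_time z) F x).

Lemma ESub_ge0 k F x : (forall z, 0 <= k z)%R -> (forall y, 0 <= F y) ->
  0 <= ESub k F x.
Proof.
move=> k0 F0; apply: integral_ge0 => z _.
by rewrite mule_ge0 ?lee_fin// EOU_ge0.
Qed.

Lemma measurable_EOU_time F x : measurable_fun setT F -> (forall y, 0 <= F y) ->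
  measurable_fun [set: R] (fun t => EOU t F x).
Proof.
move=> mF F0.
apply: (@measurable_EOU R d _ R id (F \o snd) (cst x)) => //.
  exact: (measurableT_comp mF).
by move=> z; exact: F0.
Qed.

Lemma measurable_EOU_point t F : measurable_fun setT F -> (forall y, 0 <= F y) ->
  measurable_fun setT (EOU t F).
Proof.
move=> mF F0.
apply: (@measurable_EOU R d _ X (cst t) (F \o snd) id) => //.
  exact: (measurableT_comp mF).
by move=> z; exact: F0.
Qed.

Lemma measurable_ESub d' (T : measurableType d') (k : T * R -> R)
    (F : T * X -> \bar R) (x : T -> X) : measurable_fun setT k ->
  (forall w, 0 <= k w)%R ->
  measurable_fun setT x -> measurable_fun setT F -> (forall w, 0 <= F w) ->
  measurable_fun setT (fun w => ESub (fun a => k (w, a)) (fun y => F (w, y)) (x w)).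
Proof.
move=> mk k0 mx mF F0.
apply: (@measurable_fun_fubini_tonelli_F _ _ T (measurableTypeR R) R mu
  (fun w : T * R => (k w)%:E * EOU (sub_time w.2) (fun y => F (w.1, y)) (x w.1))) => //.
  apply: emeasurable_funM; first exact/measurable_EFinP.
  apply: (@measurable_EOU R d _ (T * R)%type (sub_time \o snd)
     (fun w => F (w.1.1, w.2)) (x \o fst)) => //.
  - exact: (measurableT_comp (@measurable_sub_time R)).
  - exact: (measurableT_comp mx).
  - apply: (measurableT_comp mF); apply/measurable_fun_pairP; split => /=.
      exact: (measurableT_comp measurable_fst measurable_fst).
    exact: measurable_snd.
by move=> z; rewrite mule_ge0 ?lee_fin// EOU_ge0.
Qed.

Lemma measurable_ESub_point k F : measurable_fun setT k -> (forall z, 0 <= k z)%R ->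
  measurable_fun setT F -> (forall y, 0 <= F y) -> measurable_fun setT (ESub k F).
Proof.
move=> mk k0 mF F0.
apply: (@measurable_ESub _ X (k \o snd) (F \o snd) id) => //.
- exact: (measurableT_comp mk).
- by move=> z; exact: k0.
- exact: (measurableT_comp mF).
- by move=> z; exact: F0.
Qed.

Let measurable_integrand k F (h : X -> X) : measurable_fun setT k ->
  (forall z, 0 <= k z)%R -> measurable_fun setT h ->
  measurable_fun setT F -> (forall y, 0 <= F y) ->
  measurable_fun setT (fun w : X * measurableTypeR R =>
     (k w.2)%:E * EOU (sub_time w.2) F (h w.1)).
Proof.
move=> mk k0 mh mF F0; apply: emeasurable_funM.
  by apply/measurable_EFinP; exact: (measurableT_comp mk).
apply: (@measurable_EOU R d _ (X * measurableTypeR R)%type (sub_time \o snd)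
   (F \o snd) (h \o fst)) => //.
- exact: (measurableT_comp (@measurable_sub_time R)).
- exact: (measurableT_comp mh).
- exact: (measurableT_comp mF).
- by move=> z; exact: F0.
Qed.

Lemma integral_ESub k F : measurable_fun setT k -> (forall z, 0 <= k z)%R ->
  measurable_fun setT F -> (forall y, 0 <= F y) ->
  \int[gamma]_x ESub k F x = \int[mu]_z (k z)%:E * \int[gamma]_x F x.
Proof.
move=> mk k0 mF F0.
rewrite (@fubini_tonelli _ _ X (measurableTypeR R) R gamma mu
  (fun w => (k w.2)%:E * EOU (sub_time w.2) F w.1)); last 2 first.
- exact: (@measurable_integrand k F id).
- by move=> w; rewrite mule_ge0 ?lee_fin// EOU_ge0.
transitivity (\int[mu]_z ((k z)%:E * \int[gamma]_x F x)).
  apply: eq_integral => z _ /=; rewrite ge0_integralZl_EFin//.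
  - by rewrite integral_EOU//; exact: sub_time_gt0.
  - by move=> x _; rewrite EOU_ge0.
  - exact: measurable_EOU_point.
rewrite ge0_integralZr//.
- exact/measurable_EFinP.
- by move=> z _; rewrite lee_fin.
- exact: integral_ge0.
Qed.

Lemma ESub_poisson_semigroup s t F x : (0 < s)%R -> (0 < t)%R ->
  measurable_fun setT F -> (forall y, 0 <= F y) ->
  ESub (poisson_kernel s) (ESub (poisson_kernel t) F) x =
  ESub (poisson_kernel (s + t)) F x.
Proof.
move=> s0 t0 mF F0.
have ps z : (0 <= poisson_kernel s z)%R by rewrite poisson_kernel_ge0// ltW.
have pt z : (0 <= poisson_kernel t z)%R by rewrite poisson_kernel_ge0// ltW.
rewrite /ESub -(@ge0_poisson_kernel_convolution _ s t (fun a => EOU a F x))//; last 2 first.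
- exact: measurable_EOU_time.
- by move=> y; exact: EOU_ge0.
apply: eq_integral => a _.
transitivity ((poisson_kernel s a)%:E * \int[mu]_b
  ((poisson_kernel t b)%:E * EOU (sub_time a + sub_time b) F x)); last first.
  rewrite -ge0_integralZl_EFin//.
  - by apply: eq_integral => b _; rewrite muleA -EFinM.
  - by move=> b _; rewrite mule_ge0 ?lee_fin// EOU_ge0.
  - apply: emeasurable_funM.
      by apply/measurable_EFinP; exact: measurable_poisson_kernel.
    apply: (measurableT_comp (measurable_EOU_time x mF F0)).
    by apply: measurable_funD => //; exact: measurable_sub_time.
congr (_ * _).
rewrite [LHS](@fubini_tonelli _ _ X (measurableTypeR R) R gamma mu
  (fun w => (poisson_kernel t w.2)%:E * EOU (sub_time w.2) F
     (ou_point (sub_time a) w.1 x))); last 2 first.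
- apply: (@measurable_integrand _ F (fun u => ou_point (sub_time a) u x)) => //.
    exact: measurable_poisson_kernel.
  exact: measurable_ou_point.
- by move=> w; rewrite mule_ge0 ?lee_fin// EOU_ge0.
apply: eq_integral => b _; rewrite /= ge0_integralZl_EFin//; last 2 first.
- by move=> u _; rewrite EOU_ge0.
- apply: (measurableT_comp (measurable_EOU_point (sub_time b) mF F0)).
  exact: measurable_ou_point.
by rewrite -EOU_semigroup ?sub_time_gt0.
Qed.

(* [1 - e^{-y} >= y / (1 + y)] with [y = e^{-2z} / 2] *)
Lemma ou_rad_sub_time_ge z :
  ((ou_rad (sub_time z) ^- d) <= (1 + 2 * expR z ^+ 2) ^+ d :> R)%R.
Proof.
set r := ou_rad _; have r0 : (0 < r)%R by exact: ou_rad_gt0 (sub_time_gt0 z).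
have r1 : (r <= 1)%R by exact: ou_rad_le1.
rewrite -exprVn lerXn2r ?nnegrE ?invr_ge0 ?(ltW r0) ?addr_ge0 ?mulr_ge0 ?sqr_ge0//.
apply: (@le_trans _ _ (r ^- 2)).
  rewrite -exprVn expr2 ler_peMl ?invr_ge0 ?(ltW r0)// invr_ge1// ?unitfE ?gt_eqF//.
rewrite invf_ple ?posrE ?exprn_gt0 ?ltr_wpDr ?mulr_ge0 ?sqr_ge0//.
set W := expR z; have W0 : (0 < W)%R by exact: expR_gt0.
rewrite sqr_sqrtr; last by rewrite subr_ge0 expR_le1 oppr_le0 mulr_ge0// ltW// sub_time_gt0.
have -> : (2 * sub_time z = (2 * W ^+ 2)^-1)%R.
  rewrite /sub_time -expRM_natl expRN; field; rewrite expR_eq0//.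
set y := ((2 * W ^+ 2)^-1)%R; have y0 : (0 < y)%R.
  by rewrite invr_gt0 mulr_gt0// exprn_gt0.
have -> : ((1 + 2 * W ^+ 2)^-1 = 1 - (1 + y)^-1)%R.
  rewrite /y; field; rewrite !gt_eqF ?ltr_wpDr ?mulr_ge0 ?sqr_ge0//;
    rewrite mulr_gt0// exprn_gt0//.
rewrite lerD2l lerN2 expRN lef_pV2 ?posrE ?expR_gt0 ?addr_gt0//; exact: expR_ge1Dx.
Qed.

(** As [z] grows the time [sub_time z] tends to 0 and the bound [EOU_le] blows up, but only
    polynomially in [e^z]. Half of the exponent [(t e^z)^2] of the kernel absorbs this, and what is
    left is dominated by the kernel at time [t / 2]. *)
Lemma ESub_poisson_le t x : (0 < t)%R -> exists2 C : R, (0 <= C)%R &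
  forall F, measurable_fun setT F -> (forall y, 0 <= F y) ->
    ESub (poisson_kernel t) F x <= C%:E * \int[gamma]_y F y.
Proof.
move=> t0.
(* Chosen so that [d * eps <= t^2 / 2], with [d.+1] to avoid a division by 0; then [K = 1 + 2 / eps]
   gives [1 + 2 W^2 <= K (1 + eps W^2)]. *)
pose eps := (t ^+ 2 / (2 * d.+1%:R))%R.
have eps0 : (0 < eps)%R by rewrite divr_gt0 ?exprn_gt0// mulr_gt0.
pose K := (1 + 2 / eps)%R.
have K0 : (0 < K)%R by rewrite addr_gt0// divr_gt0.
pose C := (2 * K ^+ d * expR (enorm x ^+ 2))%R.
have C0 : (0 <= C)%R by rewrite !mulr_ge0 ?expR_ge0// exprn_ge0// ltW.
have kle z : (poisson_kernel t z * (ou_rad (sub_time z) ^- d * expR (enorm x ^+ 2))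
    <= C * poisson_kernel (t / 2) z)%R.
  set W := expR z; have W0 : (0 < W)%R by exact: expR_gt0.
  have poly : ((1 + 2 * W ^+ 2) ^+ d <= K ^+ d * expR (t ^+ 2 * W ^+ 2 / 2))%R.
    apply: (@le_trans _ _ ((K * expR (eps * W ^+ 2)) ^+ d)%R).
      rewrite lerXn2r ?nnegrE ?addr_ge0 ?mulr_ge0 ?sqr_ge0 ?expR_ge0 ?(ltW K0)//.
      apply: (@le_trans _ _ (K * (1 + eps * W ^+ 2))%R).
        have -> : (K * (1 + eps * W ^+ 2) =
            1 + 2 * W ^+ 2 + (2 / eps + eps * W ^+ 2))%R.
          by rewrite /K; field; rewrite gt_eqF.
        have h1 : (0 <= eps * W ^+ 2)%R by rewrite mulr_ge0 ?sqr_ge0 ?ltW.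
        have h2 : (0 <= 2 / eps)%R by rewrite divr_ge0 ?ltW.
        lra.
      by rewrite ler_wpM2l ?(ltW K0)//; exact: expR_ge1Dx.
    rewrite exprMn ler_wpM2l ?exprn_ge0 ?(ltW K0)//.
    rewrite -expRM_natl ler_expR /eps.
    have -> : (d%:R * (t ^+ 2 / (2 * d.+1%:R) * W ^+ 2) =
      (d%:R / d.+1%:R) * (t ^+ 2 * W ^+ 2 / 2) :> R)%R.
      have : d.+1%:R != 0%R :> R by rewrite pnatr_eq0.
      by move: (d.+1%:R : R) => D D0; field.
    rewrite ler_piMl ?divr_ge0 ?mulr_ge0 ?sqr_ge0 ?(ltW t0) ?(ltW W0)//.
    by rewrite ler_pdivrMr// mul1r ler_nat.
  have ke : (poisson_kernel t z * expR (t ^+ 2 * W ^+ 2 / 2) <=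
      2 * poisson_kernel (t / 2) z)%R.
    have he : (expR (- (t * W) ^+ 2) * expR (t ^+ 2 * W ^+ 2 / 2) <=
        expR (- (t / 2 * W) ^+ 2))%R.
      rewrite -expRD ler_expR !exprMn.
      have : (0 <= t ^+ 2 * W ^+ 2)%R by rewrite mulr_ge0 ?sqr_ge0.
      lra.
    rewrite /poisson_kernel -/W.
    have -> : (2 * (2 / Num.sqrt pi * (t / 2) * W * expR (- (t / 2 * W) ^+ 2)) =
       2 / Num.sqrt pi * t * W * expR (- (t / 2 * W) ^+ 2))%R.
      by field; rewrite gt_eqF// sqrt_pi_gt0.
    rewrite -[leLHS]mulrA ler_wpM2l// !mulr_ge0 ?invr_ge0 ?sqrtr_ge0//; exact: ltW.
  rewrite mulrA.
  apply: (@le_trans _ _ (poisson_kernel t z * (K ^+ d * expR (t ^+ 2 * W ^+ 2 / 2)) *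
      expR (enorm x ^+ 2))%R).
    rewrite ler_wpM2r ?expR_ge0// ler_wpM2l ?poisson_kernel_ge0 ?(ltW t0)//.
    exact: (le_trans (ou_rad_sub_time_ge z)).
  rewrite /C.
  have -> : (poisson_kernel t z * (K ^+ d * expR (t ^+ 2 * W ^+ 2 / 2)) *
     expR (enorm x ^+ 2) = K ^+ d * expR (enorm x ^+ 2) *
      (poisson_kernel t z * expR (t ^+ 2 * W ^+ 2 / 2)))%R by ring.
  have -> : (2 * K ^+ d * expR (enorm x ^+ 2) * poisson_kernel (t / 2) z =
     K ^+ d * expR (enorm x ^+ 2) * (2 * poisson_kernel (t / 2) z))%R by ring.
  by rewrite ler_wpM2l// mulr_ge0 ?expR_ge0// exprn_ge0// ltW.
exists C => // F mF F0.
have I0 : 0 <= \int[gamma]_y F y by exact: integral_ge0.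
have t20 : (0 < t / 2)%R by rewrite divr_gt0.
apply: (@le_trans _ _ (\int[mu]_z ((C * poisson_kernel (t / 2) z)%:E * \int[gamma]_y F y))).
  apply: ge0_le_integral => //.
  - by move=> z _; rewrite mule_ge0 ?lee_fin ?EOU_ge0// poisson_kernel_ge0// ltW.
  - apply: emeasurable_funM.
      by apply/measurable_EFinP; exact: measurable_poisson_kernel.
    apply: (measurableT_comp (measurable_EOU_time x mF F0)).
    exact: measurable_sub_time.
  - apply: emeasurable_funM => //; apply/measurable_EFinP; apply: measurable_funM => //.
    exact: measurable_poisson_kernel.
  - move=> z _.
    apply: (@le_trans _ _ ((poisson_kernel t z)%:E * ((ou_rad (sub_time z) ^- d *
        expR (enorm x ^+ 2))%:E * \int[gamma]_y F y))).
      rewrite lee_wpmul2l ?lee_fin ?poisson_kernel_ge0 ?(ltW t0)//.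
      by apply: EOU_le => //; exact: sub_time_gt0.
    by rewrite muleA -EFinM lee_wpmul2r// lee_fin.
have m1 : measurable_fun setT (fun z => (poisson_kernel (t / 2) z)%:E).
  by apply/measurable_EFinP; exact: measurable_poisson_kernel.
rewrite ge0_integralZr//; last 2 first.
- by apply/measurable_EFinP; apply: measurable_funM => //; exact: measurable_poisson_kernel.
- by move=> z _; rewrite lee_fin mulr_ge0// poisson_kernel_ge0// ltW.
under eq_integral do rewrite EFinM.
rewrite ge0_integralZl_EFin//; last first.
  by move=> z _; rewrite lee_fin poisson_kernel_ge0// ltW.
by rewrite integral_poisson_kernel// mule1.
Qed.

End subordination.

(** * Operators on integrable functions *)

Section Rintegral_extra.
Local Open Scope ereal_scope.

(** No integrability is assumed: the real integral is [fine] of a difference of two measurable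
    extended integrals, so its default values are assigned measurably. *)
Lemma measurable_Rintegral d1 d2 (T1 : measurableType d1) (T2 : measurableType d2)
    (R : realType) (m2 : {sigma_finite_measure set T2 -> \bar R}) (f : T1 * T2 -> R) :
  measurable_fun setT f ->
  measurable_fun setT (fun x => (\int[m2]_y f (x, y))%R).
Proof.
move=> mf.
have mF : measurable_fun setT (EFin \o f) by exact/measurable_EFinP.
rewrite /Rintegral; apply: (measurableT_comp (@fine_measurable R setT measurableT)).
under eq_fun do rewrite integralE.
apply: emeasurable_funB.
  have H := @measurable_fun_fubini_tonelli_F _ _ T1 T2 R m2 _
    (measurable_funepos mF) (funepos_ge0 _).
  rewrite [X in measurable_fun _ X](_ : _ = fubini_F m2 (funepos (EFin \o f))) //.
  by apply/funext => x; apply: eq_integral => y _; rewrite !funeposE.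
have H := @measurable_fun_fubini_tonelli_F _ _ T1 T2 R m2 _
  (measurable_funeneg mF) (funeneg_ge0 _).
rewrite [X in measurable_fun _ X](_ : _ = fubini_F m2 (funeneg (EFin \o f))) //.
by apply/funext => x; apply: eq_integral => y _; rewrite !funenegE.
Qed.

Lemma abs_fine_le (R : realType) (x : \bar R) : `|fine x|%:E <= `|x|.
Proof. by case: x => [r| |] /=; rewrite ?normr0 ?leey. Qed.

Lemma abs_Rintegral_le d (T : measurableType d) (R : realType)
    (m : {measure set T -> \bar R}) (f : T -> R) : measurable_fun setT f ->
  (`|(\int[m]_x f x)%R|)%:E <= \int[m]_x `|f x|%:E.
Proof.
move=> mf; rewrite /Rintegral (le_trans (abs_fine_le _))//.
by apply: le_abse_integral => //; exact/measurable_EFinP.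
Qed.

Lemma ge0_EFin_Rintegral d (T : measurableType d) (R : realType)
    (m : {measure set T -> \bar R}) (f : T -> R) : (forall x, 0 <= f x)%R ->
  \int[m]_x (f x)%:E < +oo -> ((\int[m]_x f x)%R)%:E = \int[m]_x (f x)%:E.
Proof.
move=> f0 fi; rewrite /Rintegral fineK// ge0_fin_numE//.
by apply: integral_ge0 => x _; rewrite lee_fin.
Qed.

Lemma integrable_realP d (T : measurableType d) (R : realType)
    (m : {measure set T -> \bar R}) (f : T -> R) :
  m.-integrable setT (EFin \o f) <->
  measurable_fun setT f /\ \int[m]_x `|f x|%:E < +oo.
Proof.
split; first by move=> /integrableP[/measurable_EFinP].
by move=> [mf fi]; apply/integrableP; split => //; exact/measurable_EFinP.
Qed.

(** Absolute convergence makes almost every inner integral finite; there [fine] loses nothing, and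
    the default values elsewhere sit on a null set. *)
Lemma Rintegral_swap d1 d2 (T1 : measurableType d1) (T2 : measurableType d2)
    (R : realType) (m1 : {sigma_finite_measure set T1 -> \bar R})
    (m2 : {sigma_finite_measure set T2 -> \bar R}) (f : T1 * T2 -> R) :
  measurable_fun setT f -> \int[m1]_x \int[m2]_y `|f (x, y)|%:E < +oo ->
  (\int[m1]_x \int[m2]_y f (x, y) = \int[m2]_y \int[m1]_x f (x, y))%R.
Proof.
move=> mf fi.
have mF : measurable_fun setT (EFin \o f) by exact/measurable_EFinP.
have iF : (m1 \x m2).-integrable setT (EFin \o f) by apply/integrable12ltyP.
rewrite /Rintegral; congr fine.
transitivity (\int[m1]_x \int[m2]_y (EFin \o f) (x, y)).
  apply: ae_eq_integral => //.
  - apply/measurable_EFinP; exact: (@measurable_Rintegral _ _ T1 T2 R m2 f).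
  - exact: (@measurable_fubini_F _ _ T1 T2 R m1 m2 _ iF).
  - have := @ae_integrable1 _ _ T1 T2 R m1 m2 _ iF.
    apply: filterS => x ix _; rewrite fineK//; exact: integrable_fin_num.
rewrite (Fubini iF); apply: ae_eq_integral => //.
- exact: (@measurable_fubini_G _ _ T1 T2 R m1 m2 _ iF).
- apply/measurable_EFinP.
  apply: (@measurable_Rintegral _ _ T2 T1 R m1 (fun z => f (z.2, z.1))).
  exact: (measurableT_comp mf (@measurable_swap _ _ _ _)).
- have := @ae_integrable2 _ _ T1 T2 R m1 m2 _ iF.
  apply: filterS => x ix _; rewrite fineK//; exact: integrable_fin_num.
Qed.

End Rintegral_extra.

Section ornstein_uhlenbeck_operator.
Context {R : realType} {d : nat}.
Notation mu := (@lebesgue_measure R).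
Notation X := (d.-tuple R).
Notation gamma := (@gauss_measure R d).
Notation L1 f := (gamma.-integrable setT (EFin \o f)).
Notation OU := ornstein_uhlenbeck.
Implicit Types (k l : R -> R) (s t : R) (f g : X -> R) (x : X).

Local Open Scope ereal_scope.

Notation absE f := (fun y => `|f y|%:E).

Lemma measurable_absE d' (T : measurableType d') (f : T -> R) :
  measurable_fun setT f -> measurable_fun setT (absE f).
Proof. by move=> mf; apply/measurable_EFinP; exact: measurableT_comp. Qed.

Lemma measurable_OU d' (T : measurableType d') (t : T -> R) (f : T * X -> R)
    (x : T -> X) : measurable_fun setT t -> measurable_fun setT x ->
  measurable_fun setT f ->
  measurable_fun setT (fun w => OU (t w) (fun y => f (w, y)) (x w)).
Proof.
move=> mt mx mf.
apply: (@measurable_Rintegral _ _ T X R gamma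
  (fun w => f (w.1, ou_point (t w.1) w.2 (x w.1)))).
apply: (measurableT_comp mf); apply/measurable_fun_pairP; split.
  exact: measurable_fst.
apply: measurable_ou_point => //.
  exact: (measurableT_comp mt).
exact: (measurableT_comp mx).
Qed.

Lemma measurable_OU_point t f : measurable_fun setT f -> measurable_fun setT (OU t f).
Proof.
move=> mf; apply: (@measurable_OU _ X (cst t) (f \o snd) id) => //.
exact: (measurableT_comp mf).
Qed.

Lemma abs_OU_le t f x : measurable_fun setT f -> `|OU t f x|%:E <= EOU t (absE f) x.
Proof.
move=> mf.
apply: (@abs_Rintegral_le _ X R gamma (fun u => f (ou_point t u x))).
by apply: (measurableT_comp mf); exact: measurable_ou_point.
Qed.

Lemma EOU_lty t (F : X -> \bar R) x : (0 < t)%R -> measurable_fun setT F ->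
  (forall y, 0 <= F y) -> \int[gamma]_y F y < +oo -> EOU t F x < +oo.
Proof.
move=> t0 mF F0 Fi; apply: (le_lt_trans (EOU_le x t0 mF F0)).
by rewrite lte_mul_pinfty// lee_fin mulr_ge0 ?expR_ge0// invr_ge0 exprn_ge0// ou_rad_ge0.
Qed.

Lemma integrable_ou_point t f x : (0 < t)%R -> L1 f ->
  L1 (fun u => f (ou_point t u x)).
Proof.
move=> t0 /integrable_realP[mf fi]; apply/integrable_realP; split.
  by apply: (measurableT_comp mf); exact: measurable_ou_point.
by apply: (@EOU_lty t (absE f) x) => //; exact: measurable_absE.
Qed.

Lemma integrable_OU t f : (0 < t)%R -> L1 f -> L1 (OU t f).
Proof.
move=> t0 /integrable_realP[mf fi]; apply/integrable_realP; split.
  exact: measurable_OU_point.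
have ma := measurable_absE mf.
apply: le_lt_trans fi; rewrite -(integral_EOU t0 ma)//.
apply: ge0_le_integral => //.
- by apply: measurable_absE; exact: measurable_OU_point.
- exact: measurable_EOU_point.
- by move=> x _; exact: abs_OU_le.
Qed.

Lemma OUB t f g x : (0 < t)%R -> L1 f -> L1 g ->
  OU t (f \- g)%R x = (OU t f x - OU t g x)%R.
Proof.
move=> t0 fi gi; rewrite /ornstein_uhlenbeck -RintegralB//; exact: integrable_ou_point.
Qed.

Lemma OUZ t c f x : (0 < t)%R -> L1 f -> OU t (fun y => c * f y)%R x = (c * OU t f x)%R.
Proof.
move=> t0 fi; rewrite /ornstein_uhlenbeck -RintegralZl//; exact: integrable_ou_point.
Qed.

Lemma ge0_EFin_OU t f x : (0 < t)%R -> (forall y, 0 <= f y)%R -> L1 f ->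
  (OU t f x)%:E = EOU t (EFin \o f) x.
Proof.
move=> t0 f0 /(integrable_ou_point x t0)/integrable_realP[_ fi].
rewrite /ornstein_uhlenbeck ge0_EFin_Rintegral//.
by apply: le_lt_trans fi; rewrite le_eqVlt; apply/orP; left; apply/eqP;
  apply: eq_integral => y _; rewrite ger0_norm.
Qed.

End ornstein_uhlenbeck_operator.

Section compose_positive_operators.
Context {R : realType} {d : nat}.
Notation X := (d.-tuple R).
Notation gamma := (@gauss_measure R d).
Notation L1 f := (gamma.-integrable setT (EFin \o f)).

Definition positive_operator (A : (X -> R) -> X -> R)
    (EA : (X -> \bar R) -> X -> \bar R) :=
  [/\ forall f, L1 f -> L1 (A f),
      forall f g x, L1 f -> L1 g -> A (f \- g) x = A f x - A g x,
      forall f x, (forall y, 0 <= f y) -> L1 f -> (A f x)%:E = EA (EFin \o f) x &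
      forall F x, (forall y, 0 <= F y)%E -> (0 <= EA F x)%E].

(* Identities between positive operators transfer from nonnegative functions
   to [L1] by splitting into positive and negative parts. *)
Lemma positive_operator_comp A EA B EB C EC :
  positive_operator A EA -> positive_operator B EB -> positive_operator C EC ->
  (forall F x, measurable_fun setT F -> (forall y, 0 <= F y)%E ->
     EA (EB F) x = EC F x) ->
  forall f x, L1 f -> A (B f) x = C f x.
Proof.
move=> [A1 AB AE A0] [B1 BB BE B0] [C1 CB CE C0] ABC f x fi.
have [mf _] := (integrable_realP gamma f).1 fi.
have pos g : (forall y, 0 <= g y) -> L1 g -> A (B g) x = C g x.
  move=> g0 gi; apply: EFin_inj.
  have Bg y : 0 <= B g y by rewrite -lee_fin BE// B0// => z; rewrite lee_fin.
  rewrite AE//; last exact: B1.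
  rewrite (_ : EFin \o B g = EB (EFin \o g)); last first.
    by apply/funext => y; rewrite -BE.
  rewrite ABC; last 2 first.
  - exact: measurable_int gi.
  - by move=> y; rewrite lee_fin.
  by rewrite CE.
have pi : L1 f^\+ by exact: integrable_funrpos.
have ni : L1 f^\- by exact: integrable_funrneg.
have fE : f = (f^\+ \- f^\-) by rewrite -[LHS]funrposBneg.
rewrite [in LHS]fE [in RHS]fE CB//.
rewrite (_ : B _ = B f^\+ \- B f^\-); last first.
  by apply/funext => y; rewrite BB.
by rewrite AB ?pos//; exact: B1.
Qed.

End compose_positive_operators.

Section subordinated_operator.
Context {R : realType} {d : nat}.
Notation mu := (@lebesgue_measure R).
Notation X := (d.-tuple R).
Notation gamma := (@gauss_measure R d).
Notation L1 f := (gamma.-integrable setT (EFin \o f)).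
Notation OU := ornstein_uhlenbeck.
Implicit Types (k l : R -> R) (s t : R) (f g : X -> R) (x : X).

Local Open Scope ereal_scope.

Notation absE f := (fun y => `|f y|%:E).

Lemma OU_positive t : (0 < t)%R -> @positive_operator R d (OU t) (EOU t).
Proof.
move=> t0; split.
- by move=> f; exact: integrable_OU.
- by move=> f g x; exact: OUB.
- by move=> f x; exact: ge0_EFin_OU.
- by move=> F x; exact: EOU_ge0.
Qed.

Lemma OU_semigroup s t f x : (0 < s)%R -> (0 < t)%R -> L1 f ->
  OU s (OU t f) x = OU (s + t) f x.
Proof.
move=> s0 t0; apply: (positive_operator_comp (OU_positive s0) (OU_positive t0)
  (OU_positive (addr_gt0 s0 t0))) => F y mF F0.
exact: EOU_semigroup.
Qed.

Definition Sub k f x : R := (\int[mu]_z (k z * OU (sub_time z) f x))%R.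

(** Covers signed kernels such as time derivatives of [poisson_kernel]. The time [s] of the
    dominating kernel is free, since a derivative is dominated only at a smaller time. *)
Definition dominated k := measurable_fun setT k /\
  exists c s, [/\ (0 <= c)%R, (0 < s)%R &
    forall z, (`|k z| <= c * poisson_kernel s z)%R].

Lemma dominated_poisson_kernel t : (0 < t)%R -> dominated (poisson_kernel t).
Proof.
move=> t0; split; first exact: measurable_poisson_kernel.
exists 1%R, t; split => // z; rewrite mul1r ger0_norm//.
by rewrite poisson_kernel_ge0// ltW.
Qed.

Lemma measurable_Sub d' (T : measurableType d') (k : T * R -> R) (f : T * X -> R)
    (x : T -> X) : measurable_fun setT k -> measurable_fun setT x ->
  measurable_fun setT f ->
  measurable_fun setT (fun w => Sub (fun z => k (w, z)) (fun y => f (w, y)) (x w)).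
Proof.
move=> mk mx mf.
apply: (@measurable_Rintegral _ _ T (measurableTypeR R) R mu
  (fun w => (k w * OU (sub_time w.2) (fun y => f (w.1, y)) (x w.1))%R)).
apply: measurable_funM => //.
apply: (@measurable_OU R d _ (T * R)%type (sub_time \o snd)
   (fun w => f (w.1.1, w.2)) (x \o fst)).
- exact: (measurableT_comp (@measurable_sub_time R)).
- exact: (measurableT_comp mx).
- apply: (measurableT_comp mf); apply/measurable_fun_pairP; split => /=.
    exact: (measurableT_comp measurable_fst measurable_fst).
  exact: measurable_snd.
Qed.

Lemma measurable_Sub_point k f : measurable_fun setT k -> measurable_fun setT f ->
  measurable_fun setT (Sub k f).
Proof.
move=> mk mf; apply: (@measurable_Sub _ X (k \o snd) (f \o snd) id) => //.
  exact: (measurableT_comp mk).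
exact: (measurableT_comp mf).
Qed.

Lemma measurable_Sub_integrand k f x : measurable_fun setT k -> measurable_fun setT f ->
  measurable_fun setT (fun z => k z * OU (sub_time z) f x)%R.
Proof.
move=> mk mf; apply: measurable_funM => //.
apply: (@measurable_OU R d _ R (@sub_time R) (f \o snd) (cst x)) => //.
  exact: measurable_sub_time.
exact: (measurableT_comp mf).
Qed.

Lemma integral_abs_Sub_integrand_le k f x : measurable_fun setT k -> measurable_fun setT f ->
  \int[mu]_z `|(k z * OU (sub_time z) f x)%R|%:E <= ESub (fun z => `|k z|)%R (absE f) x.
Proof.
move=> mk mf; apply: ge0_le_integral => //.
- by apply: measurable_absE; exact: measurable_Sub_integrand.
- apply: emeasurable_funM; first exact: measurable_absE.
  apply: (measurableT_comp (measurable_EOU_time x (measurable_absE mf) _)) => //.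
  exact: measurable_sub_time.
- move=> z _; rewrite normrM EFinM lee_wpmul2l ?lee_fin//; exact: abs_OU_le.
Qed.

Lemma abs_Sub_le k f x : measurable_fun setT k -> measurable_fun setT f ->
  `|Sub k f x|%:E <= ESub (fun z => `|k z|)%R (absE f) x.
Proof.
move=> mk mf; rewrite (le_trans _ (integral_abs_Sub_integrand_le x mk mf))//.
apply: (@abs_Rintegral_le _ (measurableTypeR R) R mu).
exact: measurable_Sub_integrand.
Qed.

Lemma ESub_dominated_le k (F : X -> \bar R) x c s : measurable_fun setT k ->
  (0 <= c)%R -> (0 < s)%R -> (forall z, (`|k z| <= c * poisson_kernel s z)%R) ->
  measurable_fun setT F -> (forall y, 0 <= F y) ->
  ESub (fun z => `|k z|)%R F x <= c%:E * ESub (poisson_kernel s) F x.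
Proof.
move=> mk c0 s0 kle mF F0.
have mE : measurable_fun [set: R] (fun z => EOU (sub_time z) F x).
  apply: (measurableT_comp (measurable_EOU_time x mF F0)).
  exact: measurable_sub_time.
have mP : measurable_fun [set: R] (fun z => (poisson_kernel s z)%:E).
  by apply/measurable_EFinP; exact: measurable_poisson_kernel.
have ps z : (0 <= poisson_kernel s z)%R by rewrite poisson_kernel_ge0// ltW.
rewrite /ESub -ge0_integralZl_EFin//; last 2 first.
- by move=> z _; rewrite mule_ge0 ?lee_fin// EOU_ge0.
- exact: emeasurable_funM.
apply: ge0_le_integral => //.
- by move=> z _; rewrite mule_ge0 ?lee_fin// EOU_ge0.
- by apply: emeasurable_funM => //; exact: measurable_absE.
- by apply: measurable_funeM; exact: emeasurable_funM.
- by move=> z _; rewrite muleA -EFinM lee_wpmul2r ?EOU_ge0// lee_fin.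
Qed.

Lemma ESub_dominated_bound k x : dominated k -> exists2 C : R, (0 <= C)%R &
  forall F : X -> \bar R, measurable_fun setT F -> (forall y, 0 <= F y) ->
    ESub (fun z => `|k z|)%R F x <= C%:E * \int[gamma]_y F y.
Proof.
move=> [mk [c [s [c0 s0 kle]]]]; have [C C0 CP] := ESub_poisson_le x s0.
exists (c * C)%R; first exact: mulr_ge0.
move=> F mF F0; apply: (le_trans (ESub_dominated_le x mk c0 s0 kle mF F0)).
by rewrite EFinM -muleA lee_wpmul2l ?lee_fin//; exact: CP.
Qed.

Lemma integral_dominated_lty k : dominated k -> \int[mu]_z `|k z|%:E < +oo.
Proof.
move=> [mk [c [s [c0 s0 kle]]]].
have mP : measurable_fun [set: R] (fun z => (poisson_kernel s z)%:E).
  by apply/measurable_EFinP; exact: measurable_poisson_kernel.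
apply: (@le_lt_trans _ _ (\int[mu]_z (c%:E * (poisson_kernel s z)%:E))).
  apply: ge0_le_integral => //.
  - exact: measurable_absE.
  - exact: measurable_funeM.
  - by move=> z _; rewrite -EFinM lee_fin.
rewrite ge0_integralZl_EFin//; last first.
  by move=> z _; rewrite lee_fin poisson_kernel_ge0// ltW.
by rewrite integral_poisson_kernel// mule1 ltry.
Qed.

Lemma integrable_Sub_integrand k f x : dominated k -> L1 f ->
  mu.-integrable setT (EFin \o (fun z => k z * OU (sub_time z) f x)%R).
Proof.
move=> kd /integrable_realP[mf fi]; have [mk _] := kd.
apply/(@integrable_realP _ (measurableTypeR R)); split.
  exact: measurable_Sub_integrand.
apply: (le_lt_trans (integral_abs_Sub_integrand_le x mk mf)).
have [C C0 CP] := ESub_dominated_bound x kd.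
apply: (le_lt_trans (CP _ (measurable_absE mf) _)) => //.
by rewrite lte_mul_pinfty// lee_fin.
Qed.

Lemma integrable_Sub k f : dominated k -> L1 f -> L1 (Sub k f).
Proof.
move=> kd /integrable_realP[mf fi]; have [mk _] := kd.
apply/integrable_realP; split; first exact: measurable_Sub_point.
have ma := measurable_absE mf.
apply: (@le_lt_trans _ _ (\int[gamma]_x ESub (fun z => `|k z|)%R (absE f) x)).
  apply: ge0_le_integral => //.
  - by apply: measurable_absE; exact: measurable_Sub_point.
  - apply: measurable_ESub_point => //; exact: measurableT_comp.
  - by move=> x _; exact: abs_Sub_le.
rewrite integral_ESub//; last exact: measurableT_comp.
apply: lte_mul_pinfty => //; first by apply: integral_ge0.
by rewrite ge0_fin_numE ?integral_dominated_lty//; apply: integral_ge0.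
Qed.

Lemma SubB k f g x : dominated k -> L1 f -> L1 g ->
  Sub k (f \- g)%R x = (Sub k f x - Sub k g x)%R.
Proof.
move=> kd fi gi.
rewrite /Sub -(@RintegralB _ (measurableTypeR R) R mu setT)//; last 2 first.
- exact: integrable_Sub_integrand.
- exact: integrable_Sub_integrand.
apply: eq_Rintegral => z _; rewrite OUB ?sub_time_gt0//; exact: mulrBr.
Qed.

Lemma SubZ k c f x : dominated k -> L1 f ->
  Sub k (fun y => c * f y)%R x = (c * Sub k f x)%R.
Proof.
move=> kd fi.
rewrite /Sub -(@RintegralZl _ (measurableTypeR R) R mu setT)//; last first.
  exact: integrable_Sub_integrand.
by apply: eq_Rintegral => z _; rewrite OUZ ?sub_time_gt0// mulrCA.
Qed.

Lemma Sub_positive t : (0 < t)%R ->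
  @positive_operator R d (Sub (poisson_kernel t)) (ESub (poisson_kernel t)).
Proof.
move=> t0; have kd := dominated_poisson_kernel t0.
have pt z : (0 <= poisson_kernel t z)%R by rewrite poisson_kernel_ge0// ltW.
split.
- by move=> f; exact: integrable_Sub.
- by move=> f g x; exact: SubB.
- move=> f x f0 fi.
  have := integrable_Sub_integrand x kd fi.
  move=> /(@integrable_realP _ (measurableTypeR R))[mi ii].
  have OU0 z : (0 <= OU (sub_time z) f x)%R.
    rewrite -lee_fin ge0_EFin_OU ?sub_time_gt0//.
    by apply: EOU_ge0 => y; rewrite lee_fin.
  rewrite /Sub (@ge0_EFin_Rintegral _ (measurableTypeR R)).
  + by apply: eq_integral => z _; rewrite EFinM ge0_EFin_OU ?sub_time_gt0.
  + by move=> z; rewrite mulr_ge0.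
  + apply: le_lt_trans ii; rewrite le_eqVlt; apply/orP; left; apply/eqP.
    by apply: eq_integral => z _; rewrite ger0_norm// mulr_ge0.
- by move=> F x F0; exact: ESub_ge0.
Qed.

Lemma Sub_poisson_semigroup s t f x : (0 < s)%R -> (0 < t)%R -> L1 f ->
  Sub (poisson_kernel s) (Sub (poisson_kernel t) f) x = Sub (poisson_kernel (s + t)) f x.
Proof.
move=> s0 t0; apply: (positive_operator_comp (Sub_positive s0) (Sub_positive t0)
  (Sub_positive (addr_gt0 s0 t0))) => F y mF F0.
exact: ESub_poisson_semigroup.
Qed.

(** The exchange holds at every [x]: the pointwise bound [EOU_le] turns integrability against the
    Gaussian measure into absolute convergence at the given point. *)
Lemma OU_Rintegral t (h : R * X -> R) x : (0 < t)%R -> measurable_fun setT h ->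
  \int[mu]_z \int[gamma]_y `|h (z, y)|%:E < +oo ->
  OU t (fun y => \int[mu]_z h (z, y))%R x = (\int[mu]_z OU t (fun y => h (z, y)) x)%R.
Proof.
move=> t0 mh hi.
have mh' : measurable_fun setT (fun w : X * measurableTypeR R =>
    h (w.2, ou_point t w.1 x)).
  apply: (measurableT_comp mh); apply/measurable_fun_pairP; split.
    exact: measurable_snd.
  by apply: measurable_ou_point.
apply: (@Rintegral_swap _ _ X (measurableTypeR R) R gamma mu
  (fun w => h (w.2, ou_point t w.1 x)) mh').
have ma : measurable_fun setT (fun w : X * measurableTypeR R =>
    `|h (w.2, ou_point t w.1 x)|%:E) by exact: measurable_absE.
rewrite (@fubini_tonelli _ _ X (measurableTypeR R) R gamma mu
  (fun w => `|h (w.2, ou_point t w.1 x)|%:E))//.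
have c0 : (0 <= ou_rad t ^- d * expR (enorm x ^+ 2))%R.
  by rewrite mulr_ge0 ?expR_ge0// invr_ge0 exprn_ge0// ou_rad_ge0.
have mah : measurable_fun setT (fun w : measurableTypeR R * X => `|h w|%:E).
  exact: measurable_absE.
have mg : measurable_fun setT (fun z => \int[gamma]_y `|h (z, y)|%:E).
  exact: (@measurable_fun_fubini_tonelli_F _ _ (measurableTypeR R) X R gamma _ mah).
apply: (@le_lt_trans _ _ (\int[mu]_z ((ou_rad t ^- d * expR (enorm x ^+ 2))%:E *
    \int[gamma]_y `|h (z, y)|%:E))).
  apply: ge0_le_integral => //.
  - by move=> z _; exact: integral_ge0.
  - exact: (@measurable_fun_fubini_tonelli_G _ _ X (measurableTypeR R) R gamma _ ma).
  - exact: measurable_funeM.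
  - move=> z _; apply: (@EOU_le R d t (fun y => `|h (z, y)|%:E) x) => //.
    exact: (measurableT_comp mah (pair1_measurable z)).
rewrite ge0_integralZl_EFin//; last by move=> z _; exact: integral_ge0.
by rewrite lte_mul_pinfty// lee_fin.
Qed.

Lemma Sub_Rintegral k (h : R * X -> R) x : dominated k -> measurable_fun setT h ->
  \int[mu]_z \int[gamma]_y `|h (z, y)|%:E < +oo ->
  Sub k (fun y => \int[mu]_z h (z, y))%R x = (\int[mu]_z Sub k (fun y => h (z, y)) x)%R.
Proof.
move=> kd mh hi; have [mk _] := kd.
rewrite /Sub.
have mah : measurable_fun setT (fun w : measurableTypeR R * X => `|h w|%:E).
  exact: measurable_absE.
have mg : measurable_fun setT (fun z => \int[gamma]_y `|h (z, y)|%:E).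
  exact: (@measurable_fun_fubini_tonelli_F _ _ (measurableTypeR R) X R gamma _ mah).
have mO : measurable_fun setT (fun w : measurableTypeR R * measurableTypeR R =>
     OU (sub_time w.1) (fun y => h (w.2, y)) x).
  apply: (@measurable_OU R d _ (measurableTypeR R * measurableTypeR R)%type
    (sub_time \o fst) (fun w => h (w.1.2, w.2)) (cst x)) => //.
    exact: (measurableT_comp (@measurable_sub_time R)).
  apply: (measurableT_comp mh); apply/measurable_fun_pairP; split => /=.
    exact: (measurableT_comp measurable_snd measurable_fst).
  exact: measurable_snd.
have mkO : measurable_fun setT (fun w : measurableTypeR R * measurableTypeR R =>
     (k w.1 * OU (sub_time w.1) (fun y => h (w.2, y)) x)%R).
  by apply: measurable_funM => //; exact: (measurableT_comp mk).
have mhz z : measurable_fun setT (fun y => h (z, y)).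
  exact: (measurableT_comp mh (pair1_measurable z)).
transitivity (\int[mu]_z \int[mu]_a (k z * OU (sub_time z) (fun y => h (a, y)) x))%R.
  apply: eq_Rintegral => z _; rewrite OU_Rintegral ?sub_time_gt0//.
  rewrite -(@RintegralZl _ (measurableTypeR R) R mu setT)//.
  apply/(@integrable_realP _ (measurableTypeR R)); split.
    exact: (measurableT_comp mO (pair1_measurable z)).
  set C := (ou_rad (sub_time z) ^- d * expR (enorm x ^+ 2))%R.
  have C0 : (0 <= C)%R.
    by rewrite mulr_ge0 ?expR_ge0// invr_ge0 exprn_ge0// ou_rad_ge0.
  apply: (@le_lt_trans _ _ (\int[mu]_a (C%:E * \int[gamma]_y `|h (a, y)|%:E))).
    apply: ge0_le_integral => //.
    - apply: measurable_absE; exact: (measurableT_comp mO (pair1_measurable z)).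
    - exact: measurable_funeM.
    - move=> a _; apply: (le_trans (abs_OU_le _ _ (mhz a))).
      apply: EOU_le => //; first exact: sub_time_gt0.
      exact: measurable_absE.
  rewrite ge0_integralZl_EFin//; last by move=> a _; exact: integral_ge0.
  by rewrite lte_mul_pinfty// lee_fin.
apply: (@Rintegral_swap _ _ (measurableTypeR R) (measurableTypeR R) R mu mu
  (fun w => (k w.1 * OU (sub_time w.1) (fun y => h (w.2, y)) x)%R) mkO).
have [C C0 CP] := ESub_dominated_bound x kd.
have mkOa := measurable_absE mkO.
rewrite (@fubini_tonelli _ _ (measurableTypeR R) (measurableTypeR R) R mu mu
  (fun w => `|(k w.1 * OU (sub_time w.1) (fun y => h (w.2, y)) x)%R|%:E))//.
apply: (@le_lt_trans _ _ (\int[mu]_a (C%:E * \int[gamma]_y `|h (a, y)|%:E))).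
  apply: ge0_le_integral => //.
  - by move=> a _; exact: integral_ge0.
  - exact: (@measurable_fun_fubini_tonelli_G _ _ (measurableTypeR R) (measurableTypeR R) R mu _ mkOa).
  - exact: measurable_funeM.
  - move=> a _; apply: (le_trans (integral_abs_Sub_integrand_le x mk (mhz a))).
    by apply: CP => //; exact: measurable_absE.
rewrite ge0_integralZl_EFin//; last by move=> a _; exact: integral_ge0.
by rewrite lte_mul_pinfty// lee_fin.
Qed.

(** Inherited from [T_z T_a = T_(z + a) = T_a T_z] by exchanging integrals on both sides; signed
    kernels are allowed, as time derivatives require. *)
Lemma SubC k l f x : dominated k -> dominated l -> L1 f ->
  Sub k (Sub l f) x = Sub l (Sub k f) x.
Proof.
have int_k m : dominated m -> L1 f -> measurable_fun setT
      (fun w : R * X => (m w.1 * OU (sub_time w.1) f w.2)%R) /\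
    \int[mu]_z \int[gamma]_y `|(m z * OU (sub_time z) f y)%R|%:E < +oo.
  move=> md /integrable_realP[mf fi]; have [mm _] := md.
  have mO : measurable_fun setT (fun w : R * X => OU (sub_time w.1) f w.2).
    apply: (@measurable_OU R d _ (R * X)%type (sub_time \o fst) (f \o snd) snd) => //.
      exact: (measurableT_comp (@measurable_sub_time R)).
    exact: (measurableT_comp mf).
  have mM : measurable_fun setT (fun w : R * X => (m w.1 * OU (sub_time w.1) f w.2)%R).
    by apply: measurable_funM => //; exact: (measurableT_comp mm).
  split => //.
  have ma := measurable_absE mf.
  have mma : measurable_fun setT (fun z => `|m z|%:E) by exact: measurable_absE.
  apply: (@le_lt_trans _ _ (\int[mu]_z (`|m z|%:E * \int[gamma]_y `|f y|%:E))).
    apply: ge0_le_integral => //.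
    - by move=> z _; exact: integral_ge0.
    - apply: (@measurable_fun_fubini_tonelli_F _ _ (measurableTypeR R) X R gamma
        (fun w => `|(m w.1 * OU (sub_time w.1) f w.2)%R|%:E)) => //.
      exact: (measurable_absE mM).
    - apply: emeasurable_funM => //.
    - move=> z _; rewrite -(integral_EOU (sub_time_gt0 z) ma)//.
      rewrite -ge0_integralZl_EFin//; last 2 first.
      + by move=> y _; rewrite EOU_ge0.
      + exact: measurable_EOU_point.
      apply: ge0_le_integral => //.
      + apply: (measurable_absE (f := (fun y => m z * OU (sub_time z) f y)%R)).
        by apply: measurable_funM => //; exact: measurable_OU_point.
      + by apply: measurable_funeM; exact: measurable_EOU_point.
      + move=> y _; rewrite normrM EFinM lee_wpmul2l ?lee_fin//; exact: abs_OU_le.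
  rewrite ge0_integralZr//; last exact: integral_ge0.
  apply: lte_mul_pinfty => //; first exact: integral_ge0.
  by rewrite ge0_fin_numE ?integral_dominated_lty//; apply: integral_ge0.
move=> kd ld fi.
have [ml li] := int_k l ld fi; have [mk ki] := int_k k kd fi.
transitivity (\int[mu]_a Sub k (fun y => l a * OU (sub_time a) f y) x)%R.
  exact: (@Sub_Rintegral k (fun w => l w.1 * OU (sub_time w.1) f w.2)%R).
apply: eq_Rintegral => a _.
rewrite (SubZ (l a) x kd (integrable_OU (sub_time_gt0 a) fi)).
congr (_ * _)%R.
transitivity (\int[mu]_z OU (sub_time a) (fun y => k z * OU (sub_time z) f y) x)%R.
  apply: eq_Rintegral => z _.
  rewrite (OUZ (k z) x (sub_time_gt0 a) (integrable_OU (sub_time_gt0 z) fi)).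
  rewrite (OU_semigroup x (sub_time_gt0 z) (sub_time_gt0 a) fi).
  by rewrite (OU_semigroup x (sub_time_gt0 a) (sub_time_gt0 z) fi) addrC.
apply/esym.
exact: (@OU_Rintegral _ (fun w => k w.1 * OU (sub_time w.1) f w.2)%R x (sub_time_gt0 a)).
Qed.

End subordinated_operator.

(** * Time derivatives of the Poisson-Hermite semigroup *)

Section iterated_derivatives.
Context {R : realType}.
Implicit Types (g h : R -> R) (a c t : R).

(** The formulas for the Poisson-Hermite semigroup hold for positive times only, so derivatives are
    compared on an open half-line. *)
Lemma derive1n_eq_gt k g h a : (forall s, a < s -> g s = h s) ->
  forall t, a < t -> derive1n k g t = derive1n k h t.
Proof.
elim: k g h => [|k IH] g h gh t at_; first exact: gh.
rewrite !derive1Sn; apply: IH => // s as_.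
rewrite !derive1E; apply: near_eq_derive.
by near=> u; apply: gh; near: u; exact: lt_nbhsr.
Unshelve. all: end_near. Qed.

Lemma derive1n_shift k g c t : derive1n k (fun s => g (s + c)) t = derive1n k g (t + c).
Proof.
elim: k g => [//|k IH] g.
rewrite !derive1Sn -IH; congr (derive1n k _ t); apply/funext => s.
by rewrite /derive1; under eq_fun do rewrite -addrA.
Qed.

End iterated_derivatives.

Section signed_substitution.
Context {R : realType}.
Notation mu := (@lebesgue_measure R).
Local Open Scope ereal_scope.

(** Since [w] is nonnegative, multiplication by it commutes with taking positive and negative parts;
    the identity then holds even for a non-integrable [g]. *)
Lemma integral_substitution (D : set (measurableTypeR R)) (phi w : R -> R) :
  (forall x, 0 <= w x)%R ->
  (forall G : R -> \bar R, measurable_fun [set: measurableTypeR R] G ->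
     (forall y, 0 <= G y) ->
     \int[mu]_(y in D) G y = \int[mu]_x (G (phi x) * (w x)%:E)) ->
  forall g : R -> R, measurable_fun [set: measurableTypeR R] g ->
  \int[mu]_(y in D) (g y)%:E = \int[mu]_x (g (phi x) * w x)%:E.
Proof.
move=> w0 H g mg.
have mG : measurable_fun [set: measurableTypeR R] (EFin \o g) by exact/measurable_EFinP.
rewrite integralE [RHS]integralE; congr (_ - _).
  have := H (funepos (EFin \o g)) (measurable_funepos mG) (funepos_ge0 _).
  rewrite (_ : \int[mu]_(y in D) _ = \int[mu]_(y in D) (fun y => (g y)%:E)^\+ y) //.
  move=> ->; apply: eq_integral => x _.
  by rewrite !funeposE maxe_pMl// ?mul0e ?lee_fin//.
have := H (funeneg (EFin \o g)) (measurable_funeneg mG) (funeneg_ge0 _).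
rewrite (_ : \int[mu]_(y in D) _ = \int[mu]_(y in D) (fun y => (g y)%:E)^\- y) //.
move=> ->; apply: eq_integral => x _.
by rewrite !funenegE maxe_pMl// ?mul0e ?mulNe ?lee_fin//.
Qed.

Lemma integral_expR_affine_substitution (a b : R) (g : R -> R) : (0 < a)%R ->
  measurable_fun [set: measurableTypeR R] g ->
  \int[mu]_(y in `]0%R, +oo[) (g y)%:E =
  \int[mu]_z (g (expR (a * z + b)) * (expR (a * z + b) * a))%:E.
Proof.
move=> a0 mg.
apply: (@integral_substitution _ (fun z => expR (a * z + b)) (fun z => expR (a * z + b) * a)%R) => //.
  by move=> x; rewrite mulr_ge0 ?expR_ge0// ltW.
move=> G mG G0; rewrite ge0_integral_expR_substitution//.
rewrite (ge0_integral_affine b a0).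
- by apply: eq_integral => x _; rewrite EFinM muleA.
- apply: emeasurable_funM; last exact/measurable_EFinP.
  exact: (measurableT_comp mG).
- by move=> y; rewrite mule_ge0// lee_fin expR_ge0.
Qed.

End signed_substitution.

(** [x^-1 = x |x|^(-2)], which is also correct at 0, where both sides vanish. *)
Lemma measurable_invr {R : realType} : measurable_fun [set: R] (@GRing.inv R).
Proof.
rewrite (_ : @GRing.inv R = (fun x => x * expR (- ln `|x|) ^+ 2)).
  apply: measurable_funM => //; apply: measurable_funX.
  apply: measurableT_comp => //; apply: measurable_funN.
  apply: (measurableT_comp (@measurable_ln R)); exact: (@normr_measurable R setT).
apply/funext => x; have [->|x0] := eqVneq x 0; first by rewrite invr0 mul0r.
rewrite expRN lnK ?posrE ?normr_gt0// exprVn -normrX ger0_norm ?sqr_ge0//.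
by field.
Qed.

Section poisson_hermite_operator.
Context {R : realType} {d : nat}.
Notation mu := (@lebesgue_measure R).
Notation X := (d.-tuple R).
Notation gamma := (@gauss_measure R d).
Notation L1 f := (gamma.-integrable setT (EFin \o f)).
Notation OU := ornstein_uhlenbeck.
Implicit Types (s t : R) (j k : nat) (f g : X -> R) (x : X).

Lemma poisson_hermiteE t f x : 0 < t -> L1 f ->
  poisson_hermite t f x = Sub (poisson_kernel t) f x.
Proof.
move=> t0 fi; have [mf _] := (integrable_realP gamma f).1 fi.
have kd := dominated_poisson_kernel t0.
have mg : measurable_fun [set: measurableTypeR R] (fun u : R =>
    expR (- u) / Num.sqrt u * OU (t ^+ 2 / (4 * u)) f x).
  have mV (g : R -> R) : measurable_fun [set: measurableTypeR R] g ->
      measurable_fun [set: measurableTypeR R] (fun u => (g u)^-1).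
    by move=> mg; apply: (measurableT_comp measurable_invr).
  apply: measurable_funM.
    apply: measurable_funM; first by apply: measurableT_comp => //; exact: measurable_funN.
    by apply: mV; apply: continuous_measurable_fun; exact: sqrt_continuous.
  apply: (@measurable_OU R d _ (measurableTypeR R) (fun u => t ^+ 2 / (4 * u)) (f \o snd) (cst x)) => //.
    by apply: measurable_funM => //; apply: mV; exact: measurable_funM.
  exact: (measurableT_comp mf).
rewrite /poisson_hermite {1}/Rintegral.
rewrite (integral_expR_affine_substitution (2 * ln t) (@ltr0n R 2) mg).
rewrite -/(Rintegral _ _ _) /Sub.
have ii := integrable_Sub_integrand x kd fi.
transitivity ((Num.sqrt pi)^-1 * (\int[mu]_z (Num.sqrt pi * (poisson_kernel t z * OU (sub_time z) f x)))).
  congr (_ * _); apply: eq_Rintegral => z _.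
  have -> : expR (2 * z + 2 * ln t) = (t * expR z) ^+ 2.
    by rewrite expRD !expRM_natl lnK// exprMn mulrC.
  have W0 : 0 < t * expR z by rewrite mulr_gt0// expR_gt0.
  rewrite sqrtr_sqr ger0_norm ?(ltW W0)//.
  have -> : t ^+ 2 / (4 * (t * expR z) ^+ 2) = sub_time z.
    rewrite /sub_time expRN expRM_natl; field.
    by rewrite expR_eq0 gt_eqF.
  rewrite /poisson_kernel; field.
  by rewrite expR_eq0 !gt_eqF// sqrt_pi_gt0.
rewrite (@RintegralZl _ (measurableTypeR R) R mu setT)//.
by rewrite mulKf// gt_eqF// sqrt_pi_gt0.
Qed.

Definition poisson_kernel_deriv t z : R :=
  2 / Num.sqrt pi * (1 - 2 * (t * expR z) ^+ 2) * expR z * expR (- (t * expR z) ^+ 2).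

Lemma is_derive_poisson_kernel t z :
  is_derive t 1 (fun s => poisson_kernel s z) (poisson_kernel_deriv t z).
Proof.
rewrite /poisson_kernel; apply: is_derive_eq.
rewrite /GRing.scale/= /poisson_kernel_deriv; ring.
Qed.

(** Uniform over [t >= s], as dominated differentiation demands. With [y = (t e^z)^2], three
    quarters of the exponent bound the factor [1 - 2 y] by 4, and the last quarter gives the kernel
    at time [s / 2]; the constant [8 / s] is 4 divided by the factor [s / 2] of that kernel. *)
Lemma abs_poisson_kernel_deriv_le s t z : 0 < s -> s <= t ->
  `|poisson_kernel_deriv t z| <= 8 / s * poisson_kernel (s / 2) z.
Proof.
move=> s0 st; rewrite /poisson_kernel_deriv /poisson_kernel.
set W := expR z; have W0 : 0 < W by exact: expR_gt0.
have t0 : 0 < t by exact: lt_le_trans st.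
set p := Num.sqrt pi; have p0 : 0 < p :> R by exact: sqrt_pi_gt0.
rewrite !normrM (ger0_norm (expR_ge0 _)) (ger0_norm (ltW W0)).
rewrite (@ger0_norm _ 2)// (@ger0_norm _ p^-1) ?invr_ge0 ?(ltW p0)//.
have -> : 8 / s * (2 / p * (s / 2) * W * expR (- (s / 2 * W) ^+ 2)) =
    2 / p * W * (4 * expR (- (s / 2 * W) ^+ 2)) by field; rewrite !gt_eqF.
have -> : 2 / p * `|1 - 2 * (t * W) ^+ 2| * W * expR (- (t * W) ^+ 2) =
    2 / p * W * (`|1 - 2 * (t * W) ^+ 2| * expR (- (t * W) ^+ 2)) by ring.
rewrite ler_wpM2l ?mulr_ge0 ?invr_ge0 ?(ltW p0) ?(ltW W0)//.
set y := (t * W) ^+ 2; have y0 : 0 <= y by exact: sqr_ge0.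
have yE : expR (- y) = expR (- (3 / 4 * y)) * expR (- (y / 4)).
  by rewrite -expRD; congr expR; field.
rewrite yE mulrA ler_pM ?mulr_ge0 ?expR_ge0//.
  rewrite expRN ler_pdivrMr ?expR_gt0//.
  apply: (@le_trans _ _ (1 + 2 * y)).
    by rewrite ler_norml; apply/andP; split; lra.
  apply: (@le_trans _ _ (4 * (1 + 3 / 4 * y))); first by lra.
  by rewrite ler_wpM2l//; exact: expR_ge1Dx.
rewrite ler_expR lerN2 /y.
have -> : (s / 2 * W) ^+ 2 = (s * W) ^+ 2 / 4 by field.
rewrite ler_wpM2r ?invr_ge0//.
by rewrite lerXn2r ?nnegrE ?mulr_ge0 ?(ltW s0) ?(ltW t0) ?(ltW W0)// ler_wpM2r// ltW.
Qed.

Lemma dominated_poisson_kernel_deriv t : 0 < t -> dominated (poisson_kernel_deriv t).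
Proof.
move=> t0; split; last first.
  exists (8 / t), (t / 2); split; rewrite ?divr_gt0 ?divr_ge0 ?(ltW t0)// => z.
  exact: abs_poisson_kernel_deriv_le.
have mW : measurable_fun [set: R] (fun z => t * expR z).
  by apply: measurable_funM.
apply: measurable_funM.
  apply: measurable_funM => //; apply: measurable_funM => //.
  by apply: measurable_funB => //; apply: measurable_funM => //; exact: measurable_funX.
by apply: measurableT_comp => //; apply: measurable_funN; exact: measurable_funX.
Qed.

Definition dSub t f : X -> R := Sub (poisson_kernel_deriv t) f.

Lemma derive_Sub_poisson_kernel t f x : 0 < t -> L1 f ->
  (fun s => Sub (poisson_kernel s) f x)^`()%classic t = dSub t f x.
Proof.
move=> t0 fi.
pose F s z := poisson_kernel s z * OU (sub_time z) f x.
have dF s z : is_derive s 1 (F ^~ z) (poisson_kernel_deriv s z * OU (sub_time z) f x).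
  have := is_derive_poisson_kernel s z => dk.
  apply: is_derive_eq; rewrite /GRing.scale/=; ring.
have pE s z : partial1of2 F s z = poisson_kernel_deriv s z * OU (sub_time z) f x.
  by rewrite partial1of2E; apply: derive_val.
have t20 : 0 < t / 2 by rewrite divr_gt0.
(* On []t / 2, 2 t[] the preceding bound applies with [s := t / 2], so the dominating function does
   not depend on the time. *)
pose H z := 8 / (t / 2) * poisson_kernel (t / 2 / 2) z * `|OU (sub_time z) f x|.
rewrite (@differentiation_under_integral R _ (measurableTypeR R) mu F setT measurableT
  t (t / 2) (2 * t) _ _ _ H).
- by apply: eq_Rintegral => z _; rewrite pE.
- by rewrite /= in_itv/=; apply/andP; split; lra.
- move=> s; rewrite /= in_itv/= => /andP[ts _].
  apply: integrable_Sub_integrand => //; apply: dominated_poisson_kernel.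
  exact: lt_trans ts.
- by move=> s z _ _; exact: (@ex_derive _ _ _ _ _ _ _ (dF s z)).
- move=> z; rewrite /H mulr_ge0// mulr_ge0 ?divr_ge0 ?(ltW t20) ?(ltW t0)//.
  by rewrite poisson_kernel_ge0// divr_ge0// ltW.
- have kd := dominated_poisson_kernel (divr_gt0 t20 (@ltr0n R 2)).
  have := integrable_norm (integrable_Sub_integrand x kd fi).
  move=> /(integrableZl measurableT (8 / (t / 2))).
  apply: eq_integrable => // z _ /=.
  have p0 : 0 <= poisson_kernel (t / 2 / 2) z.
    by rewrite poisson_kernel_ge0// divr_ge0// ltW.
  by rewrite -EFinM normrM (ger0_norm p0) mulrA.
- move=> s z; rewrite /= in_itv/= => /andP[ts _] _.
  rewrite pE normrM ler_wpM2r// abs_poisson_kernel_deriv_le//; exact: ltW.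
Qed.

(** [P_a = P_(a - t) P_t] is differentiated at [a = s + t], and the two subordinated operators are
    then commuted. *)
Lemma dSub_add s t f x : 0 < s -> 0 < t -> L1 f ->
  dSub (s + t) f x = Sub (poisson_kernel t) (dSub s f) x.
Proof.
move=> s0 t0 fi.
have kt := dominated_poisson_kernel t0.
have ks := dominated_poisson_kernel_deriv s0.
rewrite -derive_Sub_poisson_kernel ?addr_gt0// -derive1n1.
rewrite (@derive1n_eq_gt _ 1 _
    (fun a => Sub (poisson_kernel (a - t)) (Sub (poisson_kernel t) f) x) t); last 2 first.
- move=> a ta; rewrite Sub_poisson_semigroup ?subrK// subr_gt0//.
- by rewrite ltrDr.
have := derive1n_shift 1 (fun a => Sub (poisson_kernel a) (Sub (poisson_kernel t) f) x)
  (- t) (s + t).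
rewrite (addrK t s) => ->; rewrite derive1n1.
rewrite (derive_Sub_poisson_kernel x s0 (integrable_Sub kt fi)).
exact: SubC.
Qed.

Lemma integrable_dSub t f : 0 < t -> L1 f -> L1 (dSub t f).
Proof.
by move=> t0; apply: integrable_Sub; exact: dominated_poisson_kernel_deriv.
Qed.

Notation Dn := dt_poisson_hermite.

Lemma dt_poisson_hermite0 t f x : 0 < t -> L1 f ->
  Dn 0 t f x = Sub (poisson_kernel t) f x.
Proof. exact: poisson_hermiteE. Qed.

(** One derivative is spent at the fixed time [s], as the operator [dSub s], and the other [k] act
    on the remaining time. Induction on the order thus reduces every derivative to first-order
    differentiation under the integral. *)
Lemma dt_poisson_hermiteS k s t f x : 0 < s -> 0 < t -> L1 f ->
  Dn k.+1 (s + t) f x = Dn k t (dSub s f) x.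
Proof.
move=> s0 t0 fi; rewrite /dt_poisson_hermite derive1Sn.
have E : derive1n k (fun a => poisson_hermite (a - s) (dSub s f) x) (s + t) =
    derive1n k (fun a => poisson_hermite a (dSub s f) x) t.
  have := derive1n_shift k (fun a => poisson_hermite a (dSub s f) x) (- s) (s + t).
  by rewrite (addrC s t) addrK.
apply: etrans _ E; apply: (@derive1n_eq_gt _ k _ _ s); last by rewrite ltrDl.
move=> a sa; have as0 : 0 < a - s by rewrite subr_gt0.
rewrite poisson_hermiteE//; last exact: integrable_dSub.
rewrite -dSub_add// addrC subrK -derive_Sub_poisson_kernel ?(lt_trans s0)//.
apply: (@derive1n_eq_gt _ 1 (fun s => poisson_hermite s f x)
    (fun s => Sub (poisson_kernel s) f x) 0) => [b b0|].
  exact: poisson_hermiteE.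
exact: lt_trans sa.
Qed.

Lemma dt_poisson_hermite_half k t f : 0 < t -> L1 f ->
  Dn k.+1 t f = Dn k (t / 2) (dSub (t / 2) f).
Proof.
move=> t0 fi; apply/funext => x; rewrite {1}(splitr t).
by rewrite dt_poisson_hermiteS// divr_gt0.
Qed.

Lemma integrable_dt_poisson_hermite k t f : 0 < t -> L1 f -> L1 (Dn k t f).
Proof.
elim: k t f => [|k IH] t f t0 fi.
  rewrite (_ : Dn 0 t f = Sub (poisson_kernel t) f).
    by apply: integrable_Sub => //; exact: dominated_poisson_kernel.
  by apply/funext => x; rewrite dt_poisson_hermite0.
rewrite dt_poisson_hermite_half//; apply: IH; first by rewrite divr_gt0.
by apply: integrable_dSub => //; rewrite divr_gt0.
Qed.

Lemma dt_poisson_hermiteD j k s t f x : 0 < s -> 0 < t -> L1 f ->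
  Dn (j + k) (s + t) f x = Dn j s (Dn k t f) x.
Proof.
elim: k t f => [|k IH] t f s0 t0 fi.
  rewrite addn0 (_ : Dn 0 t f = Sub (poisson_kernel t) f); last first.
    by apply/funext => y; rewrite dt_poisson_hermite0.
  have kt := dominated_poisson_kernel t0.
  apply: etrans (esym (derive1n_shift j (fun a => poisson_hermite a f x) t s)) _.
  apply: (@derive1n_eq_gt _ j (fun a => poisson_hermite (a + t) f x)
    (fun a => poisson_hermite a (Sub (poisson_kernel t) f) x) 0 _ s s0) => a a0.
  rewrite (poisson_hermiteE x (addr_gt0 a0 t0) fi).
  rewrite (poisson_hermiteE x a0 (integrable_Sub kt fi)).
  by rewrite Sub_poisson_semigroup.
have t20 : 0 < t / 2 by rewrite divr_gt0.
rewrite addnS (dt_poisson_hermite_half k t0 fi) {1}(splitr t) addrA addrC.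
rewrite dt_poisson_hermiteS ?addr_gt0// IH//; exact: integrable_dSub.
Qed.

Lemma dt_poisson_hermiteZ k t c f x : 0 < t -> L1 f ->
  Dn k t (fun y => c * f y) x = c * Dn k t f x.
Proof.
elim: k t f x => [|k IH] t f x t0 fi.
  rewrite !dt_poisson_hermite0//; last exact: (integrableZl measurableT c fi).
  by rewrite SubZ//; exact: dominated_poisson_kernel.
have t20 : 0 < t / 2 by rewrite divr_gt0.
rewrite !dt_poisson_hermite_half//; last exact: (integrableZl measurableT c fi).
rewrite -(IH _ _ x t20 (integrable_dSub t20 fi)).
congr (Dn k _ _ x); apply/funext => y; rewrite /dSub SubZ//.
exact: dominated_poisson_kernel_deriv.
Qed.

End poisson_hermite_operator.

(** * The Bessel potential *)

Section exponential_weights.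
Context {R : realType}.
Notation mu := (@lebesgue_measure R).
Implicit Types (a b c t : R).

Lemma exprn_le_expR (n : nat) (y : R) : (0 < n)%N -> 0 <= y ->
  y ^+ n <= n%:R ^+ n * expR y.
Proof.
move=> n0 y0; have nn : 0 < n%:R :> R by rewrite ltr0n.
have h : y / n%:R <= expR (y / n%:R).
  by apply: le_trans (expR_ge1Dx _); rewrite lerDr.
have e : expR (y / n%:R) ^+ n = expR y.
  by rewrite -expRM_natl mulrCA divff ?mulr1// gt_eqF.
have := @lerXn2r R n (y / n%:R) (expR (y / n%:R)).
rewrite !nnegrE divr_ge0 ?(ltW nn)// expR_ge0 => /(_ isT isT h).
by rewrite e expr_div_n ler_pdivrMr ?exprn_gt0// mulrC.
Qed.

Lemma measurable_expR_abs c : measurable_fun [set: R] (fun a => expR (- (c * `|a|))).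
Proof.
by apply: measurableT_comp => //; apply: measurable_funN; apply: measurable_funM.
Qed.

Lemma integral_expR_abs_lty c : 0 < c ->
  (\int[mu]_a (expR (- (c * `|a|)))%:E < +oo)%E.
Proof.
move=> c0.
rewrite ge0_symfun_integralT.
- rewrite (_ : [set x | _] = `[0, +oo[%classic); last first.
    by apply/seteqP; split => x/=; rewrite in_itv/= andbT.
  have E : (\int[mu]_(x in `[0%R, +oo[) (c * expR (- c * x))%:E = 1)%E.
    rewrite -[RHS](integral_exponential_pdf c0) integral_mkcond.
    by apply: eq_integral => x _; rewrite restrict_EFin.
  have -> : (\int[mu]_(x in `[0%R, +oo[) (expR (- (c * `|x|)))%:E = (c^-1)%:E)%E.
    transitivity (\int[mu]_(x in `[0%R, +oo[) (c^-1%:E * (c * expR (- c * x))%:E))%E.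
      apply: eq_integral => x; rewrite inE/= in_itv/= andbT => x0.
      by rewrite -EFinM mulKf ?gt_eqF// ger0_norm// mulNr.
    rewrite ge0_integralZl_EFin// ?E ?mule1//.
    + by move=> x _; rewrite lee_fin mulr_ge0 ?expR_ge0// ltW.
    + apply/measurable_EFinP; apply: measurable_funTS; apply: measurable_funM => //.
      by apply: measurableT_comp => //; apply: measurable_funM.
    + by rewrite invr_ge0 ltW.
  by rewrite -EFinM ltry.
- by move=> x; exact: expR_ge0.
- move=> x; apply: (@continuous_comp _ _ _ (fun x => - (c * `|x|)) expR).
    apply: continuousN; apply: continuousM; first exact: cst_continuous.
    exact: norm_continuous.
  exact: continuous_expR.
- by move=> x /=; rewrite normrN.
Qed.

(* [t^b e^{-t} dt / t] at [t = e^a] *)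
Definition bessel_weight b a : R := expR (b * a) * expR (- expR a).

Lemma bessel_weight_ge0 b a : 0 <= bessel_weight b a.
Proof. by rewrite mulr_ge0 ?expR_ge0. Qed.

Lemma measurable_bessel_weight b : measurable_fun [set: R] (bessel_weight b).
Proof.
apply: measurable_funM.
  by apply: measurableT_comp => //; exact: measurable_funM.
by apply: measurableT_comp => //; exact: measurable_funN.
Qed.

Lemma integral_bessel_weight_lty b : 0 < b ->
  (\int[mu]_a (bessel_weight b a)%:E < +oo)%E.
Proof.
move=> b0.
(* [n >= b + 1], so for [a >= 0] the bound [e^(-e^a) <= n^n e^(-n a)] beats [e^(b a)] with a margin
   of 1; for [a < 0] the factor [e^(b a)] itself decays at rate [b]. *)
pose n := (Num.truncn b).+2.
have nb : b + 1 <= n%:R.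
  by rewrite /n -natr1 lerD2r ltW// truncnS_gt.
have n0 : 0 < n%:R :> R by rewrite ltr0n.
pose c := Num.min b 1.
have c0 : 0 < c by rewrite lt_min b0 ltr01.
pose C : R := 1 + n%:R ^+ n.
have C0 : 0 < C by rewrite ltr_wpDr// exprn_ge0// ltW.
have wle a : bessel_weight b a <= C * expR (- (c * `|a|)).
  rewrite /bessel_weight; have [a0|a0] := leP 0 a.
    rewrite ger0_norm//.
    have h : expR (- expR a) <= n%:R ^+ n * expR (- (n%:R * a)).
      rewrite !expRN expRM_natl ler_pdivlMr ?exprn_gt0 ?expR_gt0//.
      rewrite mulrC ler_pdivrMr ?expR_gt0//; apply: exprn_le_expR => //.
    apply: (@le_trans _ _ (expR (b * a) * (n%:R ^+ n * expR (- (n%:R * a))))).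
      by rewrite ler_wpM2l ?expR_ge0.
    rewrite mulrCA -expRD ler_pM ?exprn_ge0 ?expR_ge0 ?(ltW n0)//.
      by rewrite /C lerDr.
    rewrite ler_expR -mulrBl lerNr -mulNr opprB ler_wpM2r//.
    have : c <= 1 by rewrite ge_min lexx orbT.
    lra.
  rewrite ltr0_norm// mulrN opprK.
  rewrite -[leLHS]mulr1 -[leRHS]mulr1 ler_wpM2r// [leRHS]mulrC ler_pM ?expR_ge0//.
    rewrite ler_expR -subr_ge0 -mulrBl -mulrNN mulr_ge0 ?oppr_ge0 ?(ltW a0)//.
    by rewrite subr_le0 ge_min lexx.
  apply: (@le_trans _ _ 1); first by rewrite expR_le1 oppr_le0 expR_ge0.
  by rewrite /C lerDl exprn_ge0// ltW.
apply: (@le_lt_trans _ _ (\int[mu]_a (C%:E * (expR (- (c * `|a|)))%:E))%E).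
  apply: ge0_le_integral => //.
  - by move=> a _; rewrite lee_fin bessel_weight_ge0.
  - by apply/measurable_EFinP; exact: measurable_bessel_weight.
  - by apply: measurable_funeM; apply/measurable_EFinP; exact: measurable_expR_abs.
  - by move=> a _; rewrite -EFinM lee_fin.
rewrite ge0_integralZl_EFin//; last 2 first.
- by apply/measurable_EFinP; exact: measurable_expR_abs.
- exact: ltW.
rewrite lte_mul_pinfty ?lee_fin ?(ltW C0) ?integral_expR_abs_lty//.
Qed.

(* [e^{ba} (e^a + t)^{-A}] rescales to [t^{b-A} e^{bs} (e^s + 1)^{-A}] under
   [a = s + ln t] *)
Lemma integral_bessel_weight_powR_le b A : 0 < b -> b < A ->
  exists2 C : R, 0 < C & forall t, 0 < t ->
    (\int[mu]_a (bessel_weight b a * (expR a + t) `^ (- A))%:E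
      <= (C * t `^ (b - A))%:E)%E.
Proof.
move=> b0 bA; pose c := Num.min b (A - b).
have c0 : 0 < c by rewrite lt_min b0 subr_gt0.
have A0 : 0 < A by exact: lt_trans bA.
set I := (\int[mu]_a (expR (- (c * `|a|)))%:E)%E.
have I0 : (0 <= I)%E by apply: integral_ge0 => a _; rewrite lee_fin expR_ge0.
have Ioo : (I < +oo)%E by exact: integral_expR_abs_lty.
have If : I = (fine I)%:E by rewrite fineK// ge0_fin_numE.
exists (1 + fine I); first by rewrite ltr_wpDr// fine_ge0.
move=> t t0.
have mp : measurable_fun [set: measurableTypeR R] (fun a : R => (expR a + t) `^ (- A)).
  apply: (measurableT_comp (@measurable_powR R (- A))).
  exact: measurable_funD.
have mw := measurable_bessel_weight b.
rewrite (@ge0_integral_shift _ (ln t)); last 2 first.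
- by apply/measurable_EFinP; exact: measurable_funM.
- by move=> a; rewrite lee_fin mulr_ge0 ?bessel_weight_ge0 ?powR_ge0.
apply: (@le_trans _ _ (\int[mu]_a ((t `^ (b - A))%:E * (expR (- (c * `|a|)))%:E))%E).
  apply: ge0_le_integral => //.
  - by move=> a _; rewrite lee_fin mulr_ge0 ?bessel_weight_ge0 ?powR_ge0.
  - apply/measurable_EFinP; apply: measurable_funM.
      by apply: (measurableT_comp mw); exact: measurable_funD.
    by apply: (measurableT_comp mp); exact: measurable_funD.
  - by apply: measurable_funeM; apply/measurable_EFinP; exact: measurable_expR_abs.
  - move=> a _; rewrite -EFinM lee_fin.
    have -> : expR (a + ln t) + t = t * (expR a + 1).
      by rewrite expRD lnK// mulrDr mulr1 mulrC.
    rewrite powRM ?addr_ge0 ?expR_ge0 ?(ltW t0)//.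
    apply: (@le_trans _ _ (expR (b * (a + ln t)) * (t `^ (- A) * (expR a + 1) `^ (- A)))).
      rewrite ler_wpM2r ?mulr_ge0 ?powR_ge0// /bessel_weight ler_piMr ?expR_ge0//.
    have -> : expR (b * (a + ln t)) = expR (b * a) * t `^ b.
      by rewrite mulrDr expRD /powR gt_eqF.
    have -> : t `^ (b - A) = t `^ b * t `^ (- A).
      by rewrite powRD// (gt_eqF t0) implybT.
    have -> : expR (b * a) * t `^ b * (t `^ (- A) * (expR a + 1) `^ (- A)) =
       t `^ b * t `^ (- A) * (expR (b * a) * (expR a + 1) `^ (- A)) by ring.
    rewrite ler_wpM2l ?mulr_ge0 ?powR_ge0//.
    have ea0 := expR_gt0 a.
    rewrite powRN.
    have [a0|a0] := leP 0 a.
      rewrite ger0_norm//.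
      apply: (@le_trans _ _ (expR (b * a) * (expR a `^ A)^-1)).
        rewrite ler_wpM2l ?expR_ge0// lef_pV2 ?posrE ?powR_gt0 ?addr_gt0//.
        by rewrite ge0_ler_powR ?nnegrE ?addr_ge0 ?(ltW ea0) ?(ltW A0)// lerDl.
      rewrite /powR gt_eqF// expRK -expRN -expRD ler_expR -mulrBl -mulNr.
      rewrite ler_wpM2r//.
      have : c <= A - b by rewrite ge_min lexx orbT.
      lra.
    rewrite ltr0_norm// mulrN opprK.
    apply: (@le_trans _ _ (expR (b * a))).
      rewrite ler_piMr ?expR_ge0// invf_le1 ?powR_gt0 ?addr_gt0//.
      rewrite -[X in X <= _](powRr0 (expR a + 1)); apply: ler_powR; last exact: ltW.
      by rewrite lerDr ltW.
    rewrite ler_expR -subr_ge0 -mulrBl -mulrNN mulr_ge0 ?oppr_ge0 ?(ltW a0)//.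
    by rewrite subr_le0 ge_min lexx.
rewrite ge0_integralZl_EFin ?powR_ge0//; last first.
- by apply/measurable_EFinP; exact: measurable_expR_abs.
rewrite -/I If -EFinM lee_fin mulrC ler_wpM2r ?powR_ge0//.
by rewrite lerDr.
Qed.

End exponential_weights.

Section bessel_operator.
Context {R : realType} {d : nat}.
Notation mu := (@lebesgue_measure R).
Notation X := (d.-tuple R).
Notation gamma := (@gauss_measure R d).
Notation L1 f := (gamma.-integrable setT (EFin \o f)).
Notation Dn := dt_poisson_hermite.
Implicit Types (b s t : R) (f g : X -> R) (x : X).

Definition bessel_integral b f x : R :=
  \int[mu]_a (bessel_weight b a * Sub (poisson_kernel (expR a)) f x).

Let measurable_pk_exp d' (T : measurableType d') :
  measurable_fun setT (fun w : (R * T) * R => poisson_kernel (expR w.1.1) w.2).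
Proof.
apply: (@measurableT_comp _ _ _ _ _ _ (fun z : R * R => poisson_kernel z.1 z.2) _
  (fun w : (R * T) * R => (expR w.1.1, w.2)) (@measurable_poisson_kernel2 R)).
apply/measurable_fun_pairP; split => /=; last exact: measurable_snd.
apply: (measurableT_comp (@measurable_expR R)).
exact: (measurableT_comp measurable_fst measurable_fst).
Qed.

Lemma measurable_Sub_exp f : measurable_fun setT f ->
  measurable_fun setT (fun w : R * X => Sub (poisson_kernel (expR w.1)) f w.2).
Proof.
move=> mf.
apply: (@measurable_Sub R d _ (R * X)%type
  (fun w => poisson_kernel (expR w.1.1) w.2) (f \o snd) snd) => //.
- exact: measurable_pk_exp.
- exact: (measurableT_comp mf).
Qed.

Lemma measurable_bessel_integrand b f : measurable_fun setT f ->
  measurable_fun setT (fun w : R * X =>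
    bessel_weight b w.1 * Sub (poisson_kernel (expR w.1)) f w.2).
Proof.
move=> mf; apply: measurable_funM; last exact: measurable_Sub_exp.
exact: (measurableT_comp (measurable_bessel_weight b)).
Qed.

Lemma bessel_potentialE b f x : L1 f ->
  bessel_potential b f x = (Gamma b)^-1 * bessel_integral b f x.
Proof.
move=> fi; have [mf _] := (integrable_realP gamma f).1 fi.
rewrite /bessel_potential; congr (_ * _).
transitivity (\int[mu]_(t in `]0, +oo[)
    (t `^ b * expR (- t) * Sub (poisson_kernel t) f x / t)).
  apply: eq_Rintegral => t; rewrite inE/= in_itv/= andbT => t0.
  by rewrite poisson_hermiteE.
rewrite /Rintegral (integral_expR_affine_substitution 0 (@ltr01 R)); last first.
  apply: measurable_funM; last exact: measurable_invr.
  apply: measurable_funM.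
    apply: measurable_funM; first exact: measurable_powR.
    by apply: measurableT_comp => //; exact: measurable_funN.
  apply: (@measurable_Sub R d _ R
    (fun w => poisson_kernel w.1 w.2) (f \o snd) (cst x)) => //.
  - exact: measurable_poisson_kernel2.
  - exact: (measurableT_comp mf).
congr fine; apply: eq_integral => z _; congr EFin.
rewrite mul1r addr0 mulr1 /bessel_weight /powR gt_eqF ?expR_gt0// expRK.
by field; rewrite expR_eq0.
Qed.

Local Open Scope ereal_scope.

Lemma integral_bessel_integrand_lty b f : (0 < b)%R -> L1 f ->
  \int[mu]_a \int[gamma]_y
    `|(bessel_weight b a * Sub (poisson_kernel (expR a)) f y)%R|%:E < +oo.
Proof.
move=> b0 /integrable_realP[mf fi].
have mB := measurable_bessel_integrand b mf.
have ma := measurable_absE mf.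
have mBa : measurable_fun setT (fun w : measurableTypeR R * X =>
    `|(bessel_weight b w.1 * Sub (poisson_kernel (expR w.1)) f w.2)%R|%:E).
  exact: (measurable_absE mB).
have mw : measurable_fun setT (fun a => (bessel_weight b a)%:E).
  by apply/measurable_EFinP; exact: measurable_bessel_weight.
have pk0 a z : (0 <= poisson_kernel (expR a) z)%R.
  by rewrite poisson_kernel_ge0// expR_ge0.
apply: (@le_lt_trans _ _ (\int[mu]_a ((bessel_weight b a)%:E * \int[gamma]_y `|f y|%:E))).
  apply: ge0_le_integral => //.
  - by move=> a _; exact: integral_ge0.
  - exact: (@measurable_fun_fubini_tonelli_F _ _ (measurableTypeR R) X R gamma _ mBa).
  - exact: emeasurable_funM.
  - move=> a _.
    have mp := measurable_poisson_kernel (expR a).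
    have <- : \int[gamma]_y ESub (poisson_kernel (expR a)) (fun y => `|f y|%:E) y =
        \int[gamma]_y `|f y|%:E.
      by rewrite integral_ESub// integral_poisson_kernel ?expR_gt0// mul1e.
    rewrite -ge0_integralZl_EFin ?bessel_weight_ge0//; last 2 first.
    + by move=> y _; rewrite ESub_ge0.
    + exact: measurable_ESub_point.
    apply: ge0_le_integral => //.
    + apply: (measurable_absE (f := (fun y => bessel_weight b a *
        Sub (poisson_kernel (expR a)) f y)%R)).
      by apply: measurable_funM => //; exact: measurable_Sub_point.
    + by apply: measurable_funeM; exact: measurable_ESub_point.
    + move=> y _; rewrite normrM EFinM ger0_norm ?bessel_weight_ge0//.
      rewrite lee_wpmul2l ?lee_fin ?bessel_weight_ge0//.
      apply: (le_trans (abs_Sub_le _ mp mf)); rewrite le_eqVlt; apply/orP; left.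
      apply/eqP; rewrite (_ : (fun z => `|poisson_kernel (expR a) z|%R) =
        poisson_kernel (expR a))//.
      by apply/funext => w; rewrite ger0_norm ?poisson_kernel_ge0 ?expR_ge0.
rewrite ge0_integralZr//; last 2 first.
- by move=> a _; rewrite lee_fin bessel_weight_ge0.
- exact: integral_ge0.
apply: lte_mul_pinfty => //.
- by apply: integral_ge0 => a _; rewrite lee_fin bessel_weight_ge0.
- rewrite ge0_fin_numE ?integral_bessel_weight_lty//.
  by apply: integral_ge0 => a _; rewrite lee_fin bessel_weight_ge0.
Qed.

Lemma integrable_bessel_integral b f : (0 < b)%R -> L1 f -> L1 (bessel_integral b f).
Proof.
move=> b0 fi; have [mf _] := (integrable_realP gamma f).1 fi.
have mB := measurable_bessel_integrand b mf.
have mB' : measurable_fun setT (fun w : X * measurableTypeR R =>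
    bessel_weight b w.2 * Sub (poisson_kernel (expR w.2)) f w.1)%R.
  exact: (measurableT_comp mB (@measurable_swap _ _ _ _)).
have mBa' : measurable_fun setT (fun w : X * measurableTypeR R =>
    `|(bessel_weight b w.2 * Sub (poisson_kernel (expR w.2)) f w.1)%R|%:E).
  exact: (measurable_absE mB').
apply/integrable_realP; split.
  exact: (@measurable_Rintegral _ _ X (measurableTypeR R) R mu _ mB').
apply: le_lt_trans (integral_bessel_integrand_lty b0 fi).
rewrite -(@fubini_tonelli _ _ X (measurableTypeR R) R gamma mu _ mBa')//.
apply: ge0_le_integral => //.
- apply: (measurable_absE (f := bessel_integral b f)).
  exact: (@measurable_Rintegral _ _ X (measurableTypeR R) R mu _ mB').
- exact: (@measurable_fun_fubini_tonelli_F _ _ X (measurableTypeR R) R mu _ mBa').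
- move=> x _; apply: (@abs_Rintegral_le _ (measurableTypeR R) R mu).
  exact: (measurableT_comp mB' (pair1_measurable x)).
Qed.

Lemma Sub_bessel_integral k b f x : dominated k -> (0 < b)%R -> L1 f ->
  Sub k (bessel_integral b f) x = bessel_integral b (Sub k f) x.
Proof.
move=> kd b0 fi; have [mf _] := (integrable_realP gamma f).1 fi.
have := @Sub_Rintegral R d k (fun w => bessel_weight b w.1 *
  Sub (poisson_kernel (expR w.1)) f w.2)%R x kd (measurable_bessel_integrand b mf)
  (integral_bessel_integrand_lty b0 fi).
move=> ->; apply: eq_Rintegral => a _ /=.
have pd := dominated_poisson_kernel (expR_gt0 a).
by rewrite (SubZ _ _ kd (integrable_Sub pd fi)) SubC.
Qed.

(** No differentiation under the Bessel integral takes place: each derivative is an operator [dSub],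
    which commutes with that integral. *)
Lemma dt_poisson_hermite_bessel_integral k t b f x : (0 < t)%R -> (0 < b)%R -> L1 f ->
  Dn k t (bessel_integral b f) x = bessel_integral b (Dn k t f) x.
Proof.
move=> t0 b0; elim: k t f x t0 => [|k IH] t f x t0 fi.
  have kt := dominated_poisson_kernel t0.
  rewrite (dt_poisson_hermite0 x t0 (integrable_bessel_integral b0 fi)).
  rewrite (Sub_bessel_integral x kt b0 fi); congr (bessel_integral b _ x).
  by apply/funext => y; rewrite dt_poisson_hermite0.
have t20 : (0 < t / 2)%R by rewrite divr_gt0.
have kt := dominated_poisson_kernel_deriv t20.
rewrite (dt_poisson_hermite_half k t0 (integrable_bessel_integral b0 fi)).
rewrite (dt_poisson_hermite_half k t0 fi) -(IH _ _ x t20 (integrable_dSub t20 fi)).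
congr (Dn k _ _ x); apply/funext => y.
exact: Sub_bessel_integral.
Qed.

End bessel_operator.

(** * Luxemburg bounds *)

Section euclidean_norm.
Context {R : realType} {d : nat}.
Implicit Types (a b : R) (x y : d.-tuple R).

Lemma enorm0_tnth x i : enorm x = 0 -> tnth x i = 0.
Proof.
move=> x0; have /eqP : enorm x ^+ 2 = 0 by rewrite x0 expr0n.
rewrite enormE psumr_eq0 => [/allP/(_ i)|j _]; last exact: sqr_ge0.
by rewrite mem_index_enum /= sqrf_eq0 => /(_ isT)/eqP.
Qed.

Lemma enorm_oppr x : enorm (tuple_lincomb (-1) x 0 x) = enorm x.
Proof.
by congr Num.sqrt; apply: eq_bigr => i _; rewrite tnth_lincomb; ring.
Qed.

Lemma enorm_scale a x : 0 <= a -> enorm (tuple_lincomb a x 0 x) = a * enorm x.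
Proof.
move=> a0; rewrite -{2}(ger0_norm a0) -(sqrtr_sqr a) /enorm -sqrtrM ?sqr_ge0//.
by congr Num.sqrt; rewrite mulr_sumr; apply: eq_bigr => i _; rewrite tnth_lincomb; ring.
Qed.

Lemma sum_tnthM_le x y : \sum_(i < d) tnth x i * tnth y i <= enorm x * enorm y.
Proof.
have [x0|x0] := eqVneq (enorm x) 0.
  by rewrite x0 mul0r big1// => i _; rewrite enorm0_tnth ?mul0r.
have [y0|y0] := eqVneq (enorm y) 0.
  by rewrite y0 mulr0 big1// => i _; rewrite (enorm0_tnth _ y0) mulr0.
have xp : 0 < enorm x by rewrite lt_neqAle eq_sym x0 enorm_ge0.
have yp : 0 < enorm y by rewrite lt_neqAle eq_sym y0 enorm_ge0.
(* The weight for which [a / 2 * |x|^2 + a^-1 / 2 * |y|^2] equals [|x| |y|]. *)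
pose a := enorm y / enorm x.
have a0 : 0 < a by rewrite divr_gt0.
apply: (@le_trans _ _ (\sum_(i < d) (a / 2 * tnth x i ^+ 2 + a^-1 / 2 * tnth y i ^+ 2))).
  apply: ler_sum => i _; set u := tnth x i; set v := tnth y i.
  rewrite -subr_ge0 (_ : _ - _ = (a * u - v) ^+ 2 / (2 * a)).
    by rewrite divr_ge0 ?sqr_ge0// mulr_ge0// ltW.
  by field; rewrite gt_eqF.
rewrite big_split/= -!mulr_sumr -!enormE /a le_eqVlt; apply/orP; left; apply/eqP.
by field; rewrite x0 y0.
Qed.

Lemma norm_sum_tnthM_le x y : `|\sum_(i < d) tnth x i * tnth y i| <= enorm x * enorm y.
Proof.
rewrite ler_norml sum_tnthM_le andbT lerNl.
have := sum_tnthM_le (tuple_lincomb (-1) x 0 x) y; rewrite enorm_oppr.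
apply: le_trans; rewrite -sumrN le_eqVlt; apply/orP; left; apply/eqP.
by apply: eq_bigr => i _; rewrite tnth_lincomb; ring.
Qed.

Lemma enorm_lincomb_le a b x y :
  enorm (tuple_lincomb a x b y) <= `|a| * enorm x + `|b| * enorm y.
Proof.
have n0 : 0 <= `|a| * enorm x + `|b| * enorm y.
  by rewrite addr_ge0// mulr_ge0// enorm_ge0.
rewrite -(@ler_pXn2r _ 2)// ?nnegrE ?enorm_ge0// enormE.
rewrite (eq_bigr (fun i => a ^+ 2 * tnth x i ^+ 2 + b ^+ 2 * tnth y i ^+ 2 +
   (2 * a * b) * (tnth x i * tnth y i))); last first.
  by move=> i _; rewrite tnth_lincomb; ring.
rewrite 2!big_split/= -!mulr_sumr -!enormE.
have := norm_sum_tnthM_le x y; set s := \sum_(_ < _) _ => h.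
have {}h : a * b * s <= `|a| * `|b| * (enorm x * enorm y).
  by rewrite (le_trans (ler_norm _))// !normrM ler_wpM2l// mulr_ge0.
rewrite -(real_normK (num_real a)) -(real_normK (num_real b)).
rewrite -subr_ge0 (_ : _ - _ = 2 * (`|a| * `|b| * (enorm x * enorm y) - a * b * s)).
  by rewrite mulr_ge0// subr_ge0.
by ring.
Qed.

End euclidean_norm.

(** * Averages under a variable exponent *)

Section jensen_up_to_two.
Context {R : realType}.
Local Open Scope ereal_scope.

(** The bound [1 <= q] forces the value 0 where [f] vanishes; elsewhere the power is an
    exponential. *)
Lemma measurable_powR_exponent d' (T : measurableType d') (f q : T -> R) :
  measurable_fun setT f -> measurable_fun setT q -> (forall x, (1 <= q x)%R) ->
  measurable_fun setT (fun x => (f x `^ q x)%R).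
Proof.
move=> mf mq q1.
rewrite (_ : (fun x => _) = (fun x => if f x == 0%R then 0%R else expR (q x * ln (f x)))).
  apply: measurable_fun_ifT => //; first exact: measurable_fun_eqr.
  apply: measurableT_comp => //; apply: measurable_funM => //.
  exact: (measurableT_comp (@measurable_ln R)).
apply/funext => x; rewrite /powR; case: ifP => // _.
by rewrite gt_eqF// (lt_le_trans _ (q1 x)).
Qed.

(** For [a > s], [a = a^q a^(1 - q) <= a^q s^(1 - q)] because [1 - q <= 0]. The threshold [s] does
    not involve [q], so the bound can be integrated with an exponent that varies. *)
Lemma le_add_powR (a s q : R) : (0 <= a -> 0 < s -> 1 <= q ->
  a <= s + a `^ q * s `^ (1 - q))%R.
Proof.
move=> a0 s0 q1; have [as_|sa] := leP a s.
  by rewrite (le_trans as_)// lerDl mulr_ge0// powR_ge0.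
have a1 : (0 < a)%R by exact: lt_trans sa.
rewrite (@le_trans _ _ (a `^ q * s `^ (1 - q))%R)//; last by rewrite lerDr ltW.
rewrite -{1}(powRr1 a0) -{1}(subrK q 1%R) powRD; last by rewrite (gt_eqF a1) implybT.
rewrite mulrC ler_wpM2l ?powR_ge0//.
rewrite -(opprB q) !powRN lef_pV2 ?posrE ?powR_gt0//.
by rewrite ge0_ler_powR ?nnegrE ?subr_ge0// ltW.
Qed.

(* A substitute for Jensen's inequality that survives a variable exponent. *)
Lemma half_powR_le_integral d' (T : measurableType d') (m : {measure set T -> \bar R})
    (w F q : T -> R) (S e : R) :
  measurable_fun setT w -> measurable_fun setT F -> measurable_fun setT q ->
  (forall y, (0 <= w y)%R) -> (forall y, (0 <= F y)%R) -> (forall y, (1 <= q y)%R) ->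
  \int[m]_y (w y)%:E <= 1 -> (0 < S)%R -> S%:E <= \int[m]_y (w y * F y)%:E ->
  ((S / 2) `^ e)%:E <= \int[m]_y (w y * (F y `^ q y * (S / 2) `^ (e - q y)))%:E.
Proof.
move=> mw mF mq w0 F0 q1 w1 S0 SF; pose s := (S / 2)%R.
have s0 : (0 < s)%R by rewrite divr_gt0.
have mFq := measurable_powR_exponent mF mq q1.
have msq (c : R) : measurable_fun setT (fun y => s `^ (c - q y))%R.
  rewrite (_ : (fun y => _) = (fun y => expR ((c - q y) * ln s))).
    apply: measurableT_comp => //; apply: measurable_funM => //.
    exact: measurable_funB.
  by apply/funext => y; rewrite /powR gt_eqF.
have mI c : measurable_fun setT (fun y => w y * (F y `^ q y * s `^ (c - q y)))%R.
  by apply: measurable_funM => //; apply: measurable_funM.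
have I0 c y : (0 <= w y * (F y `^ q y * s `^ (c - q y)))%R.
  by rewrite !mulr_ge0 ?powR_ge0.
(* With threshold [s = S / 2] and weights of mass at most 1, [le_add_powR] integrates to
   [S <= s + ...], and half of [S] is absorbed. The exponent [e] is then reached by multiplying by
   [s^(e - 1)]. *)
have key : s%:E <= \int[m]_y (w y * (F y `^ q y * s `^ (1 - q y)))%:E.
  have : S%:E <= s%:E + \int[m]_y (w y * (F y `^ q y * s `^ (1 - q y)))%:E.
    apply: (le_trans SF).
    apply: (@le_trans _ _ (s%:E * \int[m]_y (w y)%:E +
        \int[m]_y (w y * (F y `^ q y * s `^ (1 - q y)))%:E)); last first.
      by rewrite leeD2r// -[leRHS]mule1 lee_wpmul2l// lee_fin ltW.
    rewrite -ge0_integralZl_EFin ?(ltW s0)//; last 2 first.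
      by move=> y _; rewrite lee_fin.
      by apply/measurable_EFinP.
    rewrite -ge0_integralD//.
    - apply: ge0_le_integral => //.
      + by move=> y _; rewrite lee_fin mulr_ge0.
      + by apply/measurable_EFinP; exact: measurable_funM.
      + apply: emeasurable_funD; last exact/measurable_EFinP.
        by apply: measurable_funeM; exact/measurable_EFinP.
      + move=> y _; rewrite -EFinM -EFinD lee_fin (mulrC s) -mulrDr.
        by rewrite ler_wpM2l// le_add_powR.
    - by move=> y _; rewrite -EFinM lee_fin mulr_ge0 ?(ltW s0).
    - by apply: measurable_funeM; exact/measurable_EFinP.
    - by move=> y _; rewrite lee_fin.
    - exact/measurable_EFinP.
  case: (\int[m]_y _) => [r| |//]; last by move=> _; rewrite leey.
  by rewrite -EFinD !lee_fin /s => h; lra.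
have -> : (fun y => (w y * (F y `^ q y * (S / 2) `^ (e - q y)))%:E) =
   (fun y => (s `^ (e - 1))%:E * (w y * (F y `^ q y * s `^ (1 - q y)))%:E).
  apply/funext => y; rewrite -EFinM; congr EFin.
  rewrite (_ : e - q y = (e - 1) + (1 - q y))%R; last by ring.
  rewrite powRD; last by rewrite (gt_eqF s0) implybT.
  by rewrite -/s; ring.
rewrite ge0_integralZl_EFin ?powR_ge0//; last 2 first.
- by move=> y _; rewrite lee_fin.
- exact/measurable_EFinP.
rewrite (le_trans _ (lee_wpmul2l _ key)) ?lee_fin ?powR_ge0//.
rewrite -/s -{3}(powRr1 (ltW s0)) -powRD; last by rewrite (gt_eqF s0) implybT.
by rewrite subrK.
Qed.

End jensen_up_to_two.

Section luxemburg_bound.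
Context {R : realType} {d : nat}.
Notation mu := (@lebesgue_measure R).
Notation X := (d.-tuple R).
Notation gamma := (@gauss_measure R d).
Notation L1 f := (gamma.-integrable setT (EFin \o f)).
Variable q : X -> R.
Hypotheses (mq : measurable_fun setT q) (q1 : forall x, 1 <= q x).
Implicit Types (f g : X -> R) (l : R).
Local Open Scope ereal_scope.

(* [l] is admissible in the infimum defining the Luxemburg norm of [f], for the
   real-valued exponent [q]. *)
Definition lux_le f l := (0 < l)%R /\
  \int[gamma]_x (`|(f x / l)%R| `^ q x)%:E <= 1.

Lemma measurable_modular_integrand f : measurable_fun setT f ->
  measurable_fun setT (fun x => (`|f x| `^ q x)%:E).
Proof.
move=> mf; apply/measurable_EFinP; apply: measurable_powR_exponent => //.
exact: measurableT_comp.
Qed.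

Let q0 x : (0 <= q x)%R. Proof. exact: le_trans (q1 x). Qed.

(* The modular is subhomogeneous under contraction because [1 <= q]. *)
Lemma lux_leZ f l (M : R) : measurable_fun setT f -> (0 < l)%R -> (1 <= M)%R ->
  \int[gamma]_x (`|(f x / l)%R| `^ q x)%:E <= M%:E -> lux_le f (M * l)%R.
Proof.
move=> mf l0 M1 fM; have M0 : (0 < M)%R by exact: lt_le_trans M1.
split; first exact: mulr_gt0.
have mfl : measurable_fun setT (fun x => f x / l)%R by exact: measurable_funM.
apply: (@le_trans _ _ (\int[gamma]_x (M^-1%:E * (`|(f x / l)%R| `^ q x)%:E))).
  apply: ge0_le_integral => //.
  - by apply: measurable_modular_integrand; exact: measurable_funM.
  - by apply: measurable_funeM; exact: measurable_modular_integrand.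
  - move=> x _; rewrite -EFinM lee_fin.
    rewrite (_ : f x / (M * l) = M^-1 * (f x / l))%R; last first.
      by rewrite invfM mulrCA mulrA mulrC mulrA.
    rewrite normrM powRM// ler_wpM2r ?powR_ge0// ger0_norm ?invr_ge0 ?(ltW M0)//.
    rewrite -[leRHS]powRr1 ?invr_ge0 ?(ltW M0)//.
    by rewrite ger_powR// invr_gt0 M0 invf_le1.
rewrite ge0_integralZl_EFin ?invr_ge0 ?(ltW M0)//; last first.
  exact: measurable_modular_integrand.
rewrite (le_trans (lee_wpmul2l _ fM)) ?lee_fin ?invr_ge0 ?(ltW M0)//.
by rewrite mulVf ?gt_eqF.
Qed.

Lemma lux_le_trans f g l l' : measurable_fun setT f -> measurable_fun setT g ->
  lux_le g l -> (l <= l')%R -> (forall x, `|f x| <= `|g x|)%R -> lux_le f l'.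
Proof.
move=> mf mg [l0 gl] ll' fg; have l'0 : (0 < l')%R by exact: lt_le_trans ll'.
split; first exact: l'0.
apply: (le_trans _ gl); apply: ge0_le_integral => //.
- by apply: measurable_modular_integrand; exact: measurable_funM.
- by apply: measurable_modular_integrand; exact: measurable_funM.
- move=> x _; rewrite lee_fin ge0_ler_powR ?nnegrE//.
  rewrite !normrM (gtr0_norm (x := l'^-1)) ?invr_gt0// (gtr0_norm (x := l^-1)) ?invr_gt0//.
  by rewrite ler_pM ?invr_ge0 ?(ltW l'0)// lef_pV2.
Qed.

Lemma lux_le_scale f l (c : R) : (c != 0)%R -> lux_le f l ->
  lux_le (fun x => c * f x)%R (`|c| * l)%R.
Proof.
move=> c0 [l0 fl]; have nc : (0 < `|c|)%R by rewrite normr_gt0.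
split; first exact: mulr_gt0.
rewrite (eq_integral (fun x => (`|f x / l| `^ q x)%:E)%R) => [//|x _].
congr (_ `^ _)%:E; rewrite !normrM !normfV normrM normr_id.
rewrite invfM mulrA -(mulrA _ `|f x|%R) (mulrC `|f x|%R) !mulrA.
by rewrite divff ?gt_eqF// mul1r.
Qed.

(** Integrates [a <= 1 + a^q] over a space of mass 1. This embeds L^p(.) in L1, where all the
    operator identities live. *)
Lemma lux_le_integral f l : measurable_fun setT f -> lux_le f l ->
  \int[gamma]_x `|(f x / l)%R|%:E <= 2%:E.
Proof.
move=> mf [l0 fl]; have mfl : measurable_fun setT (fun x => f x / l)%R.
  exact: measurable_funM.
apply: (@le_trans _ _ (\int[gamma]_x (1 + (`|(f x / l)%R| `^ q x)%:E))).
  apply: ge0_le_integral => //.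
  - by apply: measurable_absE.
  - by apply: emeasurable_funD => //; exact: measurable_modular_integrand.
  - move=> x _; rewrite -EFinD lee_fin.
    by have := le_add_powR (normr_ge0 (f x / l)%R) ltr01 (q1 x); rewrite powR1 mulr1.
rewrite ge0_integralD//; last first.
  exact: measurable_modular_integrand.
have -> : \int[gamma]_(x in [set: X]) (1 : \bar R) = 1.
  by rewrite integral_cst// mul1e; exact: gauss_measure_setT.
by rewrite (_ : 2%:E = 1 + 1)// leeD2l.
Qed.

Lemma lux_le_L1 f l : measurable_fun setT f -> lux_le f l -> L1 f.
Proof.
move=> mf fl; apply/integrable_realP; split => //; have [l0 _] := fl.
have -> : (fun x => `|f x|%:E) = (fun x => l%:E * `|(f x / l)%R|%:E).
  apply/funext => x; rewrite -EFinM normrM normfV (gtr0_norm l0) mulrCA.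
  by rewrite divff ?gt_eqF// mulr1.
rewrite ge0_integralZl_EFin ?(ltW l0)//; last first.
  by apply: measurable_absE; exact: measurable_funM.
rewrite lte_mul_pinfty ?lee_fin ?(ltW l0)//.
exact: le_lt_trans (lux_le_integral mf fl) (ltry _).
Qed.

(** After division by [L] the weights [w a * l a] have mass at most 1, and [g / L] is dominated by
    the corresponding average of [|H / l|]. At a fixed [x] the exponent does not depend on [a], so
    [half_powR_le_integral] leaves only its factor 2; Tonelli then integrates slices of modular at
    most 1. *)
Lemma lux_le_minkowski (w l : R -> R) (H : R * X -> R) g (L : R) :
  measurable_fun setT w -> measurable_fun setT l -> measurable_fun setT H ->
  measurable_fun setT g ->
  (forall a, (0 <= w a)%R) -> (forall a, (0 < l a)%R) -> (0 < L)%R ->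
  (forall a, lux_le (fun x => H (a, x)) (l a)) ->
  \int[mu]_a (w a * l a)%:E <= L%:E ->
  (forall x, `|g x|%:E <= \int[mu]_a (w a * `|H (a, x)|)%:E) ->
  lux_le g (2 * L)%R.
Proof.
move=> mw ml mH mg w0 l0 L0 Hl wl gH; split; first by rewrite mulr_gt0.
have ml' : measurable_fun setT (fun a => (l a)^-1)%R.
  exact: (measurableT_comp (@measurable_invr R)).
pose W a := (w a * l a / L)%R.
have mW : measurable_fun setT W by apply: measurable_funM => //; exact: measurable_funM.
have W0 a : (0 <= W a)%R by rewrite divr_ge0 ?(ltW L0)// mulr_ge0// ltW.
have W1 : \int[mu]_a (W a)%:E <= 1.
  rewrite (_ : (fun a => (W a)%:E) = (fun a => L^-1%:E * (w a * l a)%:E)); last first.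
    by apply/funext => a; rewrite -EFinM mulrC.
  rewrite ge0_integralZl_EFin ?invr_ge0 ?(ltW L0)//; last 2 first.
  - by move=> a _; rewrite lee_fin mulr_ge0// ltW.
  - by apply/measurable_EFinP; exact: measurable_funM.
  rewrite (le_trans (lee_wpmul2l _ wl)) ?lee_fin ?invr_ge0 ?(ltW L0)//.
  by rewrite mulVf ?gt_eqF.
pose F a x := `|H (a, x) / l a|%R.
have mF : measurable_fun [set: measurableTypeR R * X] (fun z => F z.1 z.2).
  apply: measurableT_comp => //; apply: measurable_funM.
    by rewrite (_ : (fun z => _) = H)//; apply/funext => -[].
  exact: (measurableT_comp ml').
have mFa x : measurable_fun setT (fun a => F a x).
  exact: (measurableT_comp mF (pair2_measurable x)).
have mqc x : measurable_fun [set: R] (fun=> q x) by [].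
have pw x : (`|(g x / (2 * L))%R| `^ q x)%:E <=
    \int[mu]_a ((W a)%:E * (F a x `^ q x)%:E).
  have [g0|g0] := eqVneq (g x) 0%R.
    rewrite g0 mul0r normr0 powR0 ?gt_eqF ?(lt_le_trans _ (q1 x))//.
    by apply: integral_ge0 => a _; rewrite -EFinM lee_fin mulr_ge0 ?powR_ge0.
  have S0 : (0 < `|g x| / L)%R by rewrite divr_gt0// normr_gt0.
  have := @half_powR_le_integral R _ (measurableTypeR R) mu W (F^~ x) (fun=> q x)
    (`|g x| / L)%R (q x) mW (mFa x) (mqc x) W0 (fun a => normr_ge0 _) (fun=> q1 x) W1 S0.
  rewrite (_ : `|g x| / L / 2 = `|g x / (2 * L)|)%R; last first.
    by rewrite normrM normfV (gtr0_norm (mulr_gt0 _ L0))// invfM mulrA mulrAC.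
  move=> h; apply: (le_trans (h _)) => {h}; last first.
    rewrite le_eqVlt; apply/orP; left; apply/eqP; apply: eq_integral => a _ /=.
    by rewrite subrr powRr0 mulr1.
  have -> : (fun a => (W a * F a x)%:E) = (fun a => L^-1%:E * (w a * `|H (a, x)|)%:E).
    apply/funext => a; rewrite -EFinM; congr EFin.
    rewrite /W /F normrM normfV (gtr0_norm (l0 a)) -!mulrA mulrC !mulrA; field.
    by rewrite !gt_eqF.
  rewrite ge0_integralZl_EFin ?invr_ge0 ?(ltW L0)//; last 2 first.
  - by move=> a _; rewrite lee_fin mulr_ge0.
  - apply/measurable_EFinP; apply: measurable_funM => //.
    apply: measurableT_comp => //.
    exact: (measurableT_comp mH (pair2_measurable x)).
  by rewrite mulrC EFinM lee_wpmul2l// lee_fin invr_ge0 ltW.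
have mFq : measurable_fun [set: measurableTypeR R * X]
    (fun z => (W z.1)%:E * (F z.1 z.2 `^ q z.2)%:E).
  apply: emeasurable_funM; apply/measurable_EFinP.
    exact: (measurableT_comp mW).
  apply: (@measurable_powR_exponent R _ (measurableTypeR R * X)%type
    (fun z => F z.1 z.2) (fun z => q z.2)) => //.
  exact: (measurableT_comp mq).
have Fq0 z : 0 <= (W z.1)%:E * (F z.1 z.2 `^ q z.2)%:E.
  by rewrite -EFinM lee_fin mulr_ge0 ?powR_ge0.
apply: (@le_trans _ _ (\int[gamma]_x \int[mu]_a ((W a)%:E * (F a x `^ q x)%:E))).
  apply: ge0_le_integral => //.
  - by apply: measurable_modular_integrand; exact: measurable_funM.
  - exact: (@measurable_fun_fubini_tonelli_G _ _ (measurableTypeR R) X R mu _ mFq Fq0).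
rewrite -(@fubini_tonelli _ _ (measurableTypeR R) X R mu gamma
  (fun z => (W z.1)%:E * (F z.1 z.2 `^ q z.2)%:E) mFq Fq0)/=.
apply: le_trans W1; apply: ge0_le_integral => //.
- by move=> a _; apply: integral_ge0 => x _; exact: (Fq0 (a, x)).
- exact: (@measurable_fun_fubini_tonelli_F _ _ (measurableTypeR R) X R gamma _ mFq Fq0).
- by apply/measurable_EFinP.
- move=> a _; rewrite ge0_integralZl_EFin//.
  + by have [_ h] := Hl a; rewrite -[leRHS]mule1 lee_wpmul2l// lee_fin.
  + by move=> x _; rewrite lee_fin powR_ge0.
  + apply: measurable_modular_integrand; apply: measurable_funM => //.
    exact: (measurableT_comp mH (pair1_measurable a)).
Qed.

End luxemburg_bound.

(** * Gaussian moments and off-diagonal decay of the Mehler kernel *)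

Section ornstein_uhlenbeck_estimates.
Context {R : realType} {d : nat}.
Notation X := (d.-tuple R).
Notation gamma := (@gauss_measure R d).
Implicit Types (t : R) (x y u v : X).

Lemma ln_inv_le (a : R) : 0 < a -> ln a^-1 <= a^-1.
Proof. by move=> a0; rewrite ltW// ln_sublinear// invr_gt0. Qed.

Lemma integral_expR_half_enorm_lty :
  (\int[gamma]_x (expR (enorm x ^+ 2 / 2))%:E < +oo)%E.
Proof.
have mE (c : R) : measurable_fun setT (fun x : X => (expR (- (c * enorm x ^+ 2)))%:E).
  by apply/measurable_EFinP; exact: measurable_enormX2.
rewrite ge0_integral_gauss//; last first.
  rewrite (_ : (fun x => _) = (fun x : X => (expR (- (- 2^-1 * enorm x ^+ 2)))%:E))//.
  by apply/funext => x; rewrite mulNr opprK mulrC.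
- rewrite (_ : (fun x => _) = (fun x : X => (pi `^ (- (d%:R / 2)))%:E *
    (expR (- (2^-1 * enorm x ^+ 2)))%:E)%E); last first.
    apply/funext => x; rewrite -!EFinM; congr EFin; rewrite /gauss_density mulrCA -expRD.
    by congr (_ * expR _); lra.
  rewrite ge0_integralZl_EFin ?powR_ge0//.
  have s2 : 0 < Num.sqrt 2 :> R by rewrite sqrtr_gt0.
  have s2V : (0 < (Num.sqrt 2)^-1 :> R) by rewrite invr_gt0.
  (* The substitution [x -> x / sqrt 2] turns the known integral of [e^(-|x|^2)] into a positive
     multiple of the one of [e^(-|x|^2 / 2)]. *)
  have := @integral_expR_enorm R d.
  rewrite (@ge0_integral_lebesgue_tuple_affine R d _ 0 (tuple_zero) _ s2V)//; last first.
    rewrite (_ : (fun x => _) = (fun x : X => (expR (- (1 * enorm x ^+ 2)))%:E))//.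
    by apply/funext => x; rewrite mul1r.
  rewrite (_ : (fun x => _) = (fun x : X => ((Num.sqrt 2)^-1 ^+ d)%:E *
    (expR (- (2^-1 * enorm x ^+ 2)))%:E)%E); last first.
    apply/funext => x; rewrite muleC; congr (_ * (expR (- _))%:E)%E.
    rewrite !enormE mulr_sumr; apply: eq_bigr => i _.
    by rewrite tnth_lincomb mul0r addr0 exprMn exprVn sqr_sqrtr.
  rewrite ge0_integralZl_EFin ?exprn_ge0 ?(ltW s2V)//.
  set I := (\int[_]_x _)%E => h.
  apply: lte_mul_pinfty; rewrite ?lee_fin ?powR_ge0//.
  move: h; case: I => [r _|h|h]; rewrite ?ltry//.
  by move: h; rewrite gt0_muley// lte_fin exprn_gt0.
Qed.

Lemma integral_expR_enorm_lty (A : R) :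
  (\int[gamma]_x (expR (A * enorm x))%:E < +oo)%E.
Proof.
have m1 : measurable_fun setT (fun x : X => (expR (A * enorm x))%:E).
  apply/measurable_EFinP; apply: measurableT_comp => //; apply: measurable_funM => //.
  exact: measurable_enorm.
have m2 : measurable_fun setT (fun x : X => (expR (enorm x ^+ 2 / 2))%:E).
  apply/measurable_EFinP; apply: measurableT_comp => //; apply: measurable_funM => //.
  by apply: measurable_funX; exact: measurable_enorm.
apply: (@le_lt_trans _ _ (\int[gamma]_x ((expR (A ^+ 2 / 2))%:E * (expR (enorm x ^+ 2 / 2))%:E))%E).
  apply: ge0_le_integral => //.
  - by apply: measurable_funeM.
  - move=> x _; rewrite -EFinM lee_fin -expRD ler_expR.
    by have := sqr_ge0 (A - enorm x); nra.
rewrite ge0_integralZl_EFin ?expR_ge0//.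
by rewrite lte_mul_pinfty ?lee_fin ?expR_ge0// integral_expR_half_enorm_lty.
Qed.

(* Far from the diagonal the Gaussian factor of the Mehler kernel absorbs the
   singularity [ou_rad t ^- d]. *)
Lemma mehler_far_le : (0 < d)%N -> exists2 M : R, 1 <= M & forall t x y, 0 < t ->
  1 < enorm x -> 4 * enorm y <= enorm x ->
  mehler t x y <= M * expR (enorm y ^+ 2) * gauss_density y.
Proof.
(* The two terms serve [s >= 1/2], where [s^-d <= 2^d], and [s < 1/2]. In the latter case [r >= 3/4]
   gives [|y - r x| >= |x| / 2 >= 1/2], so the Gaussian factor is at most [e^(-z)] with
   [z = s^-2 / 4], while [s^-d <= (4 z)^d <= 4^d d^d e^z]. *)
move=> d0; pose M : R := 2 ^+ d + 4 ^+ d * d%:R ^+ d.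
exists M => [|t x y t0 x1 yx].
  by rewrite /M ler_wpDr ?mulr_ge0 ?exprn_ge0// exprn_ege1// ler1n.
have s0 := ou_rad_gt0 t0; have s1 := ou_rad_le1 t; have s2 := ou_rad2 (ltW t0).
have -> : M * expR (enorm y ^+ 2) * gauss_density y = pi `^ (- (d%:R / 2)) * M.
  rewrite /gauss_density mulrCA -!mulrA mulrA -mulrA (mulrC M); congr (_ * _).
  by rewrite -expRD subrr expR0 mul1r.
rewrite /mehler (mulrC (_ ^- d)) -mulrA ler_wpM2l ?powR_ge0//.
set s := ou_rad t; set r := expR (- t); set n := enorm _.
rewrite -/s in s0 s1.
have r0 : 0 < r := expR_gt0 _.
have sd0 : 0 <= s ^- d by rewrite invr_ge0 exprn_ge0// ltW.
have [sh|sh] := leP 2^-1 s.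
  apply: (@le_trans _ _ (2 ^+ d)).
    rewrite -[leRHS]mulr1 ler_pM ?expR_ge0//.
      by rewrite -exprVn lerXn2r ?nnegrE ?invr_ge0 ?(ltW s0)// -[leRHS]invrK lef_pV2 ?posrE.
    by rewrite -expR0 ler_expR oppr_le0 mulr_ge0 ?invr_ge0 ?sqr_ge0.
  by rewrite /M lerDl mulr_ge0// exprn_ge0.
have r34 : 3 / 4 <= r.
  rewrite leNgt; apply/negP => rl; move: s2; rewrite -/s -/r => s2.
  by nra.
have n0 : 0 <= n by exact: enorm_ge0.
have nh : 2^-1 <= n.
  have : r * enorm x <= n + enorm y.
    rewrite -(enorm_scale x (ltW r0)).
    have -> : tuple_lincomb r x 0 x = tuple_lincomb (-1) (tuple_lincomb 1 y (- r) x) 1 y.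
      by apply: eq_from_tnth => i; rewrite !tnth_lincomb; ring.
    by apply: le_trans (enorm_lincomb_le _ _ _ _) _; rewrite normrN normr1 !mul1r.
  by move=> h; nra.
pose z := s ^- 2 / 4.
have z0 : 0 <= z by rewrite divr_ge0// invr_ge0 exprn_ge0// ltW.
have ze := exprn_le_expR d0 z0.
have zn : expR (- (s ^- 2 * n ^+ 2)) <= expR (- z).
  rewrite ler_expR lerN2 /z ler_wpM2l ?invr_ge0 ?sqr_ge0//; nra.
have sz : s ^- d <= 4 ^+ d * z ^+ d.
  rewrite -exprMn /z mulrC divfK// -exprVn -exprVn lerXn2r ?nnegrE ?sqr_ge0 ?invr_ge0 ?(ltW s0)//.
  by rewrite expr2 ler_peMr ?invr_ge0 ?(ltW s0)// invr_ge1 ?unitf_gt0.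
apply: (@le_trans _ _ (4 ^+ d * (d%:R ^+ d * expR z) * expR (- z))).
  rewrite ler_pM ?expR_ge0// (le_trans sz)// ler_wpM2l// exprn_ge0//.
rewrite -!mulrA -expRD subrr expR0 mulr1 /M lerDr exprn_ge0//.
Qed.

End ornstein_uhlenbeck_estimates.

(** * Oscillation of the exponent between a point and its Ornstein-Uhlenbeck displacement *)

Section exponent_oscillation.
Context {R : realType} {d : nat}.
Notation X := (d.-tuple R).
Variables (q : X -> R) (Q C1 C qi : R).
Hypotheses (C10 : 0 < C1) (C0 : 0 < C) (q1 : forall x, 1 <= q x) (qQ : forall x, q x <= Q).
Hypothesis qLH : forall x y,
  `|q x - q y| <= C1 / ln (expR 1 + 1 / enorm (tuple_sub x y)).
Hypothesis qP : forall x, 0 < enorm x -> `|q x - qi| <= C / enorm x ^+ 2.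
Implicit Types (t : R) (x y v : X).

Let Q1 : 1 <= Q. Proof. exact: le_trans (q1 tuple_zero) (qQ _). Qed.

Lemma osc_le x y : `|q x - q y| <= Q.
Proof.
have := q1 x; have := qQ x; have := q1 y; have := qQ y => *.
by rewrite ler_norml; apply/andP; split; lra.
Qed.

(** Both values are compared with the limit [qi]; since [|y| >= c |x|], the decay at [y] is worth
    the decay at [x] up to [c^-2]. *)
Lemma osc_decay_le (c : R) x y : 0 < c -> 0 < enorm x -> c * enorm x <= enorm y ->
  `|q x - q y| * enorm x ^+ 2 <= C * (1 + c ^- 2).
Proof.
move=> c0 x0 xy; have y0 : 0 < enorm y by rewrite (lt_le_trans _ xy)// mulr_gt0.
have h1 : `|q x - qi| * enorm x ^+ 2 <= C by rewrite -ler_pdivlMr ?exprn_gt0// qP.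
have h2 : `|q y - qi| * enorm y ^+ 2 <= C by rewrite -ler_pdivlMr ?exprn_gt0// qP.
have h3 : `|q y - qi| * enorm x ^+ 2 <= C * c ^- 2.
  rewrite ler_pdivlMr ?exprn_gt0// -mulrA -exprMn (le_trans _ h2)// ler_wpM2l//.
  by rewrite lerXn2r ?nnegrE ?enorm_ge0 ?mulr_ge0 ?(ltW c0) ?enorm_ge0// mulrC.
apply: (@le_trans _ _ ((`|q x - qi| + `|q y - qi|) * enorm x ^+ 2)).
  by rewrite ler_wpM2r ?sqr_ge0// (le_trans (ler_distD qi _ _))// (distrC qi).
by rewrite mulrDl mulrDr mulr1 lerD.
Qed.

(** The displacement [s v - (1 - r) y] is of order [s (1 + |v|)] only while [|y| <= 1 / s]; beyond
    that the drift matters, and the decay at infinity takes over from log-Hoelder continuity. When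
    neither applies, [v] is so large that [ln (1 / s)] itself is at most a multiple of [|v|]. *)
Lemma osc_log_le t y v : 0 < t ->
  `|q (ou_point t v y) - q y| * ln (ou_rad t)^-1 <=
  (4 * Q + 2 * C1 + 5 * C) * (1 + enorm v).
Proof.
move=> t0; set x := ou_point t v y; set D := `|_|.
have s0 := ou_rad_gt0 t0; have s1 := ou_rad_le1 t; have := ou_rad2 (ltW t0).
set s := ou_rad t; set r := expR (- t) => s2; set L := ln s^-1.
rewrite -/s in s0 s1.
have r0 : 0 < r := expR_gt0 _.
have r1 : r < 1 by rewrite expR_lt1 oppr_lt0.
have D0 : 0 <= D := normr_ge0 _.
have DQ : D <= Q := osc_le _ _.
have v0 : 0 <= enorm v := enorm_ge0 v.
have sV1 : 1 <= s^-1 by rewrite invr_ge1 ?unitf_gt0.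
have L0 : 0 <= L by rewrite ln_ge0.
have LV : L <= s^-1 := ln_inv_le s0.
have Q0 : 0 <= Q by rewrite (le_trans _ Q1).
have Qv : 0 <= Q * enorm v by rewrite mulr_ge0.
have C1v : 0 <= C1 * enorm v by rewrite mulr_ge0// ltW.
have Cv : 0 <= C * enorm v by rewrite mulr_ge0// ltW.
have KE z : z <= 4 * Q + 2 * C1 + 5 * C + 4 * (Q * enorm v) ->
    z <= (4 * Q + 2 * C1 + 5 * C) * (1 + enorm v).
  move=> /le_trans; apply; rewrite -subr_ge0.
  rewrite (_ : _ - _ = 2 * (C1 * enorm v) + 5 * (C * enorm v)); last by ring.
  by rewrite addr_ge0// mulr_ge0.
have C1' := ltW C10; have C' := ltW C0.
have [sh|sh] := leP 4^-1 s.
  have s4 : s^-1 <= 4 by rewrite -[leRHS]invrK lef_pV2 ?posrE.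
  have : D * L <= Q * 4 by rewrite ler_pM// (le_trans LV).
  by move=> h; apply: KE; lra.
have r34 : 3 / 4 <= r.
  by rewrite leNgt; apply/negP => rl; nra.
(* In the first case the drift is at most [s], since [1 - r <= 1 - r^2 = s^2]. *)
have [ys|ys] := leP (enorm y) s^-1.
  have xy : enorm (tuple_sub x y) <= s * (1 + enorm v).
    have -> : tuple_sub x y = tuple_lincomb s v (r - 1) y.
      by apply: eq_from_tnth => i; rewrite /x /ou_point !tnth_lincomb tnth_mktuple
        tnth_lincomb -/s -/r; ring.
    apply: (le_trans (enorm_lincomb_le _ _ _ _)).
    rewrite gtr0_norm// distrC ger0_norm ?subr_ge0 ?(ltW r1)// mulrDr mulr1 addrC lerD2r.
    apply: (@le_trans _ _ (s ^+ 2 * s^-1)).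
      by rewrite ler_pM ?subr_ge0 ?(ltW r1) ?enorm_ge0//; nra.
    by rewrite expr2 mulfK ?gt_eqF.
  (* Either [|x - y|^2 <= s], so that [ln (1 / s) <= 2 ln (1 / |x - y|)] and log-Hoelder continuity
     applies, or [1 / s < (1 + |v|)^2]. *)
  have [sv|sv] := leP ((1 + enorm v) ^+ 2 * s) 1.
    have [n0|n0] := eqVneq (enorm (tuple_sub x y)) 0.
      have -> : D = 0.
        rewrite /D (_ : x = y) ?subrr ?normr0//.
        apply: eq_from_tnth => i; have := enorm0_tnth i n0.
        by rewrite tnth_mktuple => /eqP; rewrite subr_eq0 => /eqP.
      by rewrite mul0r; apply: KE; lra.
    have np : 0 < enorm (tuple_sub x y) by rewrite lt_neqAle eq_sym n0 enorm_ge0.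
    set n := enorm (tuple_sub x y) in xy n0 np *.
    set l := ln (expR 1 + 1 / n).
    have nV : 0 < n^-1 by rewrite invr_gt0.
    have e0 : 0 < expR 1 + 1 / n :> R by rewrite mul1r addr_gt0// expR_gt0.
    have l1 : 1 <= l.
      rewrite /l -[leLHS](expRK 1) ler_ln ?posrE ?expR_gt0// mul1r lerDl ltW//.
    have Dl : D * l <= C1 by rewrite -ler_pdivlMr ?(lt_le_trans _ l1)// qLH.
    have Ll : L <= 2 * l.
      apply: (@le_trans _ _ (2 * ln n^-1)); last first.
        rewrite ler_wpM2l// /l ler_ln ?posrE// mul1r lerDr expR_ge0//.
      rewrite mulr_natl -lnXn// ler_ln ?posrE ?invr_gt0 ?exprn_gt0// exprVn lef_pV2 ?posrE ?exprn_gt0//.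
      apply: (@le_trans _ _ ((s * (1 + enorm v)) ^+ 2)).
        by rewrite lerXn2r ?nnegrE ?(ltW np)// mulr_ge0 ?(ltW s0)// addr_ge0.
      by nra.
    have : D * L <= 2 * C1.
      by apply: (@le_trans _ _ (D * (2 * l))); [rewrite ler_wpM2l|nra].
    by move=> h; apply: KE; lra.
  have Lv : L <= 2 * enorm v.
    have v1 : 0 < 1 + enorm v by rewrite ltr_wpDr.
    apply: (@le_trans _ _ (2 * ln (1 + enorm v))).
      rewrite mulr_natl -lnXn// ler_ln ?posrE ?invr_gt0 ?exprn_gt0//.
      by rewrite -[leLHS]mul1r ler_pdivrMr// ltW.
    by rewrite ler_wpM2l// le_ln1Dx// (lt_le_trans _ v0).
  have : D * L <= Q * (2 * enorm v) by rewrite ler_pM.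
  by move=> h; apply: KE; lra.
have y0 : 0 < enorm y by rewrite (lt_trans _ ys)// invr_gt0.
(* Here [ln (1 / s) <= 1 / s < |y|]. If [|x| >= |y| / 2], the decay of the exponent bounds
   [D |y|^2]; otherwise [r |y| <= |x| + s |v|] with [r >= 3/4] forces [|y| <= 4 |v|]. *)
have [xy|xy] := leP (2^-1 * enorm y) (enorm x).
  have : D * enorm y ^+ 2 <= C * (1 + 2^-1 ^- 2).
    by rewrite /D distrC osc_decay_le// invr_gt0.
  have : L <= enorm y ^+ 2.
    rewrite (le_trans LV)// (le_trans (ltW ys))// expr2 ler_peMr ?(ltW y0)//.
    exact: le_trans (ltW ys).
  move=> Ly; rewrite exprVn invrK => h.
  have : D * L <= D * enorm y ^+ 2 by rewrite ler_wpM2l.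
  by move=> h'; apply: KE; lra.
have rv : r * enorm y <= enorm x + s * enorm v.
  rewrite -(enorm_scale y (ltW r0)).
  have -> : tuple_lincomb r y 0 y = tuple_lincomb 1 x (- s) v.
    by apply: eq_from_tnth => i; rewrite /x /ou_point !tnth_lincomb -/r -/s; ring.
  by apply: (le_trans (enorm_lincomb_le _ _ _ _)); rewrite normrN normr1 mul1r gtr0_norm.
have sv : s * enorm v <= enorm v by rewrite ler_piMl.
have : L <= 4 * enorm v by nra.
move=> Lv; have : D * L <= Q * (4 * enorm v) by rewrite ler_pM.
by move=> h; apply: KE; lra.
Qed.

End exponent_oscillation.

(** * Uniform boundedness of the Ornstein-Uhlenbeck semigroup *)

Section ornstein_uhlenbeck_bounded.
Context {R : realType} {d : nat}.
Notation X := (d.-tuple R).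
Notation gamma := (@gauss_measure R d).
Notation OU := ornstein_uhlenbeck.
Variables (q : X -> R) (Q C1 C qi : R).
Hypotheses (d0 : (0 < d)%N) (mq : measurable_fun setT q).
Hypotheses (C10 : 0 < C1) (C0 : 0 < C) (q1 : forall x, 1 <= q x) (qQ : forall x, q x <= Q).
Hypothesis qLH : forall x y,
  `|q x - q y| <= C1 / ln (expR 1 + 1 / enorm (tuple_sub x y)).
Hypothesis qP : forall x, 0 < enorm x -> `|q x - qi| <= C / enorm x ^+ 2.
Implicit Types (t : R) (x y u v : X) (g : X -> R).

Let Q1 : 1 <= Q. Proof. exact: le_trans (q1 tuple_zero) (qQ _). Qed.
Let q0 x : 0 <= q x. Proof. exact: le_trans (q1 x). Qed.

(** Small enough for two purposes: a far [y] satisfies [4 |y| <= |x|], as [mehler_far_le] requires,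
    and the factor [e^((c |x|)^2)] that remains stays below [e^(|x|^2 / 2)] when raised to the power
    [Q]. *)
Let c : R := (4 * Q)^-1.
Let c0 : 0 < c. Proof. by rewrite invr_gt0 mulr_gt0// (lt_le_trans _ Q1). Qed.

(* On near pairs [`|q x - q y| * |x|^2] is bounded; far pairs are handled by the
   off-diagonal decay of the Mehler kernel. *)
Let near_pair x y := (enorm x <= 1) || (c * enorm x <= enorm y).

(** This is [ou_rad t ^ (- d |q x - q y|)], the cost of the singularity of the kernel. *)
Let log_factor t x y := expR (d%:R * (`|q x - q y| * ln (ou_rad t)^-1)).

Let measurable_log_factor t d' (T : measurableType d') (x y : T -> X) :
  measurable_fun setT x -> measurable_fun setT y ->
  measurable_fun setT (fun w => log_factor t (x w) (y w)).
Proof.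
move=> mx my.
apply: measurableT_comp => //; apply: measurable_funM => //.
apply: measurable_funM => //; apply: measurableT_comp => //.
by apply: measurable_funB; exact: (measurableT_comp mq).
Qed.

Let measurable_near x d' (T : measurableType d') (y : T -> X) :
  measurable_fun setT y -> measurable_fun setT (fun w => near_pair x (y w)).
Proof.
move=> my; rewrite /near_pair; case: (enorm x <= 1)%R => //=.
apply: measurable_fun_ler => //.
exact: (measurableT_comp (@measurable_enorm R d)).
Qed.

Let K1 : R := Q + C * (1 + c ^- 2).

Let near_osc x y : near_pair x y -> `|q x - q y| * enorm x ^+ 2 <= K1.
Proof.
have Q0 : 0 <= Q by rewrite (le_trans _ Q1).
have CK : 0 <= C * (1 + c ^- 2).
  by rewrite mulr_ge0 ?addr_ge0 ?invr_ge0 ?sqr_ge0// ltW.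
move=> xy; have [x1|x1] := leP (enorm x) 1.
  rewrite -[leLHS]addr0 lerD// -[leRHS]mulr1 ler_pM ?sqr_ge0 ?(osc_le q1 qQ)//.
  by rewrite expr_le1 ?enorm_ge0.
move: xy; rewrite /near_pair leNgt x1/= => xy.
rewrite -[leLHS]add0r lerD// (osc_decay_le qP)//.
by rewrite (lt_trans _ x1).
Qed.

(** [ln s] is at most [d ln (1 / ou_rad t) + |x|^2]: multiplied by the oscillation of [q], the first
    term gives [log_factor] and the second is bounded by [near_osc]. The upper bound on [s] is what
    [EOU_le] says of an average of a function of integral at most 1. *)
Let near_powR t x y (s : R) : 0 < t -> near_pair x y -> 1 <= s ->
  s <= ou_rad t ^- d * expR (enorm x ^+ 2) ->
  s `^ (q x - q y) <= expR K1 * log_factor t x y.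
Proof.
move=> t0 xy s1 sle; have s0 : 0 < s by rewrite (lt_le_trans _ s1).
rewrite /powR (gt_eqF s0) /log_factor -expRD ler_expR.
apply: (@le_trans _ _ (`|q x - q y| * ln s)).
  by rewrite ler_wpM2r ?ln_ge0// ler_norm.
have r0 := ou_rad_gt0 t0.
have lns : ln s <= d%:R * ln (ou_rad t)^-1 + enorm x ^+ 2.
  have p0 : 0 < ou_rad t ^- d by rewrite invr_gt0 exprn_gt0.
  rewrite -(expRK (enorm x ^+ 2)) mulr_natl -lnXn ?invr_gt0// exprVn -lnM ?posrE ?expR_gt0//.
  by rewrite ler_ln ?posrE// mulr_gt0// expR_gt0.
rewrite (le_trans (ler_wpM2l _ lns))// mulrDr addrC lerD// ?near_osc//.
by rewrite mulrCA.
Qed.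

Local Open Scope ereal_scope.

Let K3 := \int[gamma]_v (expR (d%:R * ((4 * Q + 2 * C1 + 5 * C) * (1 + enorm v))))%:E.

Let K3_lty : K3 < +oo.
Proof.
pose A : R := (d%:R * (4 * Q + 2 * C1 + 5 * C))%R.
have mA : measurable_fun setT (fun v : X => (expR (A * enorm v))%:E).
  apply/measurable_EFinP; apply: measurableT_comp => //; apply: measurable_funM => //.
  exact: measurable_enorm.
have -> : K3 = \int[gamma]_v ((expR A)%:E * (expR (A * enorm v))%:E).
  apply: eq_integral => v _; rewrite -EFinM -expRD; congr (expR _)%:E.
  by rewrite /A; ring.
rewrite ge0_integralZl_EFin ?expR_ge0//.
by rewrite lte_mul_pinfty ?lee_fin ?expR_ge0// integral_expR_enorm_lty.
Qed.

(** Exchangeability moves [g^q] to the outer variable. The inner integral is then the average of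
    [log_factor] alone, which [osc_log_le] bounds by [K3] uniformly in [t] and in the base point. *)
Let near_integral t g : (0 < t)%R -> measurable_fun setT g -> (forall y, (0 <= g y)%R) ->
  \int[gamma]_y (g y `^ q y)%:E <= 1 ->
  \int[gamma]_x \int[gamma]_u
    (g (ou_point t u x) `^ q (ou_point t u x) * log_factor t x (ou_point t u x))%:E <= K3.
Proof.
move=> t0 mg g0 gq; have mgq := measurable_powR_exponent mg mq q1.
pose Phi (z : X * X) := (g z.2 `^ q z.2 * log_factor t z.1 z.2)%:E.
have mPhi : measurable_fun setT Phi.
  apply/measurable_EFinP; apply: measurable_funM; last exact: measurable_log_factor.
  exact: (measurableT_comp mgq).
have Phi0 z : 0 <= Phi z by rewrite lee_fin mulr_ge0 ?powR_ge0 ?expR_ge0.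
rewrite (ge0_integral_ou_pointC t0 mPhi Phi0) /Phi /=.
have K30 : 0 <= K3 by apply: integral_ge0 => v _; rewrite lee_fin expR_ge0.
have mK : measurable_fun setT
    (fun v : X => (expR (d%:R * ((4 * Q + 2 * C1 + 5 * C) * (1 + enorm v))))%:E).
  apply/measurable_EFinP; apply: measurableT_comp => //; apply: measurable_funM => //.
  by apply: measurable_funM => //; apply: measurable_funD => //; exact: measurable_enorm.
have mop y : measurable_fun setT (fun u => ou_point t u y).
  exact: measurable_ou_point.
have mlf y : measurable_fun setT (fun u => (log_factor t (ou_point t u y) y)%:E).
  by apply/measurable_EFinP; exact: measurable_log_factor.
have mE : measurable_fun setT (fun z : X * X => Phi (ou_point t z.2 z.1, z.1)).
  apply: (measurableT_comp mPhi); apply/measurable_fun_pairP; split => /=.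
    exact: measurable_ou_point.
  exact: measurable_fst.
apply: (@le_trans _ _ (\int[gamma]_y ((g y `^ q y)%:E * K3))).
  apply: ge0_le_integral => //.
  - by move=> y _; apply: integral_ge0 => u _; exact: (Phi0 (_, _)).
  - exact: (@measurable_fun_fubini_tonelli_F _ _ X X R gamma _ mE (fun z => Phi0 (_, _))).
  - by apply: emeasurable_funM => //; exact/measurable_EFinP.
  - move=> y _; under eq_integral do rewrite EFinM.
    rewrite ge0_integralZl_EFin ?powR_ge0//; last first.
      by move=> u _; rewrite lee_fin expR_ge0.
    rewrite lee_wpmul2l ?lee_fin ?powR_ge0//; apply: ge0_le_integral => //.
    + by move=> u _; rewrite lee_fin expR_ge0.
    + move=> u _; rewrite lee_fin ler_expR ler_wpM2l//.
      exact: (osc_log_le C10 C0 q1 qQ qLH qP).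
rewrite ge0_integralZr//; last 2 first.
- exact/measurable_EFinP.
- by move=> y _; rewrite lee_fin powR_ge0.
by rewrite -[leRHS]mul1e lee_wpmul2r.
Qed.

(** If [S / 2 <= 1], the term 1 suffices. Otherwise [half_powR_le_integral], with the indicator of
    near pairs as weight, produces [(S / 2)^(q x - q y)], and [S / 2] lies in the range required by
    [near_powR]. *)
Let near_pointwise t g x (S : R) : (0 < t)%R -> measurable_fun setT g ->
  (forall y, (0 <= g y)%R) -> \int[gamma]_y (g y)%:E <= 1 -> (0 <= S)%R ->
  S%:E = \int[gamma]_u ((near_pair x (ou_point t u x))%:R * g (ou_point t u x))%:E ->
  ((S / 2) `^ q x)%:E <= 1 + (expR K1)%:E * \int[gamma]_u
    (g (ou_point t u x) `^ q (ou_point t u x) * log_factor t x (ou_point t u x))%:E.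
Proof.
move=> t0 mg g0 g1 S0 SE.
set J := \int[gamma]_u _.
have J0 : 0 <= J.
  by apply: integral_ge0 => u _; rewrite lee_fin mulr_ge0 ?powR_ge0 ?expR_ge0.
have [s1|s1] := leP (S / 2)%R 1%R.
  apply: (@le_trans _ _ 1); last by rewrite leeDl// mule_ge0// lee_fin expR_ge0.
  have := @ge0_ler_powR R (q x) (q0 x) (S / 2)%R 1%R.
  by rewrite powR1 lee_fin !nnegrE; apply=> //; rewrite divr_ge0.
have Sp : (0 < S)%R by lra.
have mgq := measurable_powR_exponent mg mq q1.
have mop : measurable_fun setT (fun u => ou_point t u x).
  exact: measurable_ou_point.
have mnear : measurable_fun setT (fun u => (near_pair x (ou_point t u x))%:R : R).
  rewrite (_ : (fun u => _) =
    (fun u => if near_pair x (ou_point t u x) then 1 else 0)%R); last first.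
    by apply/funext => u; case: ifP.
  by apply: measurable_fun_ifT => //; exact: measurable_near.
have mlf : measurable_fun setT (fun u => log_factor t x (ou_point t u x)).
  exact: measurable_log_factor.
have near1 : \int[gamma]_u ((near_pair x (ou_point t u x))%:R)%:E <= 1.
  apply: (@le_trans _ _ (\int[gamma]_(u in [set: X]) (1 : \bar R))).
    apply: ge0_le_integral => //; first exact/measurable_EFinP.
    by move=> u _; rewrite lee_fin; case: near_pair.
  by rewrite integral_cst// mul1e le_eqVlt; apply/orP; left; apply/eqP;
    exact: gauss_measure_setT.
have mgo := measurableT_comp mg mop.
have mqo := measurableT_comp mq mop.
have SE' : S%:E <= \int[gamma]_u ((near_pair x (ou_point t u x))%:R * g (ou_point t u x))%:E.
  by rewrite SE.
apply: (le_trans (half_powR_le_integral (q x) mnear mgo mqo (fun=> ler0n _ _)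
  (fun=> g0 _) (fun=> q1 _) near1 Sp SE')).
apply: (@le_trans _ _ ((expR K1)%:E * J)); last by rewrite leeDr.
rewrite -ge0_integralZl_EFin ?expR_ge0//; last 2 first.
- by move=> u _; rewrite lee_fin mulr_ge0 ?powR_ge0 ?expR_ge0.
- by apply/measurable_EFinP; apply: measurable_funM => //; exact: (measurableT_comp mgq mop).
have Sle : (S / 2 <= ou_rad t ^- d * expR (enorm x ^+ 2))%R.
  apply: (@le_trans _ _ S); first by lra.
  have mG : measurable_fun setT (EFin \o g) by exact/measurable_EFinP.
  have := EOU_le x t0 mG (fun y => g0 y).
  move=> /(fun h => le_trans h (lee_wpmul2l _ g1)); rewrite mule1 -lee_fin => h.
  apply: le_trans (h _); last first.
    by rewrite lee_fin mulr_ge0 ?expR_ge0// invr_ge0 exprn_ge0// ou_rad_ge0.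
  rewrite SE; apply: ge0_le_integral => //.
  - by move=> u _; rewrite lee_fin mulr_ge0.
  - by apply/measurable_EFinP; apply: measurable_funM.
  - exact/measurable_EFinP.
  - by move=> u _; rewrite lee_fin; case: near_pair; rewrite ?mul1r ?mul0r.
apply: ge0_le_integral => //.
- by move=> u _; rewrite lee_fin !mulr_ge0 ?powR_ge0.
- apply/measurable_EFinP; apply: measurable_funM => //; apply: measurable_funM.
    exact: (measurableT_comp mgq mop).
  rewrite (_ : (fun u => _) =
      (fun u => expR ((q x - q (ou_point t u x)) * ln (S / 2)))%R).
    apply: measurableT_comp => //; apply: measurable_funM => //.
    exact: measurable_funB.
  by apply/funext => u; rewrite /powR gt_eqF// (lt_trans _ s1).
- apply: measurable_funeM; apply/measurable_EFinP; apply: measurable_funM => //.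
  exact: (measurableT_comp mgq mop).
- move=> u _; rewrite -EFinM lee_fin.
  have [nr|nr] := boolP (near_pair _ _); last first.
    by rewrite mul0r !mulr_ge0 ?powR_ge0 ?expR_ge0.
  by rewrite mul1r mulrCA ler_wpM2l ?powR_ge0// near_powR// ltW.
Qed.

(** No power is involved at this stage: on far pairs [|y| < c |x|], so the kernel is at most
    [M e^((c |x|)^2)] times the Gaussian density, and [g] has integral at most 1. *)
Let far_le (M : R) t g x : (forall t x y, (0 < t)%R -> (1 < enorm x)%R ->
    (4 * enorm y <= enorm x)%R ->
    (mehler t x y <= M * expR (enorm y ^+ 2) * gauss_density y)%R) ->
  (0 <= M)%R -> (0 < t)%R -> measurable_fun setT g -> (forall y, (0 <= g y)%R) ->
  \int[gamma]_y (g y)%:E <= 1 ->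
  \int[gamma]_u (if near_pair x (ou_point t u x) then 0 else g (ou_point t u x))%:E <=
    (M * expR ((c * enorm x) ^+ 2))%:E.
Proof.
move=> HM M0 t0 mg g0 g1.
pose G y : R := if near_pair x y then 0%R else g y.
have G0 y : (0 <= G y)%R by rewrite /G; case: ifP.
have mG : measurable_fun setT G.
  by apply: measurable_fun_ifT => //; exact: measurable_near.
have mGE : measurable_fun setT (EFin \o G) by exact/measurable_EFinP.
have -> : \int[gamma]_u (if near_pair x (ou_point t u x) then 0 else g (ou_point t u x))%:E =
    \int[lebesgue_tuple d]_y ((G y)%:E * (mehler t x y)%:E).
  exact: (@ge0_integral_ou_point R d t x (EFin \o G) t0 mGE (fun y => G0 y)).
have k0 : (0 <= M * expR ((c * enorm x) ^+ 2))%R by rewrite mulr_ge0 ?expR_ge0.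
have mgd := @measurable_gauss_density R d.
apply: (@le_trans _ _ (\int[lebesgue_tuple d]_y ((M * expR ((c * enorm x) ^+ 2))%:E *
    ((G y)%:E * (gauss_density y)%:E)))).
  apply: ge0_le_integral => //.
  - by move=> y _; rewrite -EFinM lee_fin mulr_ge0 ?mehler_ge0.
  - apply: emeasurable_funM => //; apply/measurable_EFinP.
    exact: (measurableT_comp (measurable_mehler t) (pair1_measurable x)).
  - by apply: measurable_funeM; apply: emeasurable_funM => //; exact/measurable_EFinP.
  - move=> y _; rewrite -!EFinM lee_fin [leRHS]mulrCA.
    have [nr|] := boolP (near_pair x y); first by rewrite /G nr !mul0r.
    rewrite /near_pair negb_or -!ltNge => /andP[x1 yx]; rewrite ler_wpM2l//.
    have x0 : (0 < enorm x)%R by rewrite (lt_trans _ x1).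
    apply: (le_trans (HM _ _ _ t0 x1 _)).
      rewrite -ler_pdivlMl// (le_trans (ltW yx))// ler_wpM2r ?(ltW x0)//.
      by rewrite /c invfM ler_piMr ?invr_ge0// invf_le1// (lt_le_trans _ Q1).
    rewrite ler_wpM2r ?gauss_density_ge0// ler_wpM2l// ler_expR.
    by rewrite lerXn2r ?nnegrE ?enorm_ge0 ?mulr_ge0 ?enorm_ge0 ?(ltW c0)// ltW.
rewrite ge0_integralZl_EFin//; last 2 first.
- by move=> y _; rewrite -EFinM lee_fin mulr_ge0 ?gauss_density_ge0.
- by apply: emeasurable_funM => //; exact/measurable_EFinP.
have := @ge0_integral_gauss R d (EFin \o G) mGE (fun y => G0 y).
rewrite /= => <-; rewrite -[leRHS]mule1 lee_wpmul2l ?lee_fin//.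
apply: le_trans g1; apply: ge0_le_integral => //.
- by move=> y _; rewrite lee_fin.
- exact/measurable_EFinP.
- by move=> y _; rewrite lee_fin /G; case: ifP.
Qed.

Let powR_add3_le (T a b r : R) : (0 <= a -> 0 <= b -> 0 <= T -> T <= 1 + a + b ->
  1 <= r -> r <= Q -> T `^ r <= 3 `^ Q * (1 + a `^ r + b `^ r))%R.
Proof.
move=> a0 b0 T0 Tab r1 rQ; have r0 : (0 <= r)%R by lra.
pose m := Num.max 1%R (Num.max a b).
have m0 : (0 <= m)%R by rewrite le_max ler01.
have T3 : (T <= 3 * m)%R.
  have : (1 <= m)%R by rewrite le_max lexx.
  have : (a <= m)%R by rewrite !le_max lexx orbT.
  have : (b <= m)%R by rewrite !le_max lexx !orbT.
  by lra.
apply: (@le_trans _ _ ((3 * m) `^ r)%R).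
  by rewrite ge0_ler_powR// nnegrE// mulr_ge0.
rewrite powRM// ler_pM ?powR_ge0//; first by rewrite ler_powR//; lra.
have := powR_ge0 a r; have := powR_ge0 b r => *.
by rewrite /m !maxEle; do 2?case: ifP => _; rewrite ?powR1; lra.
Qed.

(** With [F = |f / l| <= 1 + g], the average of [F] is at most 1 plus the averages of [g] over near
    and over far pairs. Powers of the three are bounded pointwise, their integrals are constants
    independent of [t], and [lux_leZ] converts the resulting bound [B] of the modular into the level
    [B l]. *)
Lemma lux_le_OU : exists2 B : R, (1 <= B)%R & forall t f l, (0 < t)%R ->
  measurable_fun setT f -> lux_le q f l -> lux_le q (OU t f) (B * l)%R.
Proof.
have Q0 : (0 < Q)%R by rewrite (lt_le_trans _ Q1).
have [M M1 HM] := @mehler_far_le R d d0.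
have M0 : (0 <= M)%R by rewrite (le_trans _ M1).
set K2 := \int[gamma]_x (expR (enorm x ^+ 2 / 2))%:E.
have K2_lty : K2 < +oo by exact: integral_expR_half_enorm_lty.
have K20 : 0 <= K2 by apply: integral_ge0 => v _; rewrite lee_fin expR_ge0.
have K30 : 0 <= K3 by apply: integral_ge0 => v _; rewrite lee_fin expR_ge0.
have K2E : K2 = (fine K2)%:E by rewrite fineK// ge0_fin_numE.
have K3E : K3 = (fine K3)%:E by rewrite fineK// ge0_fin_numE.
(* [3]^ Q[comes from the power of a sum of three terms and]2 [^ Q] from the threshold [S / 2]; [a2]
   goes with the near part and [a3] with the far part. *)
pose a1 : R := (3 `^ Q * (1 + 2 `^ Q))%R.
pose a2 : R := (3 `^ Q * (2 `^ Q * expR K1))%R.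
pose a3 : R := (3 `^ Q * M `^ Q)%R.
have a10 : (0 <= a1)%R by rewrite mulr_ge0 ?addr_ge0 ?powR_ge0.
have a20 : (0 <= a2)%R by rewrite !mulr_ge0 ?expR_ge0 ?powR_ge0.
have a30 : (0 <= a3)%R by rewrite !mulr_ge0 ?powR_ge0.
pose B : R := (1 + (a1 + a2 * fine K3 + a3 * fine K2))%R.
have F2 : (0 <= fine K2)%R := fine_ge0 K20.
have F3 : (0 <= fine K3)%R := fine_ge0 K30.
have B11 : (1 <= B)%R.
  by rewrite /B lerDl; apply: addr_ge0; [apply: addr_ge0|]; (exact: a10 || exact: mulr_ge0).
have B1 : (a1 + a2 * fine K3 + a3 * fine K2 <= B)%R by rewrite lerDr.
exists B => [//|t f l t0 mf fl].
have [l0 fl1] := fl.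
have fi := lux_le_L1 mq q1 mf fl.
apply: lux_leZ => //; first exact: measurable_OU_point.
pose F y := `|f y / l|%R.
(* Where [F > 1], [F <= F^q]: the truncated function has both its modular and its integral bounded
   by 1. *)
pose g y := if (1 < F y)%R then F y else 0%R.
have mF : measurable_fun setT F.
  by apply: measurableT_comp => //; exact: measurable_funM.
have mg : measurable_fun setT g.
  by apply: measurable_fun_ifT => //; exact: measurable_fun_ltr.
have F0 y : (0 <= F y)%R by exact: normr_ge0.
have g0 y : (0 <= g y)%R by rewrite /g; case: ifP.
have mFq := measurable_powR_exponent mF mq q1.
have mgq := measurable_powR_exponent mg mq q1.
have gq : \int[gamma]_y (g y `^ q y)%:E <= 1.
  apply: le_trans fl1; apply: ge0_le_integral => //.
  - by move=> y _; rewrite lee_fin powR_ge0.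
  - exact/measurable_EFinP.
  - exact/measurable_EFinP.
  - move=> y _; rewrite lee_fin -/(F y) ge0_ler_powR ?nnegrE//.
    by rewrite /g; case: ifP.
have g1 : \int[gamma]_y (g y)%:E <= 1.
  apply: le_trans fl1; apply: ge0_le_integral => //.
  - by move=> y _; rewrite lee_fin.
  - exact/measurable_EFinP.
  - exact/measurable_EFinP.
  - move=> y _; rewrite lee_fin -/(F y) /g; case: ifP => [F1|]; rewrite ?powR_ge0//.
    by rewrite -[leLHS]powRr1// ler_powR// ltW.
have mop x : measurable_fun setT (fun u => ou_point t u x).
  exact: measurable_ou_point.
pose N x u := ((near_pair x (ou_point t u x))%:R * g (ou_point t u x))%R.
pose W x u := (if near_pair x (ou_point t u x) then 0 else g (ou_point t u x))%R.
have mgo x : measurable_fun setT (fun u => g (ou_point t u x)).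
  exact: (measurableT_comp mg (mop x)).
have mN x : measurable_fun setT (N x).
  apply: measurable_funM => //.
  rewrite (_ : (fun u => _) =
    (fun u => if near_pair x (ou_point t u x) then 1 else 0)%R); last first.
    by apply/funext => u; case: ifP.
  by apply: measurable_fun_ifT => //; exact: measurable_near.
have mW x : measurable_fun setT (W x).
  by apply: measurable_fun_ifT => //; exact: measurable_near.
have N0 x u : (0 <= N x u)%R by rewrite mulr_ge0.
have W0 x u : (0 <= W x u)%R by rewrite /W; case: ifP.
have WM x : \int[gamma]_u (W x u)%:E <= (M * expR ((c * enorm x) ^+ 2))%:E.
  exact: far_le.
have NL x : \int[gamma]_u (N x u)%:E < +oo.
  have mG : measurable_fun setT (EFin \o g) by exact/measurable_EFinP.
  apply: le_lt_trans (EOU_lty x t0 mG (fun y => g0 y) (le_lt_trans g1 (ltry _))).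
  apply: ge0_le_integral => //.
  - by move=> u _; rewrite lee_fin.
  - exact/measurable_EFinP.
  - exact/measurable_EFinP.
  - by move=> u _; rewrite lee_fin /N; case: near_pair; rewrite ?mul1r ?mul0r.
pose J x := \int[gamma]_u
    (g (ou_point t u x) `^ q (ou_point t u x) * log_factor t x (ou_point t u x))%:E.
have J0 x : 0 <= J x.
  by apply: integral_ge0 => u _; rewrite lee_fin mulr_ge0 ?powR_ge0 ?expR_ge0.
have mJ : measurable_fun setT J.
  have mE : measurable_fun setT (fun z : X * X => (g (ou_point t z.2 z.1) `^
      q (ou_point t z.2 z.1) * log_factor t z.1 (ou_point t z.2 z.1))%:E).
    have mo : measurable_fun setT (fun z : X * X => ou_point t z.2 z.1).
      exact: measurable_ou_point.
    apply/measurable_EFinP; apply: measurable_funM.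
      exact: (measurableT_comp mgq mo).
    exact: measurable_log_factor.
  apply: (@measurable_fun_fubini_tonelli_F _ _ X X R gamma _ mE).
  by move=> z; rewrite lee_fin mulr_ge0 ?powR_ge0 ?expR_ge0.
have pw x : (`|OU t f x / l|%R `^ q x)%:E <=
    a1%:E + a2%:E * J x + a3%:E * (expR (enorm x ^+ 2 / 2))%:E.
  have Tle : (`|OU t f x / l|%R)%:E <= 1 + \int[gamma]_u (N x u)%:E + \int[gamma]_u (W x u)%:E.
    rewrite mulrC -OUZ//.
    apply: (le_trans (abs_OU_le t x (measurable_funM (measurable_cst l^-1%R) mf))).
    have -> : 1 = \int[gamma]_(u in [set: X]) (1 : \bar R).
      by rewrite integral_cst// mul1e; apply/esym; exact: gauss_measure_setT.
    rewrite -ge0_integralD//; last 2 first.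
    - by move=> u _; rewrite lee_fin.
    - exact/measurable_EFinP.
    rewrite -ge0_integralD//; last 4 first.
    - by move=> u _; rewrite lee_fin addr_ge0.
    - by apply: emeasurable_funD => //; exact/measurable_EFinP.
    - by move=> u _; rewrite lee_fin.
    - exact/measurable_EFinP.
    apply: ge0_le_integral => //.
    - apply/measurable_EFinP; apply: measurableT_comp => //; apply: measurable_funM => //.
      exact: (measurableT_comp mf).
    - apply: emeasurable_funD; last exact/measurable_EFinP.
      by apply: emeasurable_funD => //; exact/measurable_EFinP.
    - move=> u _; rewrite -!EFinD lee_fin /= (mulrC l^-1%R) -/(F _) /N /W.
      have : (F (ou_point t u x) <= 1 + g (ou_point t u x))%R.
        by rewrite /g; case: ltP => [_|F1]; rewrite ?addr0 ?lerDr.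
      by case: near_pair; rewrite ?mul1r ?mul0r ?addr0.
  have NF : \int[gamma]_u (N x u)%:E = (fine (\int[gamma]_u (N x u)%:E))%:E.
    by rewrite fineK// ge0_fin_numE//; apply: integral_ge0 => u _; rewrite lee_fin.
  have WF : \int[gamma]_u (W x u)%:E = (fine (\int[gamma]_u (W x u)%:E))%:E.
    rewrite fineK// ge0_fin_numE; first exact: le_lt_trans (WM x) (ltry _).
    by apply: integral_ge0 => u _; rewrite lee_fin.
  move: Tle (WM x) NF WF; set a := fine _; set b := fine _ => Tle WMx NF WF.
  have a0 : (0 <= a)%R by rewrite fine_ge0//; apply: integral_ge0 => u _; rewrite lee_fin.
  have b0 : (0 <= b)%R by rewrite fine_ge0//; apply: integral_ge0 => u _; rewrite lee_fin.
  move: Tle WMx; rewrite NF WF -!EFinD !lee_fin => Tle bM.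
  have := near_pointwise t0 mg g0 g1 a0 (esym NF); rewrite -/(J x) => aJ.
  apply: (@le_trans _ _ (3 `^ Q * (1 + a `^ q x + b `^ q x))%:E).
    by rewrite lee_fin; exact: powR_add3_le.
  have bq : (b `^ q x <= M `^ Q * expR (enorm x ^+ 2 / 2))%R.
    have e1 : (1 <= expR ((c * enorm x) ^+ 2))%R by rewrite -expR0 ler_expR sqr_ge0.
    have Me1 : (1 <= M * expR ((c * enorm x) ^+ 2))%R by rewrite -[leLHS]mulr1 ler_pM.
    apply: (@le_trans _ _ ((M * expR ((c * enorm x) ^+ 2)) `^ q x)%R).
      by rewrite ge0_ler_powR// nnegrE// (le_trans _ Me1).
    apply: (le_trans (ler_powR Me1 (qQ x))).
    rewrite powRM ?expR_ge0// ler_wpM2l ?powR_ge0//.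
    rewrite -expRM ler_expR exprMn mulrC mulrA mulrC ler_wpM2l ?sqr_ge0//.
    have Qc : (Q * c = 4^-1)%R by rewrite /c; field; rewrite gt_eqF.
    have c1 : (c <= 1)%R by rewrite invf_le1 ?mulr_gt0//; have := Q1; lra.
    by rewrite expr2 mulrA Qc; lra.
  have aq : (a `^ q x)%:E <= (2 `^ Q)%:E * (1 + (expR K1)%:E * J x).
    rewrite -[a in leLHS](divfK (_ : 2 != 0)%R)// mulrC powRM ?divr_ge0// EFinM.
    by rewrite lee_pmul ?lee_fin ?powR_ge0// ler_powR// ler1n.
  rewrite EFinM !EFinD.
  apply: (@le_trans _ _ ((3 `^ Q)%:E * (1 + (2 `^ Q)%:E * (1 + (expR K1)%:E * J x) +
     (M `^ Q * expR (enorm x ^+ 2 / 2))%:E))).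
    by rewrite lee_wpmul2l ?lee_fin ?powR_ge0// leeD// leeD2l.
  rewrite le_eqVlt; apply/orP; left; apply/eqP.
  have EJ0 : 0 <= (expR K1)%:E * J x by rewrite mule_ge0// lee_fin expR_ge0.
  have P0 : 0 <= (2 `^ Q)%:E * (1 + (expR K1)%:E * J x).
    by rewrite mule_ge0 ?adde_ge0// lee_fin powR_ge0.
  rewrite ge0_muleDr ?adde_ge0// ?lee_fin ?mulr_ge0 ?powR_ge0 ?expR_ge0//.
  rewrite ge0_muleDr// (ge0_muleDr (2 `^ Q)%:E)// ge0_muleDr//; last first.
    by rewrite mule_ge0// lee_fin powR_ge0.
  by rewrite addeA /a1 /a2 /a3 mulrDr mulr1 !EFinD !EFinM !mule1 -!muleA.
have me2 : measurable_fun setT (fun x : X => (expR (enorm x ^+ 2 / 2))%:E).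
  apply/measurable_EFinP; apply: measurableT_comp => //; apply: measurable_funM => //.
  by apply: measurable_funX; exact: measurable_enorm.
apply: (@le_trans _ _ (\int[gamma]_x
    (a1%:E + a2%:E * J x + a3%:E * (expR (enorm x ^+ 2 / 2))%:E))).
  apply: ge0_le_integral => //.
  - apply: measurable_modular_integrand => //.
    by apply: measurable_funM => //; exact: measurable_OU_point.
  - apply: emeasurable_funD; last exact: measurable_funeM.
    by apply: emeasurable_funD => //; exact: measurable_funeM.
rewrite ge0_integralD//; last 4 first.
- by move=> x _; rewrite adde_ge0 ?mule_ge0 ?lee_fin.
- by apply: emeasurable_funD => //; exact: measurable_funeM.
- by move=> x _; rewrite mule_ge0 ?lee_fin ?expR_ge0.
- exact: measurable_funeM.
rewrite ge0_integralD//; last 2 first.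
- by move=> x _; rewrite mule_ge0 ?lee_fin.
- exact: measurable_funeM.
rewrite !ge0_integralZl_EFin//.
have -> : \int[gamma]_(x in [set: X]) a1%:E = a1%:E.
  by rewrite integral_cst// -[RHS]mule1; congr (_ * _); exact: gauss_measure_setT.
apply: (@le_trans _ _ (a1%:E + a2%:E * K3 + a3%:E * K2)).
  rewrite leeD2r// leeD2l// lee_wpmul2l ?lee_fin//.
  exact: near_integral.
by rewrite K2E K3E -!EFinM -!EFinD lee_fin.
Qed.

End ornstein_uhlenbeck_bounded.

(** * Boundedness of the Bessel potential *)

Section luxemburg_operators.
Context {R : realType} {d : nat}.
Notation mu := (@lebesgue_measure R).
Notation X := (d.-tuple R).
Notation gamma := (@gauss_measure R d).
Notation L1 f := (gamma.-integrable setT (EFin \o f)).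
Notation OU := ornstein_uhlenbeck.
Notation Dn := dt_poisson_hermite.
Variables (q : X -> R) (B : R).
Hypotheses (mq : measurable_fun setT q) (q1 : forall x, 1 <= q x) (B1 : 1 <= B).
Hypothesis OU_le : forall t f l, 0 < t -> measurable_fun setT f ->
  lux_le q f l -> lux_le q (OU t f) (B * l).
Implicit Types (t l m b : R) (f g : X -> R) (x : X) (k : R -> R) (n : nat).

Let B0 : 0 < B. Proof. exact: lt_le_trans B1. Qed.

(** The [+ 1] keeps the level positive when [c = 0]. *)
Lemma lux_leZl f l (c : R) : measurable_fun setT f -> lux_le q f l ->
  lux_le q (fun x => c * f x) ((`|c| + 1) * l).
Proof.
move=> mf fl; have c1 : 0 < `|c| + 1 by rewrite ltr_wpDl.
have := lux_le_scale (lt0r_neq0 c1) fl; rewrite (gtr0_norm c1) => h.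
apply: (lux_le_trans mq q1 _ _ h) => //; try exact: measurable_funM.
by move=> x; rewrite !normrM ler_wpM2r// (gtr0_norm c1) lerDl.
Qed.

Lemma lux_le_Sub k m f l : dominated k -> 0 < m ->
  (\int[mu]_z `|k z|%:E <= m%:E)%E -> measurable_fun setT f -> lux_le q f l ->
  lux_le q (Sub k f) (2 * (m * (B * l))).
Proof.
move=> kd m0 km mf fl; have [mk _] := kd; have [l0 _] := fl.
have Bl0 : 0 < B * l by rewrite mulr_gt0.
have mH : measurable_fun setT (fun w : R * X => OU (sub_time w.1) f w.2).
  apply: (@measurable_OU R d _ (R * X)%type (@sub_time R \o fst) (f \o snd) snd) => //.
    by apply: measurableT_comp => //; exact: measurable_sub_time.
  exact: (measurableT_comp mf).
apply: (@lux_le_minkowski R d q mq q1 (fun z => `|k z|) (cst (B * l))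
  (fun w => OU (sub_time w.1) f w.2)).
- exact: measurableT_comp.
- exact: measurable_cst.
- exact: mH.
- exact: measurable_Sub_point.
- by move=> z.
- by move=> z.
- exact: mulr_gt0.
- by move=> z; exact: (OU_le (sub_time_gt0 z) mf fl).
- rewrite (_ : (fun z => _) = (fun z => (B * l)%:E * `|k z|%:E)%E); last first.
    by apply/funext => z; rewrite -EFinM mulrC.
  rewrite ge0_integralZl_EFin ?(ltW Bl0)//; last exact: measurable_absE.
  by rewrite (mulrC m) [leRHS]EFinM lee_wpmul2l// lee_fin ltW.
- move=> x; apply: (le_trans (@abs_Rintegral_le _ (measurableTypeR R) R mu _ _)).
    exact: measurable_Sub_integrand.
  by under eq_integral do rewrite normrM.
Qed.

Lemma lux_le_poisson t f l : 0 < t -> measurable_fun setT f -> lux_le q f l ->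
  lux_le q (Sub (poisson_kernel t) f) (2 * (B * l)).
Proof.
move=> t0 mf fl; have := lux_le_Sub (dominated_poisson_kernel t0) ltr01 _ mf fl.
rewrite mul1r; apply; rewrite -(integral_poisson_kernel t0) le_eqVlt.
apply/orP; left; apply/eqP; apply: eq_integral => z _.
by rewrite ger0_norm// poisson_kernel_ge0// ltW.
Qed.

(** The kernel of [dSub t] has total mass at most [8 / t], being dominated by [8 / t] times a
    probability density. *)
Lemma lux_le_dSub t f l : 0 < t -> measurable_fun setT f -> lux_le q f l ->
  lux_le q (dSub t f) (2 * (8 / t * (B * l))).
Proof.
move=> t0 mf; have t8 : 0 < 8 / t by rewrite divr_gt0.
have kd := dominated_poisson_kernel_deriv t0; have [mk _] := kd.
have t2 : 0 < t / 2 by rewrite divr_gt0.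
move=> fl; apply: (lux_le_Sub kd t8 _ mf fl).
apply: (@le_trans _ _ (\int[mu]_z ((8 / t)%:E * (poisson_kernel (t / 2) z)%:E))%E).
  apply: ge0_le_integral => //.
  - exact: measurable_absE.
  - by apply: measurable_funeM; apply/measurable_EFinP; exact: measurable_poisson_kernel.
  - by move=> z _; rewrite -EFinM lee_fin; exact: abs_poisson_kernel_deriv_le.
rewrite ge0_integralZl_EFin ?(ltW t8)//; last 2 first.
- by move=> z _; rewrite lee_fin poisson_kernel_ge0// ltW.
- by apply/measurable_EFinP; exact: measurable_poisson_kernel.
by rewrite integral_poisson_kernel// mule1.
Qed.

Lemma lux_le_dt_poisson_hermite n : exists2 K : R, 0 < K &
  forall t f l, 0 < t -> measurable_fun setT f -> lux_le q f l ->
    lux_le q (Dn n t f) (K * t ^- n * l).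
Proof.
elim: n => [|n [K K0 IH]].
  exists (2 * B) => [|t f l t0 mf fl]; first exact: mulr_gt0.
  have fi := lux_le_L1 mq q1 mf fl.
  rewrite expr0 invr1 mulr1 -mulrA (_ : Dn 0 t f = Sub (poisson_kernel t) f).
    exact: lux_le_poisson.
  by apply/funext => x; exact: dt_poisson_hermite0.
(* [2 ^+ n] comes from applying the induction hypothesis at time [t / 2], and [32 = 2 * 8 * 2]
   collects the factor of [lux_le_minkowski], the constant of the kernel derivative and the halved
   time. *)
exists (K * 2 ^+ n * 32 * B) => [|t f l t0 mf fl]; first by rewrite !mulr_gt0 ?exprn_gt0.
have fi := lux_le_L1 mq q1 mf fl.
have t2 : 0 < t / 2 by rewrite divr_gt0.
rewrite (_ : Dn n.+1 t f = Dn n (t / 2) (dSub (t / 2) f)); last first.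
  by apply/funext => x; exact: (congr1 (@^~ x) (dt_poisson_hermite_half n t0 fi)).
have := IH _ _ _ t2 ((integrable_realP gamma _).1 (integrable_dSub t2 fi)).1
  (lux_le_dSub t2 mf fl).
congr (lux_le q _ _); rewrite exprS !exprMn !exprVn.
by field; rewrite ?expf_neq0 ?gt_eqF.
Qed.

Lemma lux_le_bessel_integral b : 0 < b -> exists2 K : R, 0 < K &
  forall f l, measurable_fun setT f -> lux_le q f l ->
    lux_le q (bessel_integral b f) (K * l).
Proof.
move=> b0; set m := (\int[mu]_a (bessel_weight b a)%:E)%E.
have moo : (m < +oo)%E := integral_bessel_weight_lty b0.
have m0 : (0 <= m)%E.
  by apply: integral_ge0 => a _; rewrite lee_fin bessel_weight_ge0.
pose M := 1 + fine m; have M0 : 0 < M by rewrite ltr_wpDr// fine_ge0.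
have mM : (m <= M%:E)%E.
  by rewrite -[leLHS]fineK ?ge0_fin_numE// lee_fin /M lerDr.
have mw := @measurable_bessel_weight R b.
exists (2 * (M * (2 * B))) => [|f l mf fl]; first by rewrite !mulr_gt0.
have [l0 _] := fl; have fi := lux_le_L1 mq q1 mf fl.
have Bl0 : 0 < 2 * (B * l) by rewrite !mulr_gt0.
rewrite -!mulrA.
apply: (@lux_le_minkowski R d q mq q1 (bessel_weight b) (cst (2 * (B * l)))
  (fun w => Sub (poisson_kernel (expR w.1)) f w.2)).
- exact: mw.
- exact: measurable_cst.
- exact: measurable_Sub_exp.
- exact: ((integrable_realP gamma _).1 (integrable_bessel_integral b0 fi)).1.
- by move=> a; exact: bessel_weight_ge0.
- by move=> a.
- exact: mulr_gt0.
- by move=> a; exact: (lux_le_poisson (expR_gt0 a) mf fl).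
- rewrite (_ : (fun a => _) = (fun a => (2 * (B * l))%:E * (bessel_weight b a)%:E)%E); last first.
    by apply/funext => a; rewrite -EFinM mulrC.
  rewrite ge0_integralZl_EFin ?(ltW Bl0)//; last 2 first.
  + by move=> a _; rewrite lee_fin bessel_weight_ge0.
  + exact/measurable_EFinP.
  by rewrite (mulrC M) [leRHS]EFinM lee_wpmul2l// lee_fin ltW.
- move=> x; apply: (le_trans (@abs_Rintegral_le _ (measurableTypeR R) R mu _ _)).
    exact: (measurableT_comp (measurable_bessel_integrand b mf) (pair2_measurable x)).
  by under eq_integral do rewrite normrM (ger0_norm (bessel_weight_ge0 _ _)).
Qed.

Lemma lux_le_dt_bessel_integral b (E : R) : 0 < b -> b < E -> exists2 K : R, 0 < K &
  forall n f (A : R), L1 f -> 0 < A ->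
    (forall t, 0 < t -> lux_le q (Dn n t f) (A * t `^ (- E))) ->
    forall t, 0 < t -> lux_le q (Dn n t (bessel_integral b f)) (K * A * t `^ (b - E)).
Proof.
move=> b0 bE; have [C C0 CP] := integral_bessel_weight_powR_le b0 bE.
exists (2 * C) => [|n f A fi A0 fA t t0]; first exact: mulr_gt0.
have Dfi := integrable_dt_poisson_hermite n t0 fi.
have [mDf _] := (integrable_realP gamma _).1 Dfi.
have mw := @measurable_bessel_weight R b.
have et a : 0 < expR a + t by rewrite addr_gt0 ?expR_gt0.
have mp : measurable_fun setT (fun a => (expR a + t) `^ (- E)).
  rewrite (_ : (fun a => _) = (fun a => expR (- E * ln (expR a + t)))); last first.
    by apply/funext => a; rewrite /powR gt_eqF.
  apply: measurableT_comp => //; apply: measurable_funM => //.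
  by apply: (measurableT_comp (@measurable_ln R)); exact: measurable_funD.
rewrite (_ : Dn n t (bessel_integral b f) = bessel_integral b (Dn n t f)); last first.
  by apply/funext => x; exact: dt_poisson_hermite_bessel_integral.
have tE : 0 < t `^ (b - E) by rewrite powR_gt0.
rewrite -!mulrA.
apply: (@lux_le_minkowski R d q mq q1 (bessel_weight b) (fun a => A * (expR a + t) `^ (- E))
  (fun w => Sub (poisson_kernel (expR w.1)) (Dn n t f) w.2)).
- exact: mw.
- exact: measurable_funM.
- exact: measurable_Sub_exp.
- exact: ((integrable_realP gamma _).1 (integrable_bessel_integral b0 Dfi)).1.
- by move=> a; exact: bessel_weight_ge0.
- by move=> a; rewrite mulr_gt0 ?powR_gt0.
- by rewrite !mulr_gt0.
- move=> a /=.
  (* [P_(e^a)] merges with the derivative at time [t] into the derivative at time [e^a + t], where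
     the hypothesis on [f] applies. *)
  rewrite (_ : (fun x => _) = Dn n (expR a + t) f); first exact: (fA _ (et a)).
  apply/funext => x; rewrite -(dt_poisson_hermite0 x (expR_gt0 a) Dfi).
  by rewrite -(dt_poisson_hermiteD 0 n x (expR_gt0 a) t0 fi) add0n.
- rewrite (_ : (fun a => _) =
      (fun a => A%:E * (bessel_weight b a * (expR a + t) `^ (- E))%:E)%E); last first.
    by apply/funext => a; rewrite -EFinM mulrCA.
  rewrite ge0_integralZl_EFin ?(ltW A0)//; last 2 first.
  + by move=> a _; rewrite lee_fin mulr_ge0 ?bessel_weight_ge0 ?powR_ge0.
  + by apply/measurable_EFinP; exact: measurable_funM.
  by rewrite mulrCA EFinM lee_wpmul2l ?lee_fin ?(ltW A0)// CP.
- move=> x; apply: (le_trans (@abs_Rintegral_le _ (measurableTypeR R) R mu _ _)).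
    exact: (measurableT_comp (measurable_bessel_integrand b mDf) (pair2_measurable x)).
  by under eq_integral do rewrite normrM (ger0_norm (bessel_weight_ge0 _ _)).
Qed.

End luxemburg_operators.

(** * From admissible levels to norms *)

Section luxemburg_norm.
Context {R : realType} {d : nat}.
Notation X := (d.-tuple R).
Variable p : X -> \bar R.
Local Notation q := (fun x => fine (p x)).
Hypotheses (mq : measurable_fun setT q) (q1 : forall x, 1 <= q x).
Implicit Types (f : X -> R) (l : R).
Local Open Scope ereal_scope.

Lemma lux_norm_le f l : lux_le q f l -> lux_norm p f <= l%:E.
Proof. by move=> fl; apply: ereal_inf_lbound; exists l. Qed.

Lemma lux_norm_ge0 f : 0 <= lux_norm p f.
Proof. by apply: le_ereal_inf_tmp => _ [l [l0 _] <-]; rewrite lee_fin ltW. Qed.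

(** Whether the infimum is attained is left open; strictness supplies a smaller admissible level,
    and admissibility passes to larger levels. *)
Lemma lux_norm_lt f l : measurable_fun setT f -> lux_norm p f < l%:E -> lux_le q f l.
Proof.
move=> mf /ereal_inf_lt[_ [l' fl' <-]]; rewrite lte_fin => ll'.
exact: (lux_le_trans mq q1 mf mf fl' (ltW ll')).
Qed.

Lemma Lvar_lux_le f : Lvar p f -> exists l, lux_le q f l.
Proof.
move=> [mf [l l0 fl]]; pose M := (1 + fine (modular p (fun x => (f x / l)%R)))%R.
have m0 : 0 <= modular p (fun x => (f x / l)%R).
  by apply: integral_ge0 => x _; rewrite lee_fin powR_ge0.
exists (M * l)%R; apply: lux_leZ => //; first by rewrite /M lerDl fine_ge0.
by rewrite -[leLHS]fineK ?ge0_fin_numE// lee_fin /M lerDr.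
Qed.

Lemma lux_le_Lvar f l : measurable_fun setT f -> lux_le q f l -> Lvar p f.
Proof. by move=> mf [l0 fl]; split => //; exists l => //; exact: le_lt_trans fl (ltry _). Qed.

End luxemburg_norm.

Section besov_norm_extra.
Context {R : realType} {d : nat}.
Implicit Types (p : d.-tuple R -> \bar R) (f : d.-tuple R -> R).
Local Open Scope ereal_scope.

Lemma le_mul_ereal_inf (S : set R) (c : R) (y : \bar R) : (0 < c)%R ->
  (forall a, S a -> y <= (c * a)%:E) -> y <= c%:E * ereal_inf [set a%:E | a in S].
Proof.
move=> c0 yS; rewrite -lee_pdivrMl//; apply: le_ereal_inf_tmp => _ [a Sa <-].
by rewrite lee_pdivrMl// -EFinM yS.
Qed.

Lemma besov_bound_ge0 a p f (A : R) : besov_bound a p f A -> (0 <= A)%R.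
Proof.
move=> /(_ 1%R ltr01); rewrite powR1 mulr1 => h.
by rewrite -lee_fin (le_trans (lux_norm_ge0 _ _) h).
Qed.

Lemma besov_seminorm_ge0 a p f : 0 <= besov_seminorm a p f.
Proof.
by apply: le_ereal_inf_tmp => _ [A /besov_bound_ge0 A0 <-]; rewrite lee_fin.
Qed.

Lemma lt_besov_order (a : R) : (0 <= a -> a < (besov_order a)%:R)%R.
Proof. by move=> a0; have := besov_orderP (besov_order a) a0; rewrite lexx => ->. Qed.

End besov_norm_extra.

Section exponent_regularity.
Context {R : realType} {d : nat}.
Notation X := (d.-tuple R).
Variable p : X -> \bar R.
Hypotheses (pE : exponent p) (pLH : LH0 p) (pP : P_infty_gauss p).
Local Notation q := (fun x => fine (p x)).

(** The diagonal case of [LH0] excludes the value [+oo], since [+oo - +oo] has infinite absolute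
    value. *)
Lemma exponent_fin x : p x = (fine (p x))%:E.
Proof.
have [_ /(_ x) p1] := pE; have [C1 _ /(_ x x)] := pLH.
by move: p1; case: (p x).
Qed.

Lemma measurable_fine_exponent : measurable_fun setT q.
Proof. by have [mp _] := pE; exact: (measurableT_comp (@fine_measurable R setT measurableT)). Qed.

Lemma fine_exponent_ge1 x : 1 <= fine (p x).
Proof. by have [_ /(_ x)] := pE; rewrite -lee_fin -exponent_fin. Qed.

Lemma fine_exponent_LH0 : exists2 C1 : R, 0 < C1 & forall x y,
  `|q x - q y| <= C1 / ln (expR 1 + 1 / enorm (tuple_sub x y)).
Proof.
have [C1 C10 H] := pLH; exists C1 => // x y.
by rewrite -lee_fin -abse_EFin EFinB -!exponent_fin.
Qed.

(** The logarithm in [LH0] is at least 1, so [q] stays within [C1] of its value at the origin: a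
    bound valid at every point. *)
Lemma fine_exponent_le : exists Q, forall x, fine (p x) <= Q.
Proof.
have [C1 C10 H] := fine_exponent_LH0; exists (q tuple_zero + C1) => x.
rewrite -lerBlDl (le_trans (ler_norm _))// (le_trans (H _ _))//.
rewrite ler_pdivrMr; last by rewrite ln_gt0// ltr_wpDr ?mulr_ge0 ?invr_ge0 ?enorm_ge0// expR_gt1.
rewrite ler_peMr ?(ltW C10)// -[leLHS](expRK 1) ler_ln ?posrE ?expR_gt0//.
  by rewrite lerDl mulr_ge0 ?invr_ge0 ?enorm_ge0.
by rewrite ltr_wpDr ?mulr_ge0 ?invr_ge0 ?enorm_ge0// expR_gt0.
Qed.

Lemma fine_exponent_decay : exists C qi : R, 0 < C /\ forall x, 0 < enorm x ->
  `|q x - qi| <= C / enorm x ^+ 2.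
Proof.
have [C [qi [C0 _ H]]] := pP; exists C, qi; split => // x x0.
have xz : x != tuple_zero.
  apply: contraTneq x0 => ->; rewrite -leNgt /enorm big1 ?sqrtr0// => i _.
  by rewrite tnth_mktuple expr0n.
by rewrite -lee_fin -abse_EFin EFinB -exponent_fin H.
Qed.

End exponent_regularity.

Theorem theorem2p1 (R : realType) (d : nat) (hd : (0 < d)%N)
    (alpha beta : R) (halpha : 0 <= alpha) (hbeta : 0 < beta)
    (p : d.-tuple R -> \bar R) (hp : exponent p)
    (hPinf : P_infty_gauss p) (hLH0 : LH0 p)
    (hp_inf : (1 < exponent_inf p)%E)
    (hp_inf_sup : (exponent_inf p <= exponent_sup p)%E)
    (hp_sup : (exponent_sup p < +oo)%E) :
  exists2 C : R, 0 < C &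
    forall f : d.-tuple R -> R, besov alpha p f ->
      besov (alpha + beta) p (bessel_potential beta f) /\
      (besov_norm (alpha + beta) p (bessel_potential beta f)
         <= C%:E * besov_norm alpha p f)%E.
Proof.
pose q x := fine (p x).
have mq : measurable_fun setT q := measurable_fine_exponent hp.
have q1 x : 1 <= q x := fine_exponent_ge1 hp hLH0 x.
have [C1 C10 qLH] := fine_exponent_LH0 hp hLH0.
have [Q qQ] := fine_exponent_le hp hLH0.
have [Cp [qi [Cp0 qP]]] := fine_exponent_decay hp hLH0 hPinf.
have [B B1 OU_le] := lux_le_OU hd mq C10 Cp0 q1 qQ qLH qP.
set k0 := besov_order alpha; set k := besov_order (alpha + beta).
have ab0 : 0 <= alpha + beta by rewrite addr_ge0// ltW.
have kk0 : (k0 <= k)%N 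
  by rewrite -lez_nat -besov_orderP//= (le_lt_trans _ (lt_besov_order ab0))// lerDl ltW.
(* The condition under which the integral of [s^(beta - 1) (s + t)^(alpha - k)] converges at
   infinity. *)
have bk : beta < k%:R - alpha by rewrite ltrBrDl lt_besov_order.
have [K1 K10 Dle] := lux_le_dt_poisson_hermite mq q1 B1 OU_le (k - k0).
have [K2 K20 Jle] := lux_le_bessel_integral mq q1 B1 OU_le hbeta.
have [K3 K30 DJle] := lux_le_dt_bessel_integral mq q1 hbeta bk.
pose c := `|(Gamma beta)^-1| + 1 : R.
have c0 : 0 < c by rewrite ltr_wpDl.
pose D1 := c * K2; have D10 : 0 < D1 by rewrite mulr_gt0.
pose D2 := c * (K3 * (K1 * 2 `^ (k%:R - alpha))).
have D20 : 0 < D2 by rewrite !mulr_gt0// powR_gt0.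
exists (D1 + D2) => [|f [fL fB]]; first exact: addr_gt0.
have [mf _] := fL; have [l0 fl0] := Lvar_lux_le mq q1 fL.
have fi := lux_le_L1 mq q1 mf fl0.
have Ji := integrable_bessel_integral hbeta fi.
have [mJ _] := (integrable_realP _ _).1 Ji.
have potE : bessel_potential beta f = fun x => (Gamma beta)^-1 * bessel_integral beta f x.
  by apply/funext => x; exact: bessel_potentialE.
have potle l : lux_le q f l -> lux_le q (bessel_potential beta f) (D1 * l).
  move=> fl; rewrite potE -mulrA.
  exact: (lux_leZl mq q1 _ mJ (Jle _ _ mf fl)).
(* The slack [e] turns the bound on the Luxemburg norm into a strict one, hence into an admissible
   level; it also keeps that level positive when [A = 0]. *)
have Dpot (A : R) : besov_bound alpha p f A -> forall e : R, 0 < e ->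
    forall t, 0 < t -> lux_le q (dt_poisson_hermite k t (bessel_potential beta f))
      (D2 * (A + e) * t `^ (- k%:R + (alpha + beta))).
  move=> fA e e0; have A0 := besov_bound_ge0 fA.
  have Ae0 : 0 < A + e by rewrite ltr_wpDl.
  have Dk0 t : 0 < t -> lux_le q (dt_poisson_hermite k0 t f)
      ((A + e) * t `^ (- k0%:R + alpha)).
    move=> t0; apply: (lux_norm_lt mq q1).
      exact: ((integrable_realP _ _).1 (integrable_dt_poisson_hermite k0 t0 fi)).1.
    apply: le_lt_trans (fA t t0) _.
    by rewrite lte_fin ltr_pM2r ?powR_gt0// ltrDl.
  have Dk t : 0 < t -> lux_le q (dt_poisson_hermite k t f)
      (K1 * 2 `^ (k%:R - alpha) * (A + e) * t `^ (- (k%:R - alpha))).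
    move=> t0; have t2 : 0 < t / 2 by rewrite divr_gt0.
    have -> : dt_poisson_hermite k t f =
        dt_poisson_hermite (k - k0) (t / 2) (dt_poisson_hermite k0 (t / 2) f).
      apply/funext => x; rewrite -{1}(subnK kk0) {1}(splitr t).
      exact: dt_poisson_hermiteD.
    have mD := ((integrable_realP _ _).1 (integrable_dt_poisson_hermite k0 t2 fi)).1.
    have := Dle _ _ _ t2 mD (Dk0 _ t2); congr (lux_le q _ _).
    have E1 : (t / 2) ^- (k - k0) * (t / 2) `^ (- k0%:R + alpha) =
        2 `^ (k%:R - alpha) * t `^ (- (k%:R - alpha)).
      rewrite -powR_mulrn ?(ltW t2)// -powRN -powRD; last by rewrite (gt_eqF t2) implybT.
      have -> : - (k - k0)%:R + (- k0%:R + alpha) = - (k%:R - alpha).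
        by rewrite natrB//; ring.
      rewrite powRM ?(ltW t0)// mulrC; congr (_ * _).
      by rewrite /powR invr_eq0 pnatr_eq0/= lnV ?posrE// mulrNN.
    by rewrite mulrACA E1 mulrACA mulrA.
  move=> t t0; rewrite potE.
  have -> : dt_poisson_hermite k t (fun x => (Gamma beta)^-1 * bessel_integral beta f x) =
      fun x => (Gamma beta)^-1 * dt_poisson_hermite k t (bessel_integral beta f) x.
    by apply/funext => x; exact: dt_poisson_hermiteZ.
  have G0 : 0 < K1 * 2 `^ (k%:R - alpha) * (A + e) by rewrite !mulr_gt0// powR_gt0.
  have := DJle k f _ fi G0 Dk t t0.
  have mDJ := ((integrable_realP _ _).1 (integrable_dt_poisson_hermite k t0 Ji)).1.
  move=> /(lux_leZl mq q1 (Gamma beta)^-1 mDJ); congr (lux_le q _ _).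
  rewrite (_ : beta - (k%:R - alpha) = - k%:R + (alpha + beta)); last by ring.
  by rewrite /D2 /c; ring.
have potB (A : R) : besov_bound alpha p f A ->
    besov_bound (alpha + beta) p (bessel_potential beta f) (D2 * A).
  move=> fA t t0; apply/lee_addgt0Pr => e e0.
  pose w := t `^ (- k%:R + (alpha + beta)).
  have w0 : 0 < w by rewrite powR_gt0.
  (* With this slack the level [D2 * (A + e / (D2 * w)) * w] is exactly [D2 * A * w + e]. *)
  have e'0 : 0 < e / (D2 * w) by rewrite divr_gt0// mulr_gt0.
  apply: le_trans (lux_norm_le (Dpot A fA _ e'0 t t0)) _.
  rewrite -EFinD lee_fin -/w le_eqVlt; apply/orP; left; apply/eqP.
  by field; rewrite !gt_eqF.
have potL : Lvar p (bessel_potential beta f).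
  apply: lux_le_Lvar (potle _ fl0); rewrite potE.
  exact: measurable_funM.
split.
  by split => //; have [A fA] := fB; exists (D2 * A); exact: potB.
rewrite /besov_norm ge0_muleDr ?lux_norm_ge0 ?besov_seminorm_ge0//.
apply: leeD.
  apply: (@le_trans _ _ (D1%:E * lux_norm p f)%E).
    by apply: le_mul_ereal_inf => // l fl; apply: lux_norm_le; exact: potle.
  by rewrite lee_wpmul2r ?lux_norm_ge0// lee_fin lerDl ltW.
apply: (@le_trans _ _ (D2%:E * besov_seminorm alpha p f)%E).
  apply: le_mul_ereal_inf => // A fA; apply: ereal_inf_lbound.
  by exists (D2 * A) => //; exact: potB.
by rewrite lee_wpmul2r ?besov_seminorm_ge0// lee_fin lerDr ltW.
Qed.
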